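(* Let $(X_n)_{n\ge1}$ be independent random vectors uniformly distributed in the discrete cube $\{-1,1\}^d$, let $X$ be a random vector in $\mathbb{R}^d$ independent of $(X_n)_{n\ge1}$, and let $Z_n=\frac{1}{\sqrt n}(X+X_1+\dots+X_n)$. Assume that $\mathbb{E}|X|<\infty$ and that the characteristic function $f(t)=\mathbb{E}\,e^{i\langle t,X\rangle}$ of $X$ satisfies $$\int_{\mathbb{R}^d}\frac{|f'(t)|}{\|t\|^{d-1}}\,dt<\infty,$$ where $\|t\|$ denotes the distance from $t\in\mathbb{R}^d$ to the lattice $\pi\mathbb{Z}^d$. If $f(\pi k)=0$ for all $k\in\mathbb{Z}^d$, $k\ne0$, then $Z_n$ have continuous densities $p_n$ such that $$\sup_{x\in\mathbb{R}^d}|p_n(x)-\varphi(x)|\to0\quad\text{as } n\to\infty.$$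
   Context: $\langle\cdot,\cdot\rangle$ and $|\cdot|$ are the canonical inner product and Euclidean norm; distances are Euclidean. $\varphi(x)=(2\pi)^{-d/2}e^{-|x|^2/2}$ is the standard normal density on $\mathbb{R}^d$. $f'=\nabla f$ is the gradient of $f$ (continuous since $\mathbb{E}|X|<\infty$) and $|f'|$ is its Euclidean norm. *)

(* Defs.v *)
From HB Require Import structures.
From mathcomp Require Import all_boot all_order all_algebra.
From mathcomp Require Import finmap complex.
From mathcomp Require Import all_classical all_reals all_analysis.

Set Implicit Arguments.
Unset Strict Implicit.
Unset Printing Implicit Defensive.

Import Order.TTheory GRing.Theory Num.Theory.
Import numFieldNormedType.Exports.

Local Open Scope classical_set_scope.
Local Open Scope ring_scope.

Definition measure_rV_display : measure_display -> measure_display.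
Proof. exact. Qed.

(* The sigma-algebra on row vectors is the one generated by the coordinate maps;
   on ['rV[R]_n] it is the Borel sigma-algebra of R^n. *)
Section measurable_rV.
Context {d} {T : sigmaRingType d}.
Variable n : nat.

Let coors : 'I_n -> 'rV[T]_n -> T := fun i x => x ord0 i.

Let rV_set0 : g_sigma_preimage coors set0.
Proof. exact: sigma_algebra0. Qed.

Let rV_setC A : g_sigma_preimage coors A -> g_sigma_preimage coors (~` A).
Proof. exact: sigma_algebraC. Qed.

Let rV_bigcup (F : _^nat) : (forall i, g_sigma_preimage coors (F i)) ->
  g_sigma_preimage coors (\bigcup_i (F i)).
Proof. exact: sigma_algebra_bigcup. Qed.

HB.instance Definition _ := @isMeasurable.Build (measure_rV_display d)
  'rV[T]_n (g_sigma_preimage coors) rV_set0 rV_setC rV_bigcup.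

End measurable_rV.

Lemma measurable_rV_coord d (T : sigmaRingType d) n (i : 'I_n) :
  measurable_fun [set: 'rV[T]_n] (fun v : 'rV[T]_n => v ord0 i).
Proof.
move=> _ Y mY; rewrite setTI; apply: sub_sigma_algebra => /=.
rewrite -bigcup_seq/=; exists i => /=; first by rewrite mem_index_enum.
by exists Y => //; rewrite setTI.
Qed.

Lemma measurable_fun_rVP d1 d2 (T1 : measurableType d1) (T2 : measurableType d2)
    n (f : T1 -> 'rV[T2]_n) :
  (forall i, measurable_fun [set: T1] (fun x => f x ord0 i)) ->
  measurable_fun [set: T1] f.
Proof.
move=> mf _ A mA; rewrite setTI.
suff : g_sigma_preimage (fun i (v : 'rV[T2]_n) => v ord0 i) `<=`
    [set B | measurable (f @^-1` B)] by apply.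
apply: smallest_sub.
  split=> /=.
  - by rewrite preimage_set0.
  - by move=> B mB; rewrite setTD preimage_setC; exact: measurableC.
  - by move=> F mF; rewrite preimage_bigcup; exact: bigcup_measurable.
move=> B; rewrite -bigcup_seq/= => -[i _ [C mC <-]].
by rewrite setTI -comp_preimage -[X in measurable X]setTI; exact: mf.
Qed.

Lemma product_measure1_sigma_finite d1 d2 (T1 : measurableType d1)
    (T2 : measurableType d2) (R : realType)
    (m1 : {sigma_finite_measure set T1 -> \bar R})
    (m2 : {sigma_finite_measure set T2 -> \bar R}) :
  sigma_finite setT (m1 \x m2)%E.
Proof.
have /sigma_finiteP[F [TF ndF Foo]] := sigma_finiteT m1.
have /sigma_finiteP[G [TG ndG Goo]] := sigma_finiteT m2.
exists (fun n => F n `*` G n).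
  rewrite -setXTT TF TG predeqE => -[x y]; split.
    move=> [/= [n _ Fnx] [k _ Gky]]; exists (maxn n k) => //; split.
    - by move: x Fnx; exact/subsetPset/ndF/leq_maxl.
    - by move: y Gky; exact/subsetPset/ndG/leq_maxr.
  by move=> [n _ []/= ? ?]; split; exists n.
move=> k; have [? ?] := Foo k; have [? ?] := Goo k.
split; first exact: measurableX.
by rewrite product_measure1E// lte_mul_pinfty// ge0_fin_numE.
Qed.

Section lebesgue_measure_rV.
Context {R : realType}.

Definition cons_rV n (xv : measurableTypeR R * 'rV[R]_n) : 'rV[R]_n.+1 :=
  \row_i oapp (xv.2 ord0) xv.1 (unlift ord0 i).

Lemma measurable_cons_rV n : measurable_fun setT (@cons_rV n).
Proof.
apply: measurable_fun_rVP => i; rewrite /cons_rV.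
under eq_fun do rewrite mxE.
case: unliftP => [j|] _ /=; last exact: measurable_fst.
exact: (measurableT_comp (measurable_rV_coord j) measurable_snd).
Qed.

HB.instance Definition _ n := isMeasurableFun.Build _ _ _ _ (@cons_rV n)
  (@measurable_cons_rV n).

Definition uncons_rV n (v : 'rV[R]_n.+1) : measurableTypeR R * 'rV[R]_n :=
  (v ord0 ord0, \row_i v ord0 (lift ord0 i)).

Lemma measurable_uncons_rV n : measurable_fun setT (@uncons_rV n).
Proof.
apply: measurable_fun_pair => /=; first exact: measurable_rV_coord.
apply: measurable_fun_rVP => i; under eq_fun do rewrite mxE.
exact: measurable_rV_coord.
Qed.

Lemma cons_rVK n : cancel (@cons_rV n) (@uncons_rV n).
Proof.
move=> [x v]; rewrite /cons_rV /uncons_rV; congr pair.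
  by rewrite mxE unlift_none.
by apply/rowP => i; rewrite !mxE liftK.
Qed.

Section step.
Variables (n : nat) (mu : {sigma_finite_measure set 'rV[R]_n -> \bar R}).

Definition lebesgue_rV_step : set 'rV[R]_n.+1 -> \bar R :=
  pushforward (@lebesgue_measure R \x mu)%E (@cons_rV n).

Let step0 : lebesgue_rV_step set0 = 0%E.
Proof. exact: measure0. Qed.

Let step_ge0 A : (0 <= lebesgue_rV_step A)%E.
Proof. exact: measure_ge0. Qed.

Let step_sigma_additive : semi_sigma_additive lebesgue_rV_step.
Proof. exact: measure_semi_sigma_additive. Qed.

HB.instance Definition _ := isMeasure.Build _ _ _ lebesgue_rV_step
  step0 step_ge0 step_sigma_additive.

Let sigma_finite_step : sigma_finite setT lebesgue_rV_step.
Proof.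
have [F FT mF] := product_measure1_sigma_finite (@lebesgue_measure R) mu.
exists (fun k => @uncons_rV n @^-1` F k).
  by rewrite -preimage_bigcup -FT preimage_setT.
move=> k; have [mFk Fk] := mF k; split.
  by rewrite -[X in measurable X]setTI; exact: measurable_uncons_rV.
rewrite /lebesgue_rV_step /pushforward -comp_preimage.
by rewrite (_ : _ \o _ = id) // funeqE => x /=; rewrite cons_rVK.
Qed.

HB.instance Definition _ :=
  Measure_isSigmaFinite.Build _ _ _ lebesgue_rV_step sigma_finite_step.

End step.

(* Lebesgue measure on R^n, as the n-fold product of the one on R. *)
Fixpoint lebesgue_rV n : {sigma_finite_measure set 'rV[R]_n -> \bar R} :=
  if n is n'.+1 return {sigma_finite_measure set 'rV[R]_n -> \bar R}
  then lebesgue_rV_step (lebesgue_rV n')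
  else dirac (0 : 'rV[R]_0).

Lemma lebesgue_rV_box n (A : 'I_n -> set R) : (forall i, measurable (A i)) ->
  lebesgue_rV n [set v : 'rV[R]_n | forall i, A i (v ord0 i)] =
  (\big[mule/1]_(i < n) lebesgue_measure (A i))%E.
Proof.
elim: n A => [|n IHn] A mA.
  rewrite big_ord0 /= diracE mem_set// => -[] //.
rewrite big_ord_recl -IHn //= /lebesgue_rV_step /pushforward.
have -> : cons_rV (n:=n) @^-1` [set v : 'rV[R]_n.+1 | forall i, A i (v ord0 i)] =
    A ord0 `*` [set v : 'rV[R]_n | forall i, A (lift ord0 i) (v ord0 i)].
  apply/seteqP; split=> -[x v] /=.
    move=> Av; split; first by have := Av ord0; rewrite mxE unlift_none.
    by move=> i; have := Av (lift ord0 i); rewrite mxE liftK.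
  move=> [Ax Av] i; rewrite mxE.
  by case: unliftP => [j|] -> //=.
rewrite product_measure1E //=; first exact: mA.
rewrite (_ : mkset _ = \bigcap_(i in [set: 'I_n])
    (fun v : 'rV[R]_n => v ord0 i) @^-1` A (lift ord0 i)); last first.
  by apply/seteqP; split=> v /= Av i; [move=> _; exact: Av|exact: (Av i I)].
apply: fin_bigcap_measurable => // i _.
rewrite -[X in measurable X]setTI.
by apply: measurable_rV_coord.
Qed.

End lebesgue_measure_rV.

Section euclidean.
Context {R : realType} {d : nat}.
Implicit Types u v t x : 'rV[R]_d.

Definition dotrV u v : R := \sum_(i < d) u ord0 i * v ord0 i.

(* The library norm [`|v|] on ['rV[R]_d] is the sup norm. *)
Definition enorm v : R := Num.sqrt (dotrV v v).

Definition dist_pi_lattice t : R :=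
  inf [set enorm (t - pi *: map_mx intr k) | k in [set: 'rV[int]_d]].

Definition cenorm (z : 'rV[R[i]]_d) : R :=
  Num.sqrt (\sum_(j < d) Normc.normc (z ord0 j) ^+ 2).

Definition normal_density x : R :=
  (2 * pi) `^ (- (d%:R / 2)) * expR (- (enorm x ^+ 2 / 2)).

Definition cgradient (f : 'rV[R]_d -> R[i]) t : 'rV[R[i]]_d :=
  \row_j (('D_(delta_mx ord0 j) (fun s => complex.Re (f s)) t : R)
           +i* ('D_(delta_mx ord0 j) (fun s => complex.Im (f s)) t : R))%C.

Definition discrete_cube : set 'rV[R]_d :=
  [set s : 'rV[R]_d | forall j, s ord0 j = 1 \/ s ord0 j = -1].

End euclidean.

Section probability.
Context {R : realType} {dO : measure_display} {Omega : measurableType dO}.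
Variable P : probability Omega R.

Definition mutually_independent {d'} {T : measurableType d'}
    (xi : nat -> {RV P >-> T}) :=
  forall (J : {fset nat}) (A : nat -> set T), (forall j, measurable (A j)) ->
  P (\bigcap_(j in [set` J]) (xi j @^-1` A j)) =
  (\big[mule/1]_(j <- J) P (xi j @^-1` A j))%E.

Definition independent_of_sequence {d1 d2} {T1 : measurableType d1}
    {T2 : measurableType d2} (X : {RV P >-> T1}) (xi : nat -> {RV P >-> T2}) :=
  forall (A : set T1) (B : set Omega), measurable A ->
  <<s \bigcup_n preimage_set_system setT (xi n) measurable >> B ->
  P (X @^-1` A `&` B) = (P (X @^-1` A) * P B)%E.

Context {d : nat}.

Definition uniform_on_cube (Y : {RV P >-> 'rV[R]_d}) :=
  forall s, discrete_cube s -> P (Y @^-1` [set s]) = ((2 ^+ d)^-1)%:E.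

Definition expi (x : R) : R[i] := (cos x +i* sin x)%C.

Definition cexpectation (f : Omega -> R[i]) : R[i] :=
  (fine 'E_P[fun w => complex.Re (f w)] +i* fine 'E_P[fun w => complex.Im (f w)])%C.

Definition charfun (X : {RV P >-> 'rV[R]_d}) (t : 'rV[R]_d) : R[i] :=
  cexpectation (fun w => expi (dotrV t (X w))).

(* [xi k] stands for X_(k+1), so the sum ranges over X_1, ..., X_n. *)
Definition normalized_sum (X : {RV P >-> 'rV[R]_d})
    (xi : nat -> {RV P >-> 'rV[R]_d}) (n : nat) (w : Omega) : 'rV[R]_d :=
  (Num.sqrt n%:R)^-1 *: (X w + \sum_(k < n) xi k w).

Definition has_density (Z : Omega -> 'rV[R]_d) (p : 'rV[R]_d -> R) :=
  [/\ measurable_fun setT p, forall x, 0 <= p x &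
      forall A, measurable A ->
        P (Z @^-1` A) = (\int[lebesgue_rV d]_(x in A) (p x)%:E)%E].

End probability.

(* Main.v *)
(**
Write f(t) = E exp(i<t,X>).  The characteristic function of Z_n is
f(s) (cos s_1 ... cos s_d)^n with s = t / sqrt n; Fourier inversion reduces the
theorem to the convergence of its L^1 distance to exp(-|t|^2/2) to 0.

On the cube |s_j| <= pi/2 one has |cos s_1 ... cos s_d|^n <= exp(-|t|^2/8), and
dominated convergence applies.  The rest of the space is cut into translates of
this cube by pi k, k <> 0, where the product of cosines is pi-periodic up to
sign and is bounded by C (1 + n|u|^2)^(-(d+2)/2), u = s - pi k.  As f(pi k) = 0,
|f(pi k + u)| <= |u| int_0^1 |f'(pi k + r u)| dr; after Tonelli and the change of
variables v = r u the integral over r is explicit, and the contribution of all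
these cubes, including the Jacobian n^(d/2), is at most a constant times
the integral of |f'(t)| ||t||^(1-d) rho_n(||t||) with 0 <= rho_n <= 1 and
rho_n -> 0 pointwise.  The hypothesis on f' and dominated convergence conclude.
With n = 1 and no cosines the same bound shows that f is integrable.

Inversion is proved by smoothing with a Gaussian: the law of Z + eG has an
explicit density, and e tends to 0 against continuous functions.

Complex exponentials are avoided: [cosE P a Y t] is E cos(a + <t,Y>), so the real
and imaginary parts of the characteristic function are the cases a = 0 and
a = -pi/2.
*)

From HB Require Import structures.
Require Import Defs.
From mathcomp Require Import all_boot all_order all_algebra.
From mathcomp Require Import finmap complex.
From mathcomp Require Import all_classical all_reals all_analysis.
From mathcomp Require Import measurable_realfun.
From mathcomp Require Import lebesgue_integral_under.
From mathcomp Require Import ring lra zify.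

Import Order.TTheory GRing.Theory Num.Theory.
Import numFieldNormedType.Exports.

Local Open Scope classical_set_scope.
Local Open Scope ring_scope.

(** * Lebesgue measure on row vectors *)

(** The exponent [d + 2] in the bound on the cosines is dictated by the integral along rays. Under
    [u = v / r] the Jacobian gives [r^(-d)], the factor [|u|] gives [r^(-1)], and the weight gives
    [r^(d+2)] times [(r^2 + n |v|^2)^(-(d+2)/2)]. Exactly one power of [r] survives, so the kernel
    has the primitive [-(1/d) (r^2 + n |v|^2)^(-d/2)]. Between 0 and 1 it yields [n^(-d/2) |v|^(-d)]
    up to [1/d] and a factor in [[0, 1]]: the power of [n] cancels the Jacobian of the rescaling by
    [sqrt n], and the remaining [|v|] produces the exponent [1 - d] of the hypothesis.

    The central cell escapes this argument because [f(0) = 1]; there the boundedness of [f] and the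
    Gaussian decay of the cosines suffice.

    Interchanges of integrals are made for nonnegative integrands: [cos] is replaced by [1 + cos]
    and the constant is cancelled afterwards. Uniformity in [x] comes for free, since translating by
    [x] only changes the phase [a], and the domination used in the inversion holds for every
    phase. *)

Section measurability_rV.
Context {R : realType} {n : nat} {d : measure_display} {T : measurableType d}.
Implicit Types f g : T -> 'rV[R]_n.

Lemma measurable_fun_coord f (mf : measurable_fun setT f) i :
  measurable_fun setT (fun w => f w ord0 i).
Proof. exact: (measurableT_comp (measurable_rV_coord i) mf). Qed.

Lemma measurable_fun_addrV f g : measurable_fun setT f -> measurable_fun setT g ->
  measurable_fun setT (fun w => f w + g w).
Proof.
move=> mf mg; apply: measurable_fun_rVP => i.
under eq_fun do rewrite mxE.
by apply: measurable_funD; exact: measurable_fun_coord.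
Qed.

Lemma measurable_fun_scalerV (c : T -> R) f : measurable_fun setT c ->
  measurable_fun setT f -> measurable_fun setT (fun w => c w *: f w).
Proof.
move=> mc mf; apply: measurable_fun_rVP => i.
under eq_fun do rewrite mxE.
by apply: measurable_funM => //; exact: measurable_fun_coord.
Qed.

Lemma measurable_fun_dotrV f g : measurable_fun setT f -> measurable_fun setT g ->
  measurable_fun setT (fun w => dotrV (f w) (g w)).
Proof.
move=> mf mg; apply: measurable_sum => i.
by apply: measurable_funM; exact: measurable_fun_coord.
Qed.

Lemma measurable_fun_enorm f : measurable_fun setT f ->
  measurable_fun setT (fun w => enorm (f w)).
Proof.
move=> mf; have ms : measurable_fun setT (@Num.sqrt R).
  apply: continuous_measurable_fun; exact: sqrt_continuous.
have md := measurable_fun_dotrV _ _ mf mf.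
rewrite /enorm.
exact: (measurableT_comp ms md).
Qed.

End measurability_rV.

Section lebesgue_rV_integral.
Context {R : realType}.
Local Open Scope ereal_scope.
Local Notation mu := (@lebesgue_measure R).

Lemma ge0_integral_rVS n (g : 'rV[R]_n.+1 -> \bar R) :
  measurable_fun setT g -> (forall x, 0 <= g x) ->
  \int[lebesgue_rV n.+1]_x g x =
  \int[mu]_x \int[lebesgue_rV n]_v g (cons_rV (x, v)).
Proof.
move=> mg g0.
transitivity (\int[(mu \x lebesgue_rV n)]_z (g \o (@cons_rV R n)) z).
  rewrite -[in RHS](preimage_setT (@cons_rV R n)).
  by rewrite -ge0_integral_pushforward.
rewrite fubini_tonelli1//; last by move=> x; exact: g0.
by apply: measurableT_comp => //; exact: measurable_cons_rV.
Qed.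

(** The image of Lebesgue measure under [x |-> a + c x], multiplied by [c], agrees with Lebesgue
    measure on half-open intervals, hence everywhere by uniqueness. *)
Lemma ge0_integral_affine (g : R -> \bar R) (a c : R) : (0 < c)%R ->
  measurable_fun setT g -> (forall x, 0 <= g x) ->
  \int[mu]_x g (a + c * x)%R = (c^-1)%:E * \int[mu]_x g x.
Proof.
move=> c0 mg g0.
pose h : measurableTypeR R -> measurableTypeR R := fun x => (a + c * x)%R.
have mh : measurable_fun setT h.
  by apply: measurable_funD => //; exact: measurable_funM.
have c0' : (0 <= c^-1)%R by rewrite invr_ge0 ltW.
have E : forall A : set R, measurable A ->
    pushforward mu h A = mscale (NngNum c0') mu A.
  have := @lebesgue_measure_unique R
    (mscale (NngNum (ltW c0)) (pushforward mu h)).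
  move=> H A mA; rewrite /mscale/= H//.
    by rewrite /mscale/= muleA -EFinM mulVf ?mul1e// gt_eqF.
  move=> _ [[x y]] _ <-/=; rewrite /mscale/= /pushforward.
  have -> : h @^-1` `]x, y] = [set` `](x - a) / c, (y - a) / c]]%R.
    apply/seteqP; split=> z /=; rewrite !in_itv/= /h ltr_pdivrMr// ler_pdivlMr//.
      by move=> /andP[? ?]; apply/andP; split; lra.
    by move=> /andP[? ?]; apply/andP; split; lra.
  rewrite lebesgue_measure_itv lebesgue_measure_itv/= !lte_fin.
  rewrite ltr_pM2r ?invr_gt0// ltrD2r; case: ifPn => // xy; last by rewrite mule0.
  by rewrite -!EFinD -EFinM; congr EFin; field; rewrite gt_eqF.
transitivity (\int[pushforward mu h]_x g x).
  by rewrite ge0_integral_pushforward// preimage_setT.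
rewrite (eq_measure_integral (mscale (NngNum c0') mu)) => [|A mA _]; last exact: E.
by rewrite ge0_integral_mscale.
Qed.

Lemma measurable_cons_rVr n (x : R) :
  measurable_fun setT (fun v : 'rV[R]_n => cons_rV (x, v)).
Proof.
exact: (measurableT_comp (@measurable_cons_rV R n) (pair1_measurable x)).
Qed.

Lemma cons_rV_affine n (a : 'rV[R]_n.+1) (c x : R) (v : 'rV[R]_n) :
  (a + c *: cons_rV (x, v) =
   cons_rV (a ord0 ord0 + c * x, (\row_i a ord0 (lift ord0 i)) + c *: v))%R.
Proof.
apply/rowP => i; rewrite !mxE /=.
by case: unliftP => [j|] -> /=; rewrite ?mxE.
Qed.

(** Induction on the dimension: [cons_rV] splits off the first coordinate, the inner integral
    contributes [c^(-n)] and the outer one [c^(-1)]. Tonelli supplies the measurability of the inner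
    integral. *)
Lemma ge0_integral_rV_affine n (g : 'rV[R]_n -> \bar R) (a : 'rV[R]_n) (c : R) :
  (0 < c)%R -> measurable_fun setT g -> (forall x, 0 <= g x) ->
  \int[lebesgue_rV n]_x g (a + c *: x)%R =
  ((c ^+ n)^-1)%:E * \int[lebesgue_rV n]_x g x.
Proof.
move=> c0; elim: n g a => [|n IHn] g a mg g0.
  rewrite expr0 invr1 mul1e; apply: eq_integral => x _; congr g.
  by apply/rowP => -[].
have maff : measurable_fun setT (fun x : 'rV[R]_n.+1 => (a + c *: x)%R).
  by apply: measurable_fun_addrV => //; exact: measurable_fun_scalerV.
rewrite ge0_integral_rVS//; last exact: measurableT_comp.
rewrite ge0_integral_rVS//.
have mgc : measurable_fun setT (g \o @cons_rV R n).
  exact: measurableT_comp.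
under eq_integral => x _.
  under eq_integral do rewrite cons_rV_affine.
  rewrite (IHn (fun v => g (cons_rV (a ord0 ord0 + c * x, v)%R)))//; last first.
    exact: (measurableT_comp mg (measurable_cons_rVr _ _)).
  over.
have mF : measurable_fun setT
    (fun x : measurableTypeR R => \int[lebesgue_rV n]_v g (cons_rV (x, v))).
  exact: (measurable_fun_fubini_tonelli_F (m2 := lebesgue_rV n)
    (g \o @cons_rV R n) mgc (fun=> g0 _)).
have maff1 : measurable_fun setT
    (fun x : measurableTypeR R => (a ord0 ord0 + c * x)%R : measurableTypeR R).
  by apply: measurable_funD => //; exact: measurable_funM.
rewrite (ge0_integralZl mu measurableT (measurableT_comp mF maff1)); last 2 first.
- by move=> x _; apply: integral_ge0.
- by rewrite lee_fin invr_ge0 exprn_ge0// ltW.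
rewrite (ge0_integral_affine (fun x => \int[lebesgue_rV n]_v g (cons_rV (x, v)))) //.
  by rewrite muleA -EFinM exprSr invfM.
by move=> x; apply: integral_ge0.
Qed.

End lebesgue_rV_integral.

(** * Continuity and Borel sets on row vectors *)

Section topology_rV.
Context {R : realType} {n : nat}.

(** Dominated convergence speaks of sequences, so the continuity of integral transforms is obtained
    in this form. If it failed, some [e] would admit points [u k] in the balls of radius [1/(k+1)]
    whose values stay at least [e] away. *)
Lemma sequentially_continuous_rV (f : 'rV[R]_n -> R) (x : 'rV[R]_n) :
  (forall u : nat -> 'rV[R]_n,
    (forall i, u k ord0 i @[k --> \oo] --> x ord0 i) ->
    f (u k) @[k --> \oo] --> f x) ->
  {for x, continuous f}.
Proof.
move=> H; apply/(@cvgrPdist_lt _ _ _ _ (nbhs_filter x)) => e e0.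
apply: contrapT => nH.
have : forall k : nat, exists y, ball x k.+1%:R^-1 y /\ ~ (`|f x - f y| < e).
  move=> k; apply: contrapT => /forallNP H'; apply: nH.
  apply/nbhs_ballP; exists k.+1%:R^-1 => /=; first by rewrite invr_gt0.
  by move=> y By; apply: contrapT => h; apply: (H' y).
move=> /choice[u Hu].
have /H : forall i, u k ord0 i @[k --> \oo] --> x ord0 i.
  move=> i; apply/cvgrPdist_lt => e' e'0; near=> k.
  have [[_ /(_ ord0 i) uk] _] := Hu k.
  apply: lt_trans uk _; near: k; exact: near_infty_natSinv_lt (PosNum e'0).
by move=> /cvgrPdist_lt /(_ e e0) [N _ /(_ N (leqnn _))]; apply: (Hu N).2.
Unshelve. all: by end_near. Qed.

(** The norm is the sup norm, so balls are finite intersections of coordinate preimages, and an open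
    set is the countable union of the balls with rational centre and radius [1/(k+1)] that it
    contains. *)
Lemma open_measurable_rV (O : set 'rV[R]_n) : open O -> measurable O.
Proof.
move=> oO.
pose B (z : 'rV[rat]_n * nat) : set 'rV[R]_n :=
  [set v | forall i, ball (ratr (z.1 ord0 i) : R) z.2.+1%:R^-1 (v ord0 i)].
have mB z : measurable (B z).
  rewrite (_ : B z = \bigcap_(i in [set: 'I_n])
    ((fun v : 'rV[R]_n => v ord0 i) @^-1`
      ball (ratr (z.1 ord0 i) : R) z.2.+1%:R^-1)); last first.
    by apply/seteqP; split=> v /= Av i; [move=> _; exact: Av|exact: (Av i I)].
  apply: fin_bigcap_measurable => // i _.
  rewrite -[X in measurable X]setTI; apply: measurable_rV_coord => //.
  exact: measurable_ball.
rewrite (_ : O = \bigcup_z (if `[< B z `<=` O >] then B z else set0)).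
  apply: countable_bigcupT_measurable => [|z]; first exact: countableP.
  by case: ifPn => // _; exact: measurable0.
apply/seteqP; split=> [x Ox|x [z _]]; last by case: ifPn => // /asboolP; apply.
have /nbhs_ballP[e /= e0 eO] : nbhs x O by move: oO; rewrite openE; apply.
have he : 0 < e / 2 by rewrite divr_gt0.
near \oo => k.
have : forall i, exists q : rat, ball (ratr q : R) k.+1%:R^-1 (x ord0 i).
  move=> i; have [|q] := @rat_in_itvoo R (x ord0 i) (x ord0 i + k.+1%:R^-1).
    by rewrite ltrDl invr_gt0.
  rewrite in_itv/= => /andP[q1 q2]; exists q.
  by rewrite /ball/= gtr0_norm ?subr_gt0// ltrBlDr addrC.
move=> /choice[q Hq].
exists (\row_i q i, k) => //; rewrite ifT.
  by move=> i/=; rewrite mxE; exact: Hq.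
apply/asboolP => v /= Bv; apply: eO; split => // j i.
rewrite ord1; apply: (@ball_splitr _ _ (ratr (q i) : R)).
  apply: le_ball (Hq i); apply: ltW.
  near: k; exact: (near_infty_natSinv_lt (PosNum he)).
have := Bv i; rewrite mxE; apply: le_ball; apply: ltW => /=.
near: k; exact: (near_infty_natSinv_lt (PosNum he)).
Unshelve. all: by end_near. Qed.

Lemma continuous_measurable_rV (f : 'rV[R]_n -> R) :
  continuous f -> measurable_fun setT f.
Proof.
move=> /continuousP cf; apply: (measurability _ (RGenOpens.measurableE R)).
move=> _ [_ [a [b ->] <-]]; rewrite setTI.
by apply: open_measurable_rV; apply: cf; exact: itv_open.
Qed.

End topology_rV.

(** * Gaussian Fourier transform *)

Section integrable_EFin.
Context d {T : measurableType d} {R : realType} (mu : {measure set T -> \bar R}).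

Lemma le_integrable_EFin (D : set T) (f g : T -> R) : measurable D ->
  measurable_fun D f -> (forall x, D x -> `|f x| <= g x) ->
  mu.-integrable D (EFin \o g) -> mu.-integrable D (EFin \o f).
Proof.
move=> mD mf fg; apply: le_integrable => //; first exact/measurable_EFinP.
move=> x Dx /=; rewrite lee_fin (le_trans (fg _ Dx))//.
exact: ler_norm.
Qed.

End integrable_EFin.

Section derivatives.
Context {R : realType}.
Implicit Types f : R -> R.

Lemma is_derive_comp_affine f (a b t df : R) :
  is_derive (a + t * b) 1 f df ->
  is_derive t 1 (fun s => f (a + s * b)) (df * b).
Proof.
move=> hf.
have h : is_derive t 1 (fun s => a + s * b) b.
  have -> : (fun s => a + s * b) = cst a + b *: id.
    by apply/funext => s /=; rewrite mulrC.
  have := is_deriveD (is_derive_cst a t (1 : R))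
    (is_deriveZ b (is_derive_id t (1 : R))).
  by rewrite add0r /GRing.scale /= mulr1.
exact: (@is_derive1_comp _ f (fun s => a + s * b) t df b hf h).
Qed.

Lemma is_derive_cos_affine (a b t : R) :
  is_derive t 1 (fun s => cos (a + s * b)) (- sin (a + t * b) * b).
Proof. exact: is_derive_comp_affine. Qed.

Lemma is_derive_sin_affine (a b t : R) :
  is_derive t 1 (fun s => sin (a + s * b)) (cos (a + t * b) * b).
Proof. exact: is_derive_comp_affine. Qed.

Lemma is_derive_continuous f (x df : R) :
  is_derive x 1 f df -> {for x, continuous f}.
Proof.
by move=> [fx _]; apply: differentiable_continuous; apply/derivable1_diffP.
Qed.

Lemma continuous_cos_affine (a t : R) : continuous (fun x => cos (a + t * x)).
Proof.
move=> x; have -> : (fun x => cos (a + t * x)) = (fun x => cos (a + x * t)).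
  by apply/funext => y; rewrite mulrC.
exact: is_derive_continuous (is_derive_cos_affine a t x).
Qed.

Lemma continuous_sin_affine (a t : R) : continuous (fun x => sin (a + t * x)).
Proof.
move=> x; have -> : (fun x => sin (a + t * x)) = (fun x => sin (a + x * t)).
  by apply/funext => y; rewrite mulrC.
exact: is_derive_continuous (is_derive_sin_affine a t x).
Qed.

(** The fundamental theorem on growing symmetric intervals, followed by dominated convergence; this
    provides integration by parts on the whole line. *)
Lemma integral_derivative_eq0 (F f : R -> R) :
  (forall x : R, is_derive x 1 F (f x)) -> continuous f ->
  lebesgue_measure.-integrable setT (EFin \o f) ->
  F n%:R @[n --> \oo] --> 0 -> F (- n%:R) @[n --> \oo] --> 0 ->
  (\int[lebesgue_measure]_x (f x)%:E = 0)%E.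
Proof.
move=> dF cf intf Fn FNn.
have mf : measurable_fun setT (EFin \o f) by case/integrableP: intf.
(* [n.+1] and not [n]: the fundamental theorem needs distinct endpoints. *)
pose fn (n : nat) := (EFin \o f) \_ `[- n.+1%:R, n.+1%:R].
have cvgI : (\int[lebesgue_measure]_x (fn n x) @[n --> \oo] -->
    \int[lebesgue_measure]_x (f x)%:E)%E.
  apply: (@dominated_cvg _ _ _ lebesgue_measure _ measurableT fn (EFin \o f)
    (abse \o (EFin \o f))) => //.
  - move=> n; apply/(measurable_restrictT _ _).1 => //.
    exact: measurable_funTS.
  - move=> x _; apply: cvg_near_cst; near=> n.
    rewrite /fn patchE mem_set//= in_itv/= -ler_norml.
    have : `|x| <= n%:R by near: n; exact: nbhs_infty_ger.
    by move/le_trans; apply; rewrite ler_nat.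
  - exact: integrable_abse.
  - move=> n x _; rewrite /fn patchE; case: ifPn => _; first by [].
    by rewrite abse0 abse_ge0.
have E n : (\int[lebesgue_measure]_x (fn n x) = (F n.+1%:R - F (- n.+1%:R))%:E)%E.
  rewrite -integral_mkcond EFinB; apply: continuous_FTC2.
  - by rewrite gtrN.
  - exact: continuous_subspaceT.
  - split; first by move=> x _; have [] := dF x.
      by apply: cvg_at_right_filter; exact: is_derive_continuous (dF _).
    by apply: cvg_at_left_filter; exact: is_derive_continuous (dF _).
  - by move=> x _; rewrite derive1E derive_val.
move: cvgI; rewrite (funext E) => cvgI.
have cvg0 : ((F n.+1%:R - F (- n.+1%:R))%:E @[n --> \oo] --> 0%E)%E.
  apply: cvg_EFin; first exact: nearW.
  rewrite -[X in _ --> X](subr0 0) /=.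
  apply: (@cvgB _ _ _ _ _ (fun n : nat => F n.+1%:R) (fun n : nat => F (- n.+1%:R))).
    by rewrite (cvg_shiftS (fun n => F n%:R)).
  by rewrite (cvg_shiftS (fun n => F (- n%:R))).
exact: (cvg_unique _ cvgI cvg0).
Unshelve. all: by end_near. Qed.

End derivatives.

Definition gauss {R : realType} (x : R) : R := expR (- (x ^+ 2 / 2)).

Section gaussian.
Context {R : realType}.
Local Notation mu := (@lebesgue_measure R).

Lemma is_derive_expR_sqr (c x : R) :
  is_derive x 1 (fun s => expR (c * s ^+ 2)) (2 * c * x * expR (c * x ^+ 2)).
Proof.
have h : is_derive x 1 (fun s : R => c * s ^+ 2) (2 * c * x).
  have -> : (fun s : R => c * s ^+ 2) = c *: (id * id) by apply/funext.
  have := is_deriveZ c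
    (is_deriveM (is_derive_id x (1 : R)) (is_derive_id x (1 : R))).
  rewrite /GRing.scale /= !mulr1.
  by have -> : c * (x + x) = 2 * c * x by ring.
rewrite mulrC.
exact: (@is_derive1_comp _ expR (fun s => c * s ^+ 2)).
Qed.

Lemma gaussE : gauss = (fun x : R => expR (- 2^-1 * x ^+ 2)).
Proof. by apply/funext => x; rewrite /gauss mulrC mulNr. Qed.

Lemma gauss_ge0 (x : R) : 0 <= gauss x.
Proof. exact: expR_ge0. Qed.

Lemma is_derive_gauss (x : R) : is_derive x 1 gauss (- x * gauss x).
Proof.
have := is_derive_expR_sqr (- 2^-1) x.
by rewrite gaussE (_ : 2 * _ * x = - x)//; field.
Qed.

Lemma integral_gauss_scaled (c : R) : 0 < c ->
  (\int[mu]_x (expR (- (c * x ^+ 2)))%:E = (Num.sqrt (pi / c))%:E)%E.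
Proof.
move=> c0.
have sc : 0 < Num.sqrt c by rewrite sqrtr_gt0.
have := @ge0_integral_affine R (EFin \o gauss_fun) 0 _ sc.
rewrite integralT_gauss -EFinM mulrC -sqrtrV 1?ltW// -sqrtrM ?pi_ge0// => <-.
- by apply: eq_integral => x _ /=; rewrite add0r /gauss_fun exprMn sqr_sqrtr// ltW.
- by apply/measurable_EFinP; exact: measurable_gauss_fun.
- by move=> x; rewrite lee_fin gauss_fun_ge0.
Qed.

Lemma measurable_gauss_scaled (c : R) :
  measurable_fun setT (fun x : R => expR (- (c * x ^+ 2))).
Proof.
apply: measurableT_comp => //; apply: measurable_funN.
by apply: measurable_funM => //; exact: measurable_funX.
Qed.

Lemma integrable_gauss_scaled (c : R) : 0 < c ->
  mu.-integrable setT (EFin \o (fun x => expR (- (c * x ^+ 2)))).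
Proof.
move=> c0; apply/integrableP; split.
  by apply/measurable_EFinP; exact: measurable_gauss_scaled.
under eq_integral do rewrite /= ger0_norm ?expR_ge0//.
by rewrite integral_gauss_scaled// ltry.
Qed.

Lemma integral_gauss : (\int[mu]_x (gauss x)%:E = (Num.sqrt (2 * pi))%:E)%E.
Proof.
under eq_integral do rewrite gaussE mulNr.
by rewrite integral_gauss_scaled// invrK mulrC.
Qed.

Lemma integrable_gauss : mu.-integrable setT (EFin \o gauss).
Proof.
rewrite gaussE; have := integrable_gauss_scaled 2^-1.
by rewrite invr_gt0 ltr0n => /(_ isT); under [in X in _ -> X]eq_fun do rewrite mulNr.
Qed.

Lemma measurable_gauss : measurable_fun setT (@gauss R).
Proof.
rewrite gaussE; have := measurable_gauss_scaled 2^-1.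
by under [in X in _ -> X]eq_fun do rewrite mulNr.
Qed.

(** Half of the exponent absorbs the factor: [|x| <= 1 + x^2/4 <= exp(x^2/4)], where the first
    inequality is [(1 - |x|/2)^2 >= 0]. *)
Lemma normM_gauss_le (x : R) : `|x| * gauss x <= expR (- (4^-1 * x ^+ 2)).
Proof.
have -> : gauss x = expR (- (4^-1 * x ^+ 2)) * expR (- (4^-1 * x ^+ 2)).
  by rewrite -expRD; congr expR; rewrite /gauss; field.
rewrite mulrA -[leRHS]mul1r ler_wpM2r ?expR_ge0//.
rewrite expRN ler_pdivrMr ?expR_gt0// mul1r.
apply: le_trans (expR_ge1Dx _).
rewrite -(ger0_norm (sqr_ge0 x)) normrX.
have := sqr_ge0 (1 - `|x| / 2); lra.
Qed.

Lemma integrable_normM_gauss :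
  mu.-integrable setT (EFin \o (fun x : R => `|x| * gauss x)).
Proof.
apply: (le_integrable_EFin _ _ _ _ _ _ _ _ (integrable_gauss_scaled (4^-1) _)) => //.
  by apply: measurable_funM => //; exact: measurable_gauss.
by move=> x _; rewrite ger0_norm ?normM_gauss_le// mulr_ge0// gauss_ge0.
Qed.

Lemma gauss_cvg0 : (gauss n%:R : R) @[n --> \oo] --> 0.
Proof.
apply: (@squeeze_cvgr _ _ _ _ (cst 0) (fun n : nat => n.+1%:R^-1 * 4)).
- near=> n; rewrite gauss_ge0/= /gauss expRN.
  apply: (@le_trans _ _ (n.+1%:R / 4)^-1); last by rewrite invfM invrK.
  rewrite lef_pV2 ?posrE ?divr_gt0 ?expR_gt0//.
  apply: le_trans (expR_ge1Dx _); rewrite -natr1.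
  by have := sqr_ge0 (n%:R - 1/4 : R); nra.
- exact: cvg_cst.
- rewrite -[X in _ --> X](mul0r 4); apply: cvgM; last exact: cvg_cst.
  exact: cvg_harmonic.
Unshelve. all: by end_near. Qed.

Local Notation fourier_gauss a t :=
  (\int[mu]_x (cos (a + t * x) * gauss x)).

Lemma integrableM_gauss (h : R -> R) : measurable_fun setT h ->
  (forall x, `|h x| <= 1) ->
  mu.-integrable setT (EFin \o (fun x => h x * gauss x)).
Proof.
move=> mh h1; apply: (le_integrable_EFin _ _ _ _ _ _ _ _ integrable_gauss) => //.
  by apply: measurable_funM => //; exact: measurable_gauss.
move=> x _; rewrite normrM (ger0_norm (gauss_ge0 _)).
by rewrite ler_piMl// gauss_ge0.
Qed.

Lemma measurable_cos_affine (a t : R) :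
  measurable_fun setT (fun x => cos (a + t * x)).
Proof.
apply: measurableT_comp; first by apply: continuous_measurable_fun; exact: continuous_cos.
by apply: measurable_funD => //; exact: measurable_funM.
Qed.

Lemma measurable_sin_affine (a t : R) :
  measurable_fun setT (fun x => sin (a + t * x)).
Proof.
apply: measurableT_comp; first by apply: continuous_measurable_fun; exact: continuous_sin.
by apply: measurable_funD => //; exact: measurable_funM.
Qed.

Lemma integrable_cos_gauss (a t : R) :
  mu.-integrable setT (EFin \o (fun x => cos (a + t * x) * gauss x)).
Proof.
by apply: integrableM_gauss => [|x]; [exact: measurable_cos_affine|exact: cos_max].
Qed.

Lemma integrable_sinM_gauss (a t : R) :
  mu.-integrable setT (EFin \o (fun x => sin (a + t * x) * x * gauss x)).
Proof.
apply: (le_integrable_EFin _ _ _ _ _ _ _ _ integrable_normM_gauss) => //.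
  apply: measurable_funM; last exact: measurable_gauss.
  by apply: measurable_funM => //; exact: measurable_sin_affine.
move=> x _; rewrite !normrM (ger0_norm (gauss_ge0 _)).
by rewrite ler_wpM2r ?gauss_ge0// ler_piMl// sin_max.
Qed.

(* Integration by parts: [sin (a + t x) gauss x] vanishes at infinity. *)
Lemma integral_sinM_gauss (a t : R) :
  \int[mu]_x (sin (a + t * x) * x * gauss x) = t * fourier_gauss a t.
Proof.
pose F x := sin (a + x * t) * gauss x.
pose f x := t * (cos (a + t * x) * gauss x) - sin (a + t * x) * x * gauss x.
have i1 : mu.-integrable setT (EFin \o (fun x => t * (cos (a + t * x) * gauss x))).
  have := integrableZl measurableT t (integrable_cos_gauss a t).
  by apply: eq_integrable.
have i2 := integrable_sinM_gauss a t.
have dF (x : R) : is_derive x 1 F (f x).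
  have := is_deriveM (is_derive_sin_affine a t x) (is_derive_gauss x).
  rewrite /f /GRing.scale /= (mulrC x t).
  set e := gauss x; have -> : t * (cos (a + t * x) * e) - sin (a + t * x) * x * e =
    sin (a + t * x) * (- x * e) + e * (cos (a + t * x) * t) by ring.
  by [].
have : (\int[mu]_x (f x)%:E = 0)%E.
  apply: (integral_derivative_eq0 F) => //.
  - move=> x; apply: cvgB; apply: cvgM.
    + exact: cvg_cst.
    + apply: cvgM; last exact: is_derive_continuous (is_derive_gauss x).
      exact: continuous_cos_affine.
    + apply: cvgM; last exact: cvg_id.
      exact: continuous_sin_affine.
    + exact: is_derive_continuous (is_derive_gauss x).
  - have := integrableB measurableT i1 i2.
    by apply: eq_integrable.
  - apply: norm_cvg0; apply: (@squeeze_cvgr _ _ _ _ (cst 0) _ _ _ _ _ gauss_cvg0).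
      apply: nearW => n; rewrite normr_ge0/= normrM (ger0_norm (gauss_ge0 _)).
      by rewrite ler_piMl ?gauss_ge0// sin_max.
    exact: cvg_cst.
  - apply: norm_cvg0; apply: (@squeeze_cvgr _ _ _ _ (cst 0) _ _ _ _ _ gauss_cvg0).
      apply: nearW => n; rewrite normr_ge0/= normrM (ger0_norm (gauss_ge0 _)) /gauss sqrrN -/(gauss _).
      by rewrite ler_piMl ?gauss_ge0// sin_max.
    exact: cvg_cst.
have -> : (\int[mu]_x (f x)%:E)%E =
    (\int[mu]_x (t * (cos (a + t * x) * gauss x))%:E -
     \int[mu]_x (sin (a + t * x) * x * gauss x)%:E)%E.
  by rewrite -integralB_EFin.
move=> /(congr1 fine); rewrite fineB ?integrable_fin_num//.
rewrite -/(Rintegral _ _ _) -/(Rintegral _ _ _).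
by rewrite RintegralZl//; [move=> /eqP; rewrite subr_eq0 => /eqP|exact: integrable_cos_gauss].
Qed.

(** Differentiating under the integral, with domination by [|x| gauss x], and then integrating by
    parts gives a linear differential equation in [t]. *)
Lemma is_derive_fourier_gauss (a t : R) :
  is_derive t 1 (fun s => fourier_gauss a s) (- t * fourier_gauss a t).
Proof.
have -> : - t * fourier_gauss a t = \int[mu]_x (- (sin (a + t * x) * x * gauss x)).
  rewrite mulNr -integral_sinM_gauss -mulN1r -RintegralZl//; last exact: integrable_sinM_gauss.
  by apply: eq_Rintegral => x _; rewrite mulN1r.
pose f s x := cos (a + s * x) * gauss x.
have df (s x : R) : is_derive s 1 (f ^~ x) (- (sin (a + s * x) * x * gauss x)).
  have := is_deriveM (is_derive_cos_affine a x s) (is_derive_cst (gauss x) s (1:R)).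
  by rewrite scaler0 add0r /GRing.scale/= !mulNr mulrN [gauss x * _]mulrC.
have d1f s x : partial1of2 f s x = - (sin (a + s * x) * x * gauss x).
  by rewrite partial1of2E; have [_] := df s x.
have tI : (fun s => (t - 1 < s < t + 1)) t by rewrite /= ltrBlDr ltrDl ltr01.
have H1 s : `]t - 1, t + 1[%classic s -> mu.-integrable setT (EFin \o f s).
  by move=> _; exact: integrable_cos_gauss.
have H2 s x : `]t - 1, t + 1[%classic s -> [set: R] x -> derivable (f ^~ x) s 1.
  by move=> _ _; have [] := df s x.
have H3 s x : `]t - 1, t + 1[%classic s -> [set: R] x ->
    `|partial1of2 f s x| <= `|x| * gauss x.
  move=> _ _; rewrite d1f normrN !normrM (ger0_norm (gauss_ge0 _)).
  by rewrite ler_wpM2r ?gauss_ge0// ler_piMl// sin_max.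
have tI' : `]t - 1, t + 1[%classic t by rewrite /= in_itv.
have G0 : forall x : R, 0 <= `|x| * gauss x by move=> x; rewrite mulr_ge0 ?gauss_ge0.
apply: DeriveDef.
  exact: (derivable_under_integral measurableT tI' H1 H2 G0 integrable_normM_gauss H3).
rewrite -derive1E.
rewrite (differentiation_under_integral measurableT tI' H1 H2 G0 integrable_normM_gauss H3).
by apply: eq_Rintegral => x _; exact: d1f.
Qed.

(** By the differential equation the transform times [exp(t^2/2)] is constant in [t], so its value
    at 0 determines it. *)
Lemma fourier_gaussE (a t : R) :
  fourier_gauss a t = Num.sqrt (2 * pi) * cos a * gauss t.
Proof.
pose J s := fourier_gauss a s * expR (2^-1 * s ^+ 2).
have dJ (s : R) : is_derive s 1 J 0.
  have := is_deriveM (is_derive_fourier_gauss a s) (is_derive_expR_sqr 2^-1 s).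
  rewrite /GRing.scale/=; set x := fourier_gauss a s; set e := expR _.
  by have -> : x * (2 / 2 * s * e) + e * (- s * x) = 0 by field.
have JE : J t = J 0 := is_derive_0_is_cst _ _ dJ.
have gt : gauss t * expR (2^-1 * t ^+ 2) = 1.
  by rewrite gaussE -expRD mulNr addNr expR0.
apply: (@mulIf _ (expR (2^-1 * t ^+ 2))); first by rewrite gt_eqF ?expR_gt0.
rewrite -[RHS]mulrA gt mulr1 -[LHS]/(J t) JE /J expr0n/= mulr0 expR0 mulr1.
under eq_Rintegral do rewrite mul0r addr0.
rewrite RintegralZl//; last exact: integrable_gauss.
by rewrite /Rintegral integral_gauss /= mulrC.
Qed.

End gaussian.

Section gaussian_rV.
Context {R : realType}.

Definition gaussV {n} (x : 'rV[R]_n) : R := expR (- (dotrV x x / 2)).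

Lemma gaussV_ge0 n (x : 'rV[R]_n) : 0 <= gaussV x.
Proof. exact: expR_ge0. Qed.

Lemma dotrV_cons n (t : 'rV[R]_n.+1) (x : R) (v : 'rV[R]_n) :
  dotrV t (cons_rV (x, v)) = t ord0 ord0 * x + dotrV (\row_i t ord0 (lift ord0 i)) v.
Proof.
rewrite /dotrV big_ord_recl mxE unlift_none; congr (_ + _).
by apply: eq_bigr => i _; rewrite !mxE liftK.
Qed.

Lemma gaussV_cons n (x : R) (v : 'rV[R]_n) :
  gaussV (cons_rV (x, v)) = gauss x * gaussV v.
Proof.
rewrite /gaussV /gauss -expRD dotrV_cons mxE unlift_none /=.
rewrite (_ : \row_i _ = v).
  by congr expR; field.
by apply/rowP => i; rewrite !mxE liftK.
Qed.

Lemma gaussV_split n (t : 'rV[R]_n.+1) :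
  gaussV t = gauss (t ord0 ord0) * gaussV (\row_i t ord0 (lift ord0 i)).
Proof.
rewrite -gaussV_cons; congr gaussV; apply/rowP => i; rewrite mxE /=.
by case: unliftP => [j|] -> //=; rewrite mxE.
Qed.

Lemma dotrV0l n (v : 'rV[R]_n) : dotrV 0 v = 0.
Proof. by rewrite /dotrV big1// => i _; rewrite mxE mul0r. Qed.

Lemma dotrV0 n (v : 'rV[R]_n) : dotrV v 0 = 0.
Proof. by rewrite /dotrV big1// => i _; rewrite mxE mulr0. Qed.

Lemma dotrVC n (u v : 'rV[R]_n) : dotrV u v = dotrV v u.
Proof. by apply: eq_bigr => i _; rewrite mulrC. Qed.

Lemma dotrVDr n (u v w : 'rV[R]_n) : dotrV u (v + w) = dotrV u v + dotrV u w.
Proof. by rewrite -big_split; apply: eq_bigr => i _; rewrite mxE mulrDr. Qed.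

Lemma dotrVZr n (c : R) (u v : 'rV[R]_n) : dotrV u (c *: v) = c * dotrV u v.
Proof. by rewrite /dotrV mulr_sumr; apply: eq_bigr => i _; rewrite mxE mulrCA. Qed.

Lemma dotrVZl n (c : R) (u v : 'rV[R]_n) : dotrV (c *: u) v = c * dotrV u v.
Proof. by rewrite dotrVC dotrVZr dotrVC. Qed.

Lemma dotrVNr n (u v : 'rV[R]_n) : dotrV u (- v) = - dotrV u v.
Proof. by rewrite -scaleN1r dotrVZr mulN1r. Qed.

Lemma dotrVBr n (u v w : 'rV[R]_n) : dotrV u (v - w) = dotrV u v - dotrV u w.
Proof. by rewrite dotrVDr dotrVNr. Qed.

Lemma gaussVN n (v : 'rV[R]_n) : gaussV (- v) = gaussV v.
Proof. by rewrite /gaussV dotrVNr dotrVC dotrVNr opprK. Qed.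

Lemma measurable_fun_gaussV d (T : measurableType d) n (f : T -> 'rV[R]_n) :
  measurable_fun setT f -> measurable_fun setT (fun x => gaussV (f x)).
Proof.
move=> mf.
have m : measurable_fun setT (fun x => - (dotrV (f x) (f x) / 2)).
  apply: measurable_funN.
  by apply: measurable_funM => //; exact: measurable_fun_dotrV.
exact: (measurableT_comp (@measurable_expR R) m).
Qed.

Lemma integral_rV0 (f : 'rV[R]_0 -> \bar R) : measurable_fun setT f ->
  (\int[lebesgue_rV 0]_v f v = f 0%R)%E.
Proof.
move=> mf; have := integral_dirac (0 : 'rV[R]_0) measurableT mf.
by rewrite diracE mem_set//= mul1e.
Qed.

Lemma integral_cos_gauss_lin (p q a t : R) :
  (\int[lebesgue_measure]_x ((p + q * cos (a + t * x)) * gauss x)%:E =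
   (Num.sqrt (2 * pi) * (p + q * (cos a * gauss t)))%:E)%E.
Proof.
have i1 := integrableZl measurableT p (@integrable_gauss R).
have i2 := integrableZl measurableT q (integrable_cos_gauss a t).
transitivity (\int[lebesgue_measure]_x
  (p%:E * (gauss x)%:E + q%:E * (cos (a + t * x) * gauss x)%:E))%E.
  by apply: eq_integral => x _; rewrite -!EFinM -EFinD; congr EFin; ring.
rewrite integralD// integralZl//; last exact: integrable_gauss.
rewrite integralZl//; last exact: integrable_cos_gauss.
rewrite integral_gauss.
have := congr1 (@EFin R) (fourier_gaussE a t).
rewrite [X in X = _]fineK; last exact: integrable_fin_num (integrable_cos_gauss a t).
by move=> ->; rewrite -!EFinM -EFinD; congr EFin; ring.
Qed.

(** The condition [|q| <= p] keeps the integrand nonnegative, so that coordinates can be split off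
    by Tonelli. The phase [a] varies in the induction because it absorbs the first coordinate. The
    case [q = 0] is the total mass. *)
Lemma integral_cos_gaussV n (p q a : R) (t : 'rV[R]_n) : `|q| <= p ->
  (\int[lebesgue_rV n]_v ((p + q * cos (a + dotrV t v)) * gaussV v)%:E =
   (Num.sqrt (2 * pi) ^+ n * (p + q * (cos a * gaussV t)))%:E)%E.
Proof.
move=> qp; have ge0 (b : R) : 0 <= p + q * cos b.
  rewrite addrC -(opprK p) subr_ge0; move: (cos_max b); rewrite ler_norml => /andP[c1 c2].
  by move: qp; rewrite ler_norml => /andP[h1 h2]; nra.
have mf m (b : R) (s : 'rV[R]_m) : measurable_fun setT
    (fun v : 'rV[R]_m => ((p + q * cos (b + dotrV s v)) * gaussV v)%:E).
  apply/measurable_EFinP; apply: measurable_funM; last exact: measurable_fun_gaussV.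
  apply: measurable_funD => //; apply: measurable_funM => //.
  apply: measurableT_comp; first by apply: continuous_measurable_fun; exact: continuous_cos.
  by apply: measurable_funD => //; exact: measurable_fun_dotrV.
elim: n a t => [|n IHn] a t.
  rewrite integral_rV0// expr0 mul1r.
  rewrite [t](_ : _ = 0); last by apply/rowP => -[].
  by rewrite /gaussV !dotrV0 mul0r oppr0 expR0 !mulr1 addr0.
rewrite ge0_integral_rVS//; last first.
  by move=> v; rewrite lee_fin mulr_ge0// gaussV_ge0.
pose t' := \row_i t ord0 (lift ord0 i).
transitivity (\int[lebesgue_measure]_x ((gauss x)%:E * (Num.sqrt (2 * pi) ^+ n *
  (p + q * (cos (a + t ord0 ord0 * x) * gaussV t')))%:E))%E.
  apply: eq_integral => x _.
  rewrite -IHn -ge0_integralZl//.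
  - apply: eq_integral => v _; rewrite -EFinM; congr EFin.
    by rewrite dotrV_cons gaussV_cons addrA; ring.
  - exact: mf.
  - by move=> v _; rewrite lee_fin mulr_ge0// gaussV_ge0.
  - by rewrite lee_fin gauss_ge0.
transitivity (\int[lebesgue_measure]_x ((Num.sqrt (2 * pi) ^+ n * p +
   Num.sqrt (2 * pi) ^+ n * q * gaussV t' * cos (a + t ord0 ord0 * x)) * gauss x)%:E)%E.
  by apply: eq_integral => x _; rewrite -EFinM; congr EFin; ring.
rewrite integral_cos_gauss_lin (gaussV_split _ t) -/t' exprS.
by congr EFin; ring.
Qed.

Lemma integral_gaussV n :
  (\int[lebesgue_rV n]_v (gaussV v)%:E = (Num.sqrt (2 * pi) ^+ n)%:E)%E.
Proof.
have := @integral_cos_gaussV n 1 0 0 0.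
rewrite normr0 ler01 mul0r addr0 mulr1 => <-//.
by apply: eq_integral => v _; rewrite mul0r addr0 mul1r.
Qed.

Lemma integrable_gaussV n : (lebesgue_rV n).-integrable setT (EFin \o gaussV).
Proof.
apply/integrableP; split; first by apply/measurable_EFinP; exact: measurable_fun_gaussV.
under eq_integral do rewrite /= ger0_norm ?gaussV_ge0//.
by rewrite integral_gaussV ltry.
Qed.

End gaussian_rV.

(** * Densities and open boxes *)

Section density_measure.
Context d {T : measurableType d} {R : realType} (mu : {measure set T -> \bar R}).
Variables (f : T -> R) (mf : measurable_fun setT f) (f0 : forall x, 0 <= f x).

(** The two proofs are arguments so that the measure structure can be attached to the term
    itself. *)
Definition density_measure of measurable_fun setT f & (forall x, 0 <= f x) :=
  fun A : set T => (\int[mu]_(x in A) (f x)%:E)%E.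

Local Notation nu := (density_measure mf f0).

Let nu0 : nu set0 = 0%E.
Proof. by rewrite /density_measure integral_set0. Qed.

Let nu_ge0 A : (0 <= nu A)%E.
Proof. by apply: integral_ge0 => x _; rewrite lee_fin. Qed.

Let nu_sigma_additive : semi_sigma_additive nu.
Proof.
move=> /= A mA tA mUA; rewrite /density_measure ge0_integral_bigcup//=.
- apply: is_cvg_ereal_nneg_natsum_cond => n _ _.
  by apply: integral_ge0 => x _; rewrite lee_fin.
- by apply: measurable_funTS; exact/measurable_EFinP.
- by move=> x _; rewrite lee_fin.
Qed.

HB.instance Definition _ := isMeasure.Build _ _ _ nu nu0 nu_ge0 nu_sigma_additive.

End density_measure.

Section open_boxes.
Context {R : realType} {n : nat}.
Implicit Types a b : 'rV[R]_n.

Definition obox a b : set 'rV[R]_n :=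
  [set v | forall i, a ord0 i < v ord0 i < b ord0 i].

Lemma open_box_measure_lty a b : (lebesgue_rV n (obox a b) < +oo)%E.
Proof.
have -> : obox a b = [set v : 'rV[R]_n | forall i, `]a ord0 i, b ord0 i[%classic (v ord0 i)].
  by apply/seteqP; split=> v h i; have := h i; rewrite /= in_itv.
rewrite (lebesgue_rV_box (A := fun i => `]a ord0 i, b ord0 i[%classic))//.
rewrite ltey_eq prode_fin_num// => i _.
by rewrite lebesgue_measure_itv/=; case: ifP.
Qed.

(** A continuous function that is positive exactly on the box: it lets boxes be reached from
    continuous test functions. *)
Definition box_fun a b (v : 'rV[R]_n) : R :=
  \prod_(i < n) (Num.max 0 (v ord0 i - a ord0 i) * Num.max 0 (b ord0 i - v ord0 i)).

Lemma box_fun_ge0 a b v : 0 <= box_fun a b v.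
Proof. by apply: prodr_ge0 => i _; rewrite mulr_ge0// le_max lexx. Qed.

Lemma box_fun_gt0 a b : [set v | 0 < box_fun a b v] = obox a b.
Proof.
apply/seteqP; split=> v /=.
  move=> h i; have : box_fun a b v != 0 by rewrite gt_eqF.
  move=> /prodf_neq0 /(_ i isT).
  rewrite mulf_eq0 negb_or => /andP[h1 h2]; apply/andP; split.
    by rewrite ltNge; apply: contra h1 => h3; apply/eqP/max_idPl; rewrite subr_le0.
  by rewrite ltNge; apply: contra h2 => h3; apply/eqP/max_idPl; rewrite subr_le0.
move=> h; apply: prodr_gt0 => i _; have /andP[h1 h2] := h i.
by rewrite mulr_gt0// lt_max subr_gt0 ?h1 ?h2 orbT.
Qed.

Lemma continuous_box_fun a b : continuous (box_fun a b).
Proof.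
move=> v; apply: sequentially_continuous_rV => u uv.
apply: cvg_big => [|i _]; first by move=> x; exact: mul_continuous.
have cvg_max0 (s : nat -> R) (l : R) : s k @[k --> \oo] --> l ->
    Num.max 0 (s k) @[k --> \oo] --> Num.max 0 l.
  move=> sl; rewrite maxr_absE !add0r; under eq_fun do rewrite maxr_absE !add0r.
  apply: cvgM; last exact: cvg_cst.
  by apply: cvgD => //; apply: cvg_norm; exact: cvgN.
by apply: cvgM; apply: cvg_max0; apply: cvgB => //; exact: cvg_cst.
Qed.

Definition oboxes : set (set 'rV[R]_n) := [set obox a b | a in setT & b in setT].

Lemma setI_closed_oboxes : setI_closed oboxes.
Proof.
move=> _ _ [a _ [b _ <-]] [a' _ [b' _ <-]].
exists (\row_i Num.max (a ord0 i) (a' ord0 i)) => //.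
exists (\row_i Num.min (b ord0 i) (b' ord0 i)) => //.
apply/seteqP; split=> v /=.
  move=> h; split=> i; have := h i; rewrite !mxE gt_max lt_min;
  by move=> /andP[/andP[h1 h2] /andP[h3 h4]]; rewrite ?h1 ?h2 ?h3 ?h4.
move=> [h h'] i; rewrite !mxE gt_max lt_min.
by have /andP[-> ->] := h i; have /andP[-> ->] := h' i.
Qed.

Lemma bigcup_obox : \bigcup_k obox (- const_mx k%:R) (const_mx k%:R) = setT.
Proof.
rewrite -subTset => v _; near \oo => k; exists k => // i; rewrite !mxE.
rewrite -ltr_norml; apply: le_lt_trans (_ : `|v| < _).
  rewrite [in leRHS]/Num.norm/= mx_normrE.
  by apply: le_trans (le_bigmax _ _ (ord0, i)).
by near: k; exact: nbhs_infty_gtr.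
Unshelve. all: by end_near. Qed.

(** Coordinate preimages of open intervals generate, and such a preimage is the union over [k] of
    the boxes whose other sides are []-k, k[]. Conversely, boxes are open. *)
Lemma measurable_oboxesE : measurable = <<s oboxes >>.
Proof.
apply/seteqP; split; last first.
  apply: smallest_sub; first exact: sigma_algebra_measurable.
  move=> _ [a _ [b _ <-]]; rewrite -box_fun_gt0.
  apply: open_measurable_rV.
  have := continuous_box_fun a b; move/continuousP => /(_ `]0, +oo[%classic).
  rewrite (_ : _ @^-1` _ = [set v | 0 < box_fun a b v]).
    by apply; exact: rray_open.
  by apply/seteqP; split=> v /=; rewrite in_itv/= andbT.
apply: smallest_sub; first exact: smallest_sigma_algebra.
move=> B; rewrite -bigcup_seq/= => -[i _ [C mC <-]]; rewrite setTI.
suff : measurable `<=` [set D : set R | <<s oboxes >> ((fun v : 'rV[R]_n => v ord0 i) @^-1` D)].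
  by apply.
have -> : (measurable : set (set R)) = <<s @RGenOpens.G R >>.
  exact: RGenOpens.measurableE.
apply: smallest_sub.
  split=> /=.
  - by rewrite preimage_set0; exact: sigma_algebra0.
  - by move=> D hD; rewrite setTD preimage_setC; exact: sigma_algebraC.
  - by move=> F hF; rewrite preimage_bigcup; exact: sigma_algebra_bigcup.
move=> _ [x [y ->]] /=.
have -> : (fun v : 'rV[R]_n => v ord0 i) @^-1` `]x, y[%classic =
    \bigcup_k obox (\row_j (if j == i then x else - k%:R))
                   (\row_j (if j == i then y else k%:R)).
  apply/seteqP; split=> v /=.
    rewrite in_itv/= => hv.
    have : setT v by []. rewrite -bigcup_obox => -[k _ hk].
    exists k => // j; rewrite !mxE; case: eqP => [->//|_].
    by have := hk j; rewrite !mxE.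
  by move=> [k _ /(_ i)]; rewrite !mxE eqxx in_itv.
apply: sigma_algebra_bigcup => k; apply: sub_sigma_algebra.
by eexists => //; eexists.
Qed.

End open_boxes.

(** * Fourier inversion *)

Section cosine_transform.
Context {R : realType} {dO : measure_display} {Omega : measurableType dO}
  (P : probability Omega R) {d : nat}.
Implicit Types (Y : Omega -> 'rV[R]_d) (t x : 'rV[R]_d).

Definition cosE (a : R) Y t : R := \int[P]_w (cos (a + dotrV t (Y w))).

Lemma integral_cst_probability (c : R) : (\int[P]_w c%:E = c%:E)%E.
Proof. by have := expectation_cst P c; rewrite unlock. Qed.

Lemma measurable_fun_cos (s : Omega -> R) :
  measurable_fun setT s -> measurable_fun setT (fun w => cos (s w)).
Proof.
move=> ms; apply: measurableT_comp => //.
by apply: continuous_measurable_fun; exact: continuous_cos.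
Qed.

Lemma integrable_bounded (s : Omega -> R) (M : R) : measurable_fun setT s ->
  (forall w, `|s w| <= M) -> P.-integrable setT (EFin \o s).
Proof.
move=> ms sM; apply: (le_integrable_EFin _ _ _ _ (cst M)) => //.
exact: finite_measure_integrable_cst.
Qed.

Lemma integrable_cos (s : Omega -> R) : measurable_fun setT s ->
  P.-integrable setT (EFin \o (fun w => cos (s w))).
Proof.
move=> ms; apply: (integrable_bounded _ 1); first exact: measurable_fun_cos.
by move=> w; exact: cos_max.
Qed.

Lemma cvg_integral_cos (s_ : nat -> Omega -> R) (s : Omega -> R) :
  (forall k, measurable_fun setT (s_ k)) -> measurable_fun setT s ->
  (forall w, s_ k w @[k --> \oo] --> s w) ->
  \int[P]_w (cos (s_ k w)) @[k --> \oo] --> \int[P]_w (cos (s w)).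
Proof.
move=> ms_ ms s_s; apply: fine_cvg.
rewrite fineK; last by exact: integrable_fin_num (integrable_cos _ ms).
apply: (@dominated_cvg _ _ _ P _ measurableT
  (fun k w => (cos (s_ k w))%:E) (fun w => (cos (s w))%:E) (cst 1%E)) => //.
- by move=> k; apply/measurable_EFinP; exact: measurable_fun_cos.
- move=> w _; apply: cvg_EFin; first exact: nearW.
  by apply: continuous_cvg; [exact: continuous_cos|exact: s_s].
- exact: (finite_measure_integrable_cst P 1 measurableT).
- by move=> k w _; rewrite lee_fin cos_max.
Qed.

Lemma cvg_dotrV (u v : nat -> 'rV[R]_d) t x :
  (forall i, u k ord0 i @[k --> \oo] --> t ord0 i) ->
  (forall i, v k ord0 i @[k --> \oo] --> x ord0 i) ->
  dotrV (u k) (v k) @[k --> \oo] --> dotrV t x.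
Proof.
move=> ut vx; apply: cvg_big => [|i _]; last exact: cvgM.
exact: add_continuous.
Qed.

Lemma gaussV0 n : gaussV (0 : 'rV[R]_n) = 1.
Proof. by rewrite /gaussV dotrV0 mul0r oppr0 expR0. Qed.

Lemma cvg_gaussV (u : nat -> 'rV[R]_d) x :
  (forall i, u k ord0 i @[k --> \oo] --> x ord0 i) ->
  gaussV (u k) @[k --> \oo] --> gaussV x.
Proof.
move=> ux; rewrite /gaussV; apply: continuous_cvg; first exact: continuous_expR.
by apply: cvgN; apply: cvgM; [exact: cvg_dotrV|exact: cvg_cst].
Qed.

Lemma measurable_fun_phase (a : R) Y t : measurable_fun setT Y ->
  measurable_fun setT (fun w => a + dotrV t (Y w)).
Proof.
by move=> mY; apply: measurable_funD => //; exact: measurable_fun_dotrV.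
Qed.

Lemma continuous_cosE (a : R) Y : measurable_fun setT Y -> continuous (cosE a Y).
Proof.
move=> mY t; apply: sequentially_continuous_rV => u ut.
apply: cvg_integral_cos => [k||w]; try exact: measurable_fun_phase.
by apply: cvgD; [exact: cvg_cst|apply: cvg_dotrV => // i; exact: cvg_cst].
Qed.

Lemma measurable_cosE (a : R) Y : measurable_fun setT Y ->
  measurable_fun setT (cosE a Y).
Proof. by move=> mY; apply: continuous_measurable_rV; exact: continuous_cosE. Qed.

(** This is why the inversion assumes its bound [psi] for every phase: it then dominates the
    transforms of all translates [Z - x] at once. *)
Lemma cosE_shift Y x t :
  cosE 0 (fun w => Y w - x) t = cosE (- dotrV t x) Y t.
Proof.
by apply: eq_Rintegral => w _; rewrite dotrVBr add0r addrC.
Qed.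

Lemma measurable_fun_subV Y x : measurable_fun setT Y ->
  measurable_fun setT (fun w => Y w - x).
Proof. by move=> mY; apply: measurable_fun_addrV. Qed.

(* Adding [1] makes the integrands nonnegative, so that Tonelli applies. *)
Lemma integral_cosE_gaussV Y (e : R) : measurable_fun setT Y -> 0 < e ->
  (\int[lebesgue_rV d]_t ((1 + cosE 0 Y t) * gaussV (e *: t))%:E =
   ((Num.sqrt (2 * pi) / e) ^+ d)%:E *
     \int[P]_w (1 + gaussV (e^-1 *: Y w))%:E)%E.
Proof.
move=> mY e0.
pose f (z : 'rV[R]_d * Omega) : R := (1 + cos (dotrV z.1 (Y z.2))) * gaussV (e *: z.1).
have mYs : measurable_fun setT (fun z : 'rV[R]_d * Omega => Y z.2).
  exact: measurableT_comp mY measurable_snd.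
have mf : measurable_fun setT (EFin \o f).
  apply/measurable_EFinP; apply: measurable_funM.
    apply: measurable_funD => //; apply: measurableT_comp.
      by apply: continuous_measurable_fun; exact: continuous_cos.
    exact: measurable_fun_dotrV measurable_fst mYs.
  by apply: measurable_fun_gaussV; exact: measurable_fun_scalerV.
have ge0 (b : R) : 0 <= 1 + cos b by rewrite -lerBlDl sub0r cos_geN1.
have f0 z : (0 <= (EFin \o f) z)%E by rewrite lee_fin mulr_ge0// gaussV_ge0.
have fub := @fubini_tonelli _ _ _ _ _ (lebesgue_rV d) P (EFin \o f) mf f0.
transitivity (\int[lebesgue_rV d]_x \int[P]_y (EFin \o f) (x, y))%E.
  apply: eq_integral => t _; rewrite /f /=.
  have i1 := integrable_cos _ (measurable_fun_phase 0 _ t mY).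
  under [RHS]eq_integral do rewrite EFinM.
  rewrite integralZr//=; last first.
    apply: (integrable_bounded _ 2).
      apply: measurable_funD => //; apply: measurable_fun_cos.
      exact: measurable_fun_dotrV.
    by move=> w; rewrite ger0_norm// -lerBrDl (_ : 2 - 1 = 1) ?cos_le1//; lra.
  rewrite EFinM; congr (_ * _)%E.
  under eq_integral do rewrite EFinD.
  rewrite integralD//; last 2 first.
  - exact: finite_measure_integrable_cst.
  - apply: (integrable_cos (fun w => dotrV t (Y w))).
    exact: measurable_fun_dotrV.
  rewrite integral_cst_probability /cosE EFinD fineK.
    by congr (_ + _)%E; apply: eq_integral => w _; rewrite add0r.
  exact: integrable_fin_num i1.
rewrite fub -ge0_integralZl//; last 3 first.
- apply/measurable_EFinP; apply: measurable_funD => //.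
  by apply: measurable_fun_gaussV; exact: measurable_fun_scalerV.
- by move=> w _; rewrite lee_fin addr_ge0// gaussV_ge0.
- by rewrite lee_fin exprn_ge0// divr_ge0// ltW.
apply: eq_integral => w _; rewrite /f /=.
(* For fixed [w] the roles are exchanged: with [s = e t] the integral in [t] is the Gaussian
   transform at the frequency [Y w / e]. *)
pose F (s : 'rV[R]_d) := ((1 + 1 * cos (0 + dotrV (e^-1 *: Y w) s)) * gaussV s)%:E.
transitivity (\int[lebesgue_rV d]_t F (0 + e *: t)%R)%E.
  apply: eq_integral => t _; rewrite /F !add0r mul1r dotrVZl dotrVZr mulrA.
  by rewrite mulVf ?mul1r ?gt_eqF// dotrVC.
rewrite ge0_integral_rV_affine//; last 2 first.
- apply/measurable_EFinP; apply: measurable_funM; last exact: measurable_fun_gaussV.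
  apply: measurable_funD => //; apply: measurable_funM => //.
  apply: measurableT_comp; first by apply: continuous_measurable_fun; exact: continuous_cos.
  by apply: measurable_funD => //; exact: measurable_fun_dotrV.
- by move=> s; rewrite lee_fin mulr_ge0 ?gaussV_ge0// mul1r.
rewrite integral_cos_gaussV ?normr1// cos0 !mul1r -EFinM; congr EFin.
by rewrite expr_div_n mulrA [_^-1 * _]mulrC.
Qed.

Section inversion.
Variables (Z : Omega -> 'rV[R]_d) (psi : 'rV[R]_d -> R).
Hypothesis mZ : measurable_fun setT Z.
Hypothesis ipsi : (lebesgue_rV d).-integrable setT (EFin \o psi).
Hypothesis cosE_psi : forall a t, `|cosE a Z t| <= psi t.

(** The usual inversion integral of [exp(-i<t,x>)] times the characteristic function: its imaginary
    part is odd in [t] and integrates to 0, so only the cosine is kept. *)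
Definition inversion_density (x : 'rV[R]_d) : R :=
  ((2 * pi) ^+ d)^-1 * \int[lebesgue_rV d]_t (cosE 0 (fun w => Z w - x) t).

Let mZx x : measurable_fun setT (fun w => Z w - x).
Proof. exact: measurable_fun_subV. Qed.

Let cosE_le x t : `|cosE 0 (fun w => Z w - x) t| <= psi t.
Proof. by rewrite cosE_shift. Qed.

Lemma cvg_integral_psi (f_ : nat -> 'rV[R]_d -> R) (f : 'rV[R]_d -> R) :
  (forall k, measurable_fun setT (f_ k)) ->
  (forall t, f_ k t @[k --> \oo] --> f t) ->
  (forall k t, `|f_ k t| <= psi t) ->
  \int[lebesgue_rV d]_t (f_ k t) @[k --> \oo] --> \int[lebesgue_rV d]_t (f t).
Proof.
move=> mf_ f_f f_psi.
have mf : measurable_fun setT f by apply: measurable_fun_cvg mf_ _ => t _; exact: f_f.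
have f_le t : `|f t| <= psi t.
  have h : `|f_ k t| @[k --> \oo] --> `|f t| by apply: cvg_norm; exact: f_f.
  rewrite -(cvg_lim _ h)//; apply: limr_le; first by apply/cvg_ex; eexists; exact: h.
  by apply: nearW => k; exact: f_psi.
apply: fine_cvg; rewrite fineK; last first.
  apply: integrable_fin_num => //.
  exact: (le_integrable_EFin _ _ _ _ psi).
apply: (@dominated_cvg _ _ _ (lebesgue_rV d) _ measurableT
  (fun k t => (f_ k t)%:E) (fun t => (f t)%:E) (EFin \o psi)) => //.
- by move=> k; apply/measurable_EFinP.
- by move=> t _; apply: cvg_EFin; [exact: nearW|exact: f_f].
- by move=> k t _; rewrite lee_fin f_psi.
Qed.

Lemma continuous_inversion_density : continuous inversion_density.
Proof.
move=> x; apply: sequentially_continuous_rV => u ux.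
apply: cvgM; first exact: cvg_cst.
apply: cvg_integral_psi => [k|t|k t].
- exact: measurable_cosE.
- apply: cvg_integral_cos => [k||w]; try exact: measurable_fun_phase.
  apply: cvgD; first exact: cvg_cst.
  apply: cvg_dotrV => i; first exact: cvg_cst.
  under eq_fun do rewrite !mxE.
  rewrite !mxE; apply: cvgD; first exact: cvg_cst.
  by apply: cvgN; exact: ux.
- exact: cosE_le.
Qed.

Lemma measurable_inversion_density : measurable_fun setT inversion_density.
Proof. exact: continuous_measurable_rV continuous_inversion_density. Qed.

Let c : R := (Num.sqrt (2 * pi) ^+ d)^-1.

Definition smoothed_density (e : R) (x : 'rV[R]_d) : R :=
  c * (e ^+ d)^-1 * \int[P]_w (gaussV (e^-1 *: (Z w - x))).

Let integrable_gaussVZ (e : R) x :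
  P.-integrable setT (EFin \o (fun w => gaussV (e^-1 *: (Z w - x)))).
Proof.
apply: (integrable_bounded _ 1).
  by apply: measurable_fun_gaussV; exact: measurable_fun_scalerV.
move=> w; rewrite ger0_norm ?gaussV_ge0// -expR0 ler_expR oppr_le0 divr_ge0//.
by apply: sumr_ge0 => i _; rewrite -expr2 sqr_ge0.
Qed.

Lemma gaussV_le1 (y : 'rV[R]_d) : gaussV y <= 1.
Proof.
rewrite -expR0 ler_expR oppr_le0 divr_ge0//.
by apply: sumr_ge0 => i _; rewrite -expr2 sqr_ge0.
Qed.

Let sqrt2pi : Num.sqrt (2 * pi) ^+ 2 = 2 * pi :> R.
Proof. by rewrite sqr_sqrtr// mulr_ge0// pi_ge0. Qed.

Let sqrt2pi_gt0 : 0 < Num.sqrt (2 * pi) :> R.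
Proof. by rewrite sqrtr_gt0 mulr_gt0// pi_gt0. Qed.

Let measurable_gaussVe (e : R) : measurable_fun setT (fun t : 'rV[R]_d => gaussV (e *: t)).
Proof. by apply: measurable_fun_gaussV; exact: measurable_fun_scalerV. Qed.

Lemma integral_gaussV_scale (e : R) : 0 < e ->
  (\int[lebesgue_rV d]_t (gaussV (e *: t))%:E = ((Num.sqrt (2 * pi) / e) ^+ d)%:E)%E.
Proof.
move=> e0; transitivity (\int[lebesgue_rV d]_t (EFin \o gaussV) (0 + e *: t)%R)%E.
  by apply: eq_integral => t _; rewrite add0r.
rewrite ge0_integral_rV_affine//.
- by rewrite integral_gaussV -EFinM expr_div_n mulrC.
- by apply/measurable_EFinP; exact: measurable_fun_gaussV.
- by move=> t; rewrite lee_fin gaussV_ge0.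
Qed.

(** The Gaussian reproduces itself under the Fourier transform, so an average of Gaussian kernels
    becomes the inversion integral damped by [gaussV (e *: t)]. In this form the limit in [e] is
    dominated by [psi]. *)
Lemma smoothed_densityE (e : R) x : 0 < e -> smoothed_density e x =
  ((2 * pi) ^+ d)^-1 *
  \int[lebesgue_rV d]_t (cosE 0 (fun w => Z w - x) t * gaussV (e *: t)).
Proof.
move=> e0; pose Y w := Z w - x.
have ig : (lebesgue_rV d).-integrable setT (EFin \o (fun t => gaussV (e *: t))).
  apply/integrableP; split; first exact/measurable_EFinP.
  under eq_integral do rewrite /= ger0_norm ?gaussV_ge0//.
  by rewrite integral_gaussV_scale// ltry.
have icg : (lebesgue_rV d).-integrable setT
    (EFin \o (fun t => cosE 0 Y t * gaussV (e *: t))).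
  apply: (le_integrable_EFin _ _ _ _ psi) => //.
    by apply: measurable_funM => //; exact: measurable_cosE (mZx x).
  move=> t _; rewrite normrM (ger0_norm (gaussV_ge0 _ _)).
  rewrite -[leRHS]mulr1 ler_pM ?gaussV_ge0// ?gaussV_le1//.
  exact: cosE_le.
have := integral_cosE_gaussV Y e (mZx x) e0.
under eq_integral do rewrite mulrDl mul1r EFinD.
rewrite integralD// integral_gaussV_scale//.
under [X in _ = (_ * X)%E]eq_integral do rewrite EFinD.
rewrite [X in _ = (_ * X)%E]integralD//; last 2 first.
- exact: finite_measure_integrable_cst.
- exact: integrable_gaussVZ.
rewrite integral_cst_probability -[X in (_ + X)%E = _]fineK ?integrable_fin_num//.
rewrite -[X in (_ * (_ + X))%E]fineK; last exact: integrable_fin_num (integrable_gaussVZ _ _).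
rewrite -!EFinD -EFinM => -[].
(* [A] is the contribution of the constant 1 added for Tonelli; it occurs on both sides and is
   cancelled. *)
set A := _ ^+ d; rewrite (mulrDr A) mulr1 => /addrI.
rewrite -/(Rintegral _ _ _) -/(Rintegral _ _ _) => ->.
rewrite mulrA /smoothed_density; congr (_ * _).
have sd : (2 * pi) ^+ d = Num.sqrt (2 * pi) ^+ d * Num.sqrt (2 * pi) ^+ d :> R.
  by rewrite -[in LHS]sqrt2pi exprAC expr2.
rewrite /A /c sd expr_div_n; field.
by rewrite !expf_eq0 (gt_eqF sqrt2pi_gt0) (gt_eqF e0) !andbF.
Qed.

Lemma cvg_smoothed_density x :
  smoothed_density k.+1%:R^-1 x @[k --> \oo] --> inversion_density x.
Proof.
under eq_fun do rewrite smoothed_densityE ?invr_gt0//.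
apply: cvgM; first exact: cvg_cst.
apply: cvg_integral_psi => [k|t|k t].
- by apply: measurable_funM => //; exact: measurable_cosE.
- rewrite -[X in _ --> X]mulr1 -[in X in _ --> X](gaussV0 d).
  apply: cvgM; first exact: cvg_cst.
  apply: cvg_gaussV => i; rewrite mxE.
  under eq_fun do rewrite mxE.
  rewrite -(mul0r (t ord0 i)); apply: cvgM; last exact: cvg_cst.
  exact: cvg_harmonic.
- rewrite normrM (ger0_norm (gaussV_ge0 _ _)) -[leRHS]mulr1.
  by rewrite ler_pM ?gaussV_ge0// ?gaussV_le1// cosE_le.
Qed.

Lemma smoothed_density_ge0 (e : R) x : 0 <= e -> 0 <= smoothed_density e x.
Proof.
move=> e0; rewrite /smoothed_density mulr_ge0//.
  by rewrite mulr_ge0// invr_ge0 exprn_ge0.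
by apply: Rintegral_ge0 => w _; exact: gaussV_ge0.
Qed.

(** Positivity is invisible in the oscillating integral; it is inherited from the smoothed
    densities, which are averages of Gaussians. *)
Lemma inversion_density_ge0 x : 0 <= inversion_density x.
Proof.
rewrite -(cvg_lim _ (cvg_smoothed_density x))//.
apply: limr_ge; first by apply/cvg_ex; eexists; exact: cvg_smoothed_density.
by apply: nearW => k; rewrite smoothed_density_ge0.
Qed.

Lemma smoothed_density_le (e : R) x : 0 < e ->
  smoothed_density e x <= ((2 * pi) ^+ d)^-1 * \int[lebesgue_rV d]_t (psi t).
Proof.
move=> e0; rewrite smoothed_densityE// ler_wpM2l//.
  by rewrite invr_ge0 exprn_ge0// mulr_ge0// pi_ge0.
have h t : `|cosE 0 (fun w => Z w - x) t * gaussV (e *: t)| <= psi t.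
  rewrite normrM (ger0_norm (gaussV_ge0 _ _)) -[leRHS]mulr1.
  by rewrite ler_pM ?gaussV_ge0// ?gaussV_le1// cosE_le.
apply: le_Rintegral => //.
  apply: (le_integrable_EFin _ _ _ _ psi) => //.
  by apply: measurable_funM => //; exact: measurable_cosE.
by move=> t _; exact: le_trans (ler_norm _) (h t).
Qed.

(** Tonelli, then [x = Z w + e y] for fixed [w]; the Jacobian [e^d] cancels the normalization of the
    kernel. *)
Lemma integralM_smoothed_density (g : 'rV[R]_d -> R) (e : R) : 0 < e ->
  measurable_fun setT g -> (forall x, 0 <= g x) ->
  (\int[lebesgue_rV d]_x (g x * smoothed_density e x)%:E =
   c%:E * \int[P]_w \int[lebesgue_rV d]_y (g (Z w + e *: y) * gaussV y)%:E)%E.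
Proof.
move=> e0 mg g0.
pose f (z : 'rV[R]_d * Omega) : R := g z.1 * gaussV (e^-1 *: (Z z.2 - z.1)).
have mf : measurable_fun setT (EFin \o f).
  apply/measurable_EFinP; apply: measurable_funM.
    exact: measurableT_comp mg measurable_fst.
  apply: measurable_fun_gaussV; apply: measurable_fun_scalerV => //.
  apply: measurable_fun_addrV; first exact: measurableT_comp mZ measurable_snd.
  by under eq_fun do rewrite -scaleN1r; apply: measurable_fun_scalerV => //; exact: measurable_fst.
have f0 z : (0 <= (EFin \o f) z)%E by rewrite lee_fin mulr_ge0// gaussV_ge0.
have fub := @fubini_tonelli _ _ _ _ _ (lebesgue_rV d) P (EFin \o f) mf f0.
have c0 : 0 <= c by rewrite invr_ge0 exprn_ge0// ltW.
have e0' : 0 <= (e ^+ d)^-1 by rewrite invr_ge0 exprn_ge0// ltW.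
transitivity ((c * (e ^+ d)^-1)%:E *
    \int[lebesgue_rV d]_x \int[P]_w (EFin \o f) (x, w))%E.
  rewrite -ge0_integralZl//; last 3 first.
  - exact: (measurable_fun_fubini_tonelli_F (m2 := P) _ mf f0).
  - by move=> x _; apply: integral_ge0.
  - by rewrite lee_fin mulr_ge0.
  apply: eq_integral => x _; rewrite /f /=.
  under eq_integral do rewrite EFinM.
  rewrite integralZl//; last exact: integrable_gaussVZ.
  rewrite -[X in (_ * (_ * X))%E]fineK; last exact: integrable_fin_num (integrable_gaussVZ _ _).
  by rewrite -!EFinM; congr EFin; rewrite /smoothed_density mulrCA.
rewrite fub EFinM -muleA; congr (_ * _)%E.
have mG : measurable_fun setT (fun w => \int[lebesgue_rV d]_x (EFin \o f) (x, w))%E.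
  exact: (measurable_fun_fubini_tonelli_G (m1 := lebesgue_rV d) _ mf f0).
transitivity (\int[P]_w ((e ^- d)%:E * \int[lebesgue_rV d]_x (EFin \o f) (x, w)))%E.
  apply/esym/(ge0_integralZl P measurableT mG); last by rewrite lee_fin.
  by move=> w _; apply: integral_ge0 => x _; exact: (f0 (x, w)).
apply: eq_integral => w _.
transitivity (\int[lebesgue_rV d]_y
  (g (Z w + e *: y)%R * gaussV (e^-1 *: (Z w - (Z w + e *: y))))%:E)%E; last first.
  apply: eq_integral => y _; rewrite opprD addNKr scalerN scalerA mulVf ?gt_eqF//.
  by rewrite scale1r gaussVN.
rewrite (ge0_integral_rV_affine d (fun x => (EFin \o f) (x, w)))//.
exact: (measurableT_comp mf (pair2_measurable w)).
Qed.

(* The smoothed density is the density of [Z + e G] with [G] standard normal;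
   letting [e] tend to 0 identifies the law of [Z] on test functions. *)
Lemma integralM_inversion_density (g : 'rV[R]_d -> R) (D : set 'rV[R]_d) :
  continuous g -> (forall x, 0 <= g x <= 1) -> (forall x, ~ D x -> g x = 0) ->
  measurable D -> (lebesgue_rV d D < +oo)%E ->
  (\int[lebesgue_rV d]_x (g x * inversion_density x)%:E = \int[P]_w (g (Z w))%:E)%E.
Proof.
move=> cg g01 gD mD Doo.
have mg := continuous_measurable_rV _ cg.
have g0 x : 0 <= g x by case/andP: (g01 x).
have g1 x : g x <= 1 by case/andP: (g01 x).
pose M := ((2 * pi) ^+ d)^-1 * \int[lebesgue_rV d]_t (psi t).
have M0 : 0 <= M.
  apply: le_trans (smoothed_density_le 1 0 ltr01); exact: smoothed_density_ge0.
have ek k : 0 < k.+1%:R^-1 :> R by rewrite invr_gt0.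
have msd e : measurable_fun setT (smoothed_density e).
  apply: measurable_funM => //; apply: measurableT_comp => //.
  pose f (z : 'rV[R]_d * Omega) : \bar R := (gaussV (e^-1 *: (Z z.2 - z.1)))%:E.
  apply: (measurable_fun_fubini_tonelli_F (m2 := P) f) => [|z]; last first.
    by rewrite lee_fin gaussV_ge0.
  apply/measurable_EFinP/measurable_fun_gaussV; apply: measurable_fun_scalerV => //.
  apply: measurable_fun_addrV; first exact: measurableT_comp mZ measurable_snd.
  under eq_fun do rewrite -scaleN1r.
  by apply: measurable_fun_scalerV => //; exact: measurable_fst.
(* The smoothed densities are bounded by [M] and [g] vanishes off [D], so [M] times the indicator of
   [D] dominates; the finite measure of [D] enters here. *)
have lim1 : (\int[lebesgue_rV d]_x (g x * smoothed_density k.+1%:R^-1 x)%:E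
    @[k --> \oo] --> \int[lebesgue_rV d]_x (g x * inversion_density x)%:E)%E.
  apply: (@dominated_cvg _ _ _ (lebesgue_rV d) _ measurableT
    (fun k x => (g x * smoothed_density k.+1%:R^-1 x)%:E) _
    (fun x => (M * \1_D x)%:E)) => //.
  - by move=> k; apply/measurable_EFinP; apply: measurable_funM => //; exact: msd.
  - move=> x _; apply: cvg_EFin; first exact: nearW.
    by apply: cvgM; [exact: cvg_cst|exact: cvg_smoothed_density].
  - apply/integrableP; split.
      by apply/measurable_EFinP; apply: measurable_funM.
    rewrite (eq_integral (fun x => M%:E * (\1_D x)%:E)%E); last first.
      by move=> x _; rewrite gee0_abs// lee_fin mulr_ge0.
    rewrite ge0_integralZl//; first by rewrite integral_indic// setIT lte_mul_pinfty.
    exact/measurable_EFinP.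
  - move=> k x _; have sd0 : 0 <= smoothed_density k.+1%:R^-1 x.
      by apply: smoothed_density_ge0; exact: ltW.
    rewrite lee_fin ger0_norm; last exact: mulr_ge0.
    rewrite indicE; case: (boolP (x \in D)) => [/set_mem Dx|/negP].
      by rewrite mulr1 -[leRHS]mul1r ler_pM//; exact: smoothed_density_le.
    by rewrite inE => nDx; rewrite gD// mul0r mulr0.
have mF (e : R) : measurable_fun setT
    (fun z : Omega * 'rV[R]_d => (g (Z z.1 + e *: z.2) * gaussV z.2)%:E).
  apply/measurable_EFinP; apply: measurable_funM.
    apply: (measurableT_comp mg); apply: measurable_fun_addrV.
      exact: measurableT_comp mZ measurable_fst.
    by apply: measurable_fun_scalerV => //; exact: measurable_snd.
  by apply: measurable_fun_gaussV; exact: measurable_snd.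
have F0 (e : R) (z : Omega * 'rV[R]_d) : (0 <= (g (Z z.1 + e *: z.2)%R * gaussV z.2)%:E)%E.
  by rewrite lee_fin mulr_ge0// gaussV_ge0.
(* The same quantity seen from [Z]: an average of [g] around [Z w] at scale [1/(k+1)]. By continuity
   it tends to [g (Z w)] times the Gaussian mass, and that mass bounds it. *)
pose J k w := (\int[lebesgue_rV d]_y (g (Z w + k.+1%:R^-1 *: y)%R * gaussV y)%:E)%E.
have mJ k : measurable_fun setT (J k).
  exact: (measurable_fun_fubini_tonelli_F (m2 := lebesgue_rV d) _ (mF _) (F0 _)).
have J_le k w : (J k w <= (Num.sqrt (2 * pi) ^+ d)%:E)%E.
  rewrite -integral_gaussV; apply: ge0_le_integral => //.
  - by move=> y _; exact: (F0 _ (w, y)).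
  - exact: (measurableT_comp (mF _) (pair1_measurable w)).
  - by apply/measurable_EFinP; exact: measurable_fun_gaussV.
  - by move=> y _; rewrite lee_fin ler_piMl// gaussV_ge0.
have J_cvg w : (J k w @[k --> \oo] --> (g (Z w) * Num.sqrt (2 * pi) ^+ d)%:E)%E.
  rewrite EFinM -integral_gaussV -ge0_integralZl//; last 3 first.
  - by apply/measurable_EFinP; exact: measurable_fun_gaussV.
  - by move=> y _; rewrite lee_fin gaussV_ge0.
  - by rewrite lee_fin.
  apply: (@dominated_cvg _ _ _ (lebesgue_rV d) _ measurableT
    (fun k y => (g (Z w + k.+1%:R^-1 *: y)%R * gaussV y)%:E) _ (EFin \o gaussV)) => //.
  - by move=> k; exact: (measurableT_comp (mF _) (pair1_measurable w)).
  - move=> y _; rewrite -EFinM; apply: cvg_EFin; first exact: nearW.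
    apply: cvgM; last exact: cvg_cst.
    apply: continuous_cvg; first exact: cg.
    rewrite -[X in _ --> X]addr0 -(scale0r y); apply: cvgD; first exact: cvg_cst.
    by apply: cvgZ; [exact: cvg_harmonic|exact: cvg_cst].
  - exact: integrable_gaussV.
  - move=> k y _; rewrite lee_fin ger0_norm ?mulr_ge0 ?gaussV_ge0//.
    by rewrite ler_piMl// gaussV_ge0.
have lim2 : (c%:E * \int[P]_w J k w @[k --> \oo] -->
    c%:E * \int[P]_w (g (Z w) * Num.sqrt (2 * pi) ^+ d)%:E)%E.
  apply: cvgeZl => //.
  apply: (@dominated_cvg _ _ _ P _ measurableT J _
    (cst (Num.sqrt (2 * pi) ^+ d)%:E)) => //.
  - exact: finite_measure_integrable_cst.
  - move=> k w _; rewrite gee0_abs//.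
    by apply: integral_ge0 => y _; exact: (F0 _ (w, y)).
have lim1' : (c%:E * \int[P]_w J k w @[k --> \oo] -->
    \int[lebesgue_rV d]_x (g x * inversion_density x)%:E)%E.
  apply: cvg_trans lim1; apply: near_eq_cvg; apply: nearW => k.
  by rewrite integralM_smoothed_density.
rewrite (cvg_unique _ lim1' lim2)//.
have mgZ : measurable_fun setT (fun w => g (Z w)) by exact: measurableT_comp.
under eq_integral do rewrite EFinM.
rewrite ge0_integralZr//; last 2 first.
- exact/measurable_EFinP.
- by move=> w _; rewrite lee_fin.
rewrite muleCA -EFinM mulVf ?mule1//.
by rewrite expf_eq0 (gt_eqF sqrt2pi_gt0) andbF.
Qed.

Lemma inversion_density_le x :
  inversion_density x <= ((2 * pi) ^+ d)^-1 * \int[lebesgue_rV d]_t (psi t).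
Proof.
rewrite -(cvg_lim _ (cvg_smoothed_density x))//.
apply: limr_le; first by apply/cvg_ex; eexists; exact: cvg_smoothed_density.
by apply: nearW => k; rewrite smoothed_density_le// invr_gt0.
Qed.

(** The test functions [min(1, (k+1) h)] increase to the indicator of the set where [h > 0], so the
    identity for continuous functions passes to this open set. *)
Lemma law_positivity_set (h : 'rV[R]_d -> R) :
  continuous h -> (forall x, 0 <= h x) -> (lebesgue_rV d [set x | (0 < h x)%R] < +oo)%E ->
  (P (Z @^-1` [set x | (0 < h x)%R]) =
   \int[lebesgue_rV d]_(x in [set x | (0 < h x)%R]) (inversion_density x)%:E)%E.
Proof.
move=> ch h0; set O := [set x | 0 < h x] => Ooo.
have mh := continuous_measurable_rV _ ch.
have mO : measurable O.
  rewrite (_ : O = h @^-1` `]0, +oo[%classic).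
    by rewrite -[X in measurable X]setTI; apply: mh.
  by apply/seteqP; split=> v; rewrite /O /= in_itv/= andbT.
pose g k (x : 'rV[R]_d) := Num.min 1 (k.+1%:R * h x).
have g01 k x : 0 <= g k x <= 1.
  by rewrite /g le_min ler01 mulr_ge0//= ge_min lexx.
have gO k x : ~ O x -> g k x = 0.
  move=> /negP; rewrite -leNgt => hx.
  rewrite /g (_ : h x = 0); last by apply/le_anti; rewrite hx h0.
  by rewrite mulr0; apply/min_idPr; exact: ler01.
have cg k : continuous (g k).
  have cm : continuous (fun y : R => Num.min 1 (k.+1%:R * y)).
    move=> y; rewrite /continuous_at minr_absE; under eq_fun do rewrite minr_absE.
    have cy : k.+1%:R * z @[z --> y] --> k.+1%:R * y.
      by apply: cvgM; [exact: cvg_cst|exact: cvg_id].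
    apply: cvgM; last exact: cvg_cst.
    apply: cvgB; first by apply: cvgD => //; exact: cvg_cst.
    by apply: cvg_norm; apply: cvgB => //; exact: cvg_cst.
  by move=> x; exact: (continuous_comp (ch x) (cm _)).
have g_cvg x : g k x @[k --> \oo] --> (\1_O x : R).
  rewrite indicE; case: (boolP (x \in O)) => [/set_mem Ox|/negP]; last first.
    by rewrite inE => nOx; under eq_fun do rewrite gO//; exact: cvg_cst.
  apply: cvg_near_cst; near=> k; apply/min_idPl.
  rewrite -ler_pdivrMr// mul1r ltW//; apply: (@lt_trans _ _ k%:R); last by rewrite ltr_nat.
  by near: k; exact: nbhs_infty_gtr.
have mgk k : measurable_fun setT (g k) by exact: continuous_measurable_rV.
pose M := ((2 * pi) ^+ d)^-1 * \int[lebesgue_rV d]_t (psi t).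
have M0 : 0 <= M by apply: le_trans (inversion_density_le 0); exact: inversion_density_ge0.
have lim1 : (\int[lebesgue_rV d]_x (g k x * inversion_density x)%:E @[k --> \oo] -->
    \int[lebesgue_rV d]_x (\1_O x * inversion_density x)%:E)%E.
  apply: (@dominated_cvg _ _ _ (lebesgue_rV d) _ measurableT
    (fun k x => (g k x * inversion_density x)%:E) _ (fun x => (M * \1_O x)%:E)) => //.
  - move=> k; apply/measurable_EFinP; apply: measurable_funM => //.
    exact: measurable_inversion_density.
  - move=> x _; apply: cvg_EFin; first exact: nearW.
    by apply: cvgM; [exact: g_cvg|exact: cvg_cst].
  - apply/integrableP; split.
      by apply/measurable_EFinP; apply: measurable_funM.
    rewrite (eq_integral (fun x => M%:E * (\1_O x)%:E)%E); last first.
      by move=> x _; rewrite gee0_abs// lee_fin mulr_ge0.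
    rewrite ge0_integralZl//; first by rewrite integral_indic// setIT lte_mul_pinfty.
    exact/measurable_EFinP.
  - move=> k x _; have /andP[gx0 gx1] := g01 k x.
    rewrite lee_fin ger0_norm; last by rewrite mulr_ge0// inversion_density_ge0.
    rewrite indicE; case: (boolP (x \in O)) => [_|/negP].
      by rewrite mulr1 -[leRHS]mul1r ler_pM// ?inversion_density_ge0// inversion_density_le.
    by rewrite inE => nOx; rewrite gO// mul0r mulr0.
have lim2 : (\int[P]_w (g k (Z w))%:E @[k --> \oo] --> \int[P]_w (\1_O (Z w))%:E)%E.
  apply: (@dominated_cvg _ _ _ P _ measurableT
    (fun k w => (g k (Z w))%:E) _ (cst 1%E)) => //.
  - by move=> k; apply/measurable_EFinP; exact: measurableT_comp.
  - by move=> w _; apply: cvg_EFin; [exact: nearW|exact: g_cvg].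
  - exact: (finite_measure_integrable_cst P 1 measurableT).
  - by move=> k w _; have /andP[gx0 gx1] := g01 k (Z w); rewrite lee_fin ger0_norm.
have lim1' : (\int[P]_w (g k (Z w))%:E @[k --> \oo] -->
    \int[lebesgue_rV d]_x (\1_O x * inversion_density x)%:E)%E.
  apply: cvg_trans lim1; apply: near_eq_cvg; apply: nearW => k.
  by rewrite (integralM_inversion_density _ O)//; exact: gO.
have E : (\int[lebesgue_rV d]_x (\1_O x * inversion_density x)%:E =
    \int[P]_w (\1_O (Z w))%:E)%E.
  by apply: (cvg_unique _ lim1' lim2).
transitivity (\int[P]_w (\1_O (Z w))%:E)%E.
  have mZO : measurable (Z @^-1` O).
    by rewrite -[X in measurable X]setTI; exact: mZ.
  by have := integral_indic P measurableT mZO; rewrite setIT => <-.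
rewrite -E [RHS]integral_mkcond; apply: eq_integral => x _.
by rewrite patchE indicE; case: ifP => _; rewrite ?mul1r// mul0r.
Unshelve. all: by end_near. Qed.

(** Open boxes generate and are stable under intersection, and the law and the density measure agree
    on them because a box is the positivity set of a [box_fun]. The boxes []-k, k[^d] exhaust the
    space with finite mass, so uniqueness of measures applies. *)
Theorem has_density_inversion_density : has_density P Z inversion_density.
Proof.
split; [exact: measurable_inversion_density|exact: inversion_density_ge0|].
move=> A mA.
pose mp := measurable_inversion_density.
pose m2 := density_measure _ (lebesgue_rV d) _ mp inversion_density_ge0.
rewrite -[RHS]/(m2 A).
apply: (measure_unique (@oboxes R d) (fun k => obox (- const_mx k%:R) (const_mx k%:R))
  measurable_oboxesE setI_closed_oboxes _ bigcup_obox (pushforward P Z) m2) => //.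
- by move=> k; exists (- const_mx k%:R) => //; exists (const_mx k%:R).
- move=> _ [a _ [b _ <-]]; rewrite -box_fun_gt0.
  apply: law_positivity_set; first exact: continuous_box_fun.
    exact: box_fun_ge0.
  by rewrite box_fun_gt0 open_box_measure_lty.
- move=> k; apply: (le_lt_trans _ (ltry 1)); apply: probability_le1.
  rewrite -[X in measurable X]setTI; apply: mZ => //.
  rewrite measurable_oboxesE; apply: sub_sigma_algebra.
  by exists (- const_mx k%:R) => //; exists (const_mx k%:R).
Qed.

End inversion.
End cosine_transform.

(** * Sums of sign vectors *)

Section restriction.
Context d {T : measurableType d} {R : realType} (mu : {measure set T -> \bar R}).
Local Open Scope ereal_scope.

Lemma ge0_integral_mrestr (B : set T) (mB : measurable B) (f : T -> \bar R) :
  measurable_fun setT f -> (forall x, 0 <= f x) ->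
  \int[mrestr mu mB]_x f x = \int[mu]_(x in B) f x.
Proof.
move=> mf f0.
rewrite (@ge0_negligible_integral _ _ _ (mrestr mu mB) setT (~` B))//; last 2 first.
- exact: measurableC.
- by rewrite /= /mrestr setICl measure0.
rewrite setTD setCK; apply: eq_measure_integral => A mA AB.
by rewrite /= /mrestr setIidl.
Qed.

End restriction.

Section sign_sums.
Context {R : realType}.

Lemma expiD (x y : R) : expi (x + y) = expi x * expi y.
Proof. by rewrite /expi cosD sinD; simpc; congr (_ +i* _)%C; rewrite addrC. Qed.

Lemma expi_sum (I : Type) (r : seq I) (F : I -> R) :
  expi (\sum_(i <- r) F i) = \prod_(i <- r) expi (F i).
Proof.
elim: r => [|i r IHr]; first by rewrite !big_nil /expi cos0 sin0.
by rewrite !big_cons expiD IHr.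
Qed.

Definition signR (b : bool) : R := if b then 1 else - 1.

Lemma sum_expi_sign (x : R) : \sum_(b : bool) expi (x * signR b) = (2 * cos x)%:C%C.
Proof.
rewrite (bigD1 true)//= (bigD1 false)//= big1 ?addr0; last by case.
rewrite mulr1 mulrN1 /expi cosN sinN; apply/eqP.
by rewrite eq_complex /= addrN eqxx andbT mulr2n mulrDl mul1r.
Qed.

(** Each exponential is a product over [i], and the product of the sums over one sign expands into
    the sum over all choices of signs. Complex numbers serve only this algebra; the next two lemmas
    extract the real statements. *)
Lemma sum_expi_signs (I : finType) (x : I -> R) :
  \sum_(e : {ffun I -> bool}) expi (\sum_i x i * signR (e i)) =
  ((2 ^+ #|I| * \prod_i cos (x i)))%:C%C.
Proof.
transitivity (\sum_(e : {ffun I -> bool}) \prod_i expi (x i * signR (e i))).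
  by apply: eq_bigr => e _; rewrite expi_sum.
rewrite -(bigA_distr_bigA (fun i b => expi (x i * signR b))).
under eq_bigr do rewrite sum_expi_sign.
rewrite -rmorph_prod big_split/= prodr_const.
by [].
Qed.

Lemma sum_cos_signs (I : finType) (x : I -> R) :
  \sum_(e : {ffun I -> bool}) cos (\sum_i x i * signR (e i)) =
  2 ^+ #|I| * \prod_i cos (x i).
Proof.
have := congr1 (@complex.Re R) (sum_expi_signs I x).
by rewrite /= => <-; rewrite raddf_sum.
Qed.

Lemma sum_sin_signs (I : finType) (x : I -> R) :
  \sum_(e : {ffun I -> bool}) sin (\sum_i x i * signR (e i)) = 0.
Proof.
have := congr1 (@complex.Im R) (sum_expi_signs I x).
by rewrite raddf_sum.
Qed.

End sign_sums.

Section sum_of_cube_vectors.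
Context {R : realType} {dO : measure_display} {Omega : measurableType dO}
  (P : probability Omega R) {d : nat}.
Variables (X : {RV P >-> 'rV[R]_d}) (xi : nat -> {RV P >-> 'rV[R]_d}).
Hypothesis hxi_indep : mutually_independent xi.
Hypothesis hxi_unif : forall k, uniform_on_cube (xi k).
Hypothesis hX_indep : independent_of_sequence X xi.
Variable n : nat.

(** Independence is stated for families of sets indexed by all naturals; the default entry 1 keeps
    the vector in the cube for [k >= n]. *)
Definition signV (e : {ffun 'I_n * 'I_d -> bool}) (k : nat) : 'rV[R]_d :=
  \row_j (if insub k is Some i then signR (e (i, j)) else 1).

Lemma signV_cube e k : discrete_cube (signV e k).
Proof.
move=> j; rewrite mxE; case: insubP => [i _ _|_]; last by left.
by rewrite /signR; case: (e _); [left|right].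
Qed.

Lemma measurable_set1_rV (v : 'rV[R]_d) : measurable [set v].
Proof.
rewrite (_ : [set v] = \bigcap_(i in [set: 'I_d])
   ((fun u : 'rV[R]_d => u ord0 i) @^-1` [set v ord0 i])); last first.
  apply/seteqP; split=> u /=; first by move=> ->.
  by move=> h; apply/rowP => i; exact: (h i I).
apply: fin_bigcap_measurable => // i _.
by rewrite -[X in measurable X]setTI; exact: measurable_rV_coord.
Qed.

Definition sign_event (e : {ffun 'I_n * 'I_d -> bool}) : set Omega :=
  \bigcap_(j in [set` [fset k in iota 0 n]%fset]) (xi j @^-1` [set signV e j]).

Lemma probability_sign_event e : P (sign_event e) = ((2 ^+ (n * d))^-1)%:E.
Proof.
rewrite /sign_event (hxi_indep _ (fun j => [set signV e j])); last first.
  by move=> j; exact: measurable_set1_rV.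
under eq_bigr do rewrite (hxi_unif _ _ (signV_cube e _)).
rewrite prodEFin; congr EFin.
rewrite big_tnth prodr_const card_ord.
rewrite card_fseq undup_id ?iota_uniq// size_iota.
by rewrite exprVn -exprM mulnC.
Qed.

Lemma sign_eventP e w : sign_event e w <->
  forall k : 'I_n, xi k w = \row_j signR (e (k, j)).
Proof.
have sE (k : 'I_n) : signV e k = \row_j signR (e (k, j)).
  by apply/rowP => j; rewrite !mxE valK.
split=> [h k|h k /=].
  by rewrite -sE; apply: h; rewrite /= !inE mem_iota add0n ltn_ord.
rewrite !inE mem_iota add0n => /andP[_ kn].
by rewrite -[k]/(val (Ordinal kn)) sE h.
Qed.

Lemma sigma_sign_event e :
  <<s \bigcup_n preimage_set_system setT (xi n) measurable >> (sign_event e).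
Proof.
pose G := \bigcup_n preimage_set_system setT (xi n) measurable.
have h : finite_set [set` [fset k in iota 0 n]%fset] by exact: finite_fset.
apply: (@fin_bigcap_measurable _ (g_sigma_algebraType G) _ _ _ h) => j _.
apply: sub_sigma_algebra; exists j => //; exists [set signV e j].
  exact: measurable_set1_rV.
by rewrite setTI.
Qed.

Lemma measurable_sign_event e : measurable (sign_event e).
Proof.
apply: fin_bigcap_measurable => [|j _]; first exact: finite_fset.
by rewrite -[X in measurable X]setTI; apply: measurable_funP => //; exact: measurable_set1_rV.
Qed.

(** By independence the law of [X] under [P] restricted to the event is [2^(-nd)] times its law
    under [P]; an equality of measures carries over to integrals. *)
Lemma ge0_integral_sign_event e (g : 'rV[R]_d -> \bar R) :
  measurable_fun setT g -> (forall x, (0 <= g x)%E) ->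
  (\int[P]_(w in sign_event e) g (X w) =
   ((2 ^+ (n * d))^-1)%:E * \int[P]_w g (X w))%E.
Proof.
move=> mg g0; have mB := measurable_sign_event e.
have r0 : 0 <= (2 ^+ (n * d))^-1 :> R by rewrite invr_ge0.
rewrite -(ge0_integral_mrestr _ P _ mB); last 2 first.
- exact: measurableT_comp.
- by move=> x; exact: g0.
transitivity (\int[pushforward (mrestr P mB) X]_x g x)%E.
  by rewrite ge0_integral_pushforward// preimage_setT.
transitivity (\int[mscale (NngNum r0) (distribution P X)]_x g x)%E.
  apply: eq_measure_integral => A mA _; rewrite /= /mrestr /mscale /pushforward/=.
  rewrite (hX_indep _ _ mA (sigma_sign_event e)) -(probability_sign_event e) muleC.
  by [].
rewrite ge0_integral_mscale//; congr (_ * _)%E.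
by rewrite ge0_integral_pushforward// preimage_setT.
Qed.

Lemma trivIset_sign_event : trivIset setT sign_event.
Proof.
apply/trivIsetP => e e' _ _ ee'; apply/seteqP; split=> // w [/sign_eventP h /sign_eventP h'].
case/eqP: ee'; apply/ffunP => -[k j].
have /rowP/(_ j) : \row_j signR (e (k, j)) = \row_j signR (e' (k, j)) :> 'rV[R]_d.
  by rewrite -h h'.
rewrite !mxE /signR; case: (e _); case: (e' _) => // /eqP; rewrite ?eqNr ?oner_eq0//.
  by rewrite eq_sym eqNr oner_eq0.
Qed.

Let U := \big[setU/set0]_(e <- enum {ffun 'I_n * 'I_d -> bool}) sign_event e.

Let mU : measurable U.
Proof. by apply: bigsetU_measurable => e _; exact: measurable_sign_event. Qed.

Let card_signs : #|{: {ffun 'I_n * 'I_d -> bool}}| = (2 ^ (n * d))%N.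
Proof. by rewrite card_ffun card_bool card_prod !card_ord. Qed.

(** [uniform_on_cube] prescribes only point masses. There are [2^(nd)] disjoint sign events of
    probability [2^(-nd)], so they exhaust the probability and values off the cube are
    negligible. *)
Let PU : P U = 1%E.
Proof.
have tI := sub_trivIset (@subsetT _ [set` enum {ffun 'I_n * 'I_d -> bool}]) trivIset_sign_event.
have := ge0_integral_bigsetU P (f := cst 1%E) measurable_sign_event (enum_uniq _) tI.
move=> /(_ (measurable_cst _) (fun _ _ => lee01)).
rewrite integral_cst ?mul1e// => ->.
transitivity (\sum_(e <- enum {ffun 'I_n * 'I_d -> bool}) ((2 ^+ (n * d))^-1 : R)%:E)%E.
  apply: eq_bigr => e _; rewrite integral_cst ?mul1e; last exact: measurable_sign_event.
  exact: probability_sign_event.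
rewrite sumEFin; congr EFin; rewrite big_enum/= sumr_const card_signs.
by rewrite -[LHS]mulr_natl natrX mulfV// expf_neq0// pnatr_eq0.
Qed.

Let ge0_integral_signs (F : Omega -> \bar R) : measurable_fun setT F ->
  (forall w, (0 <= F w)%E) ->
  (\int[P]_w F w = \sum_(e : {ffun 'I_n * 'I_d -> bool}) \int[P]_(w in sign_event e) F w)%E.
Proof.
move=> mF F0.
have PUC : P (~` U) = 0%E by rewrite probability_setC// [P U]PU subee.
rewrite (ge0_negligible_integral (measurableC mU) measurableT mF _ PUC)//.
rewrite setTD setCK.
have tI := sub_trivIset (@subsetT _ [set` enum {ffun 'I_n * 'I_d -> bool}]) trivIset_sign_event.
rewrite (ge0_integral_bigsetU P measurable_sign_event (enum_uniq _) tI)//.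
  by rewrite big_enum.
exact: measurable_funTS.
Qed.

Lemma cosE_shift_phase (Y : Omega -> 'rV[R]_d) (a c : R) s : measurable_fun setT Y ->
  cosE P (a + c) Y s = cos c * cosE P a Y s - sin c * \int[P]_w (sin (a + dotrV s (Y w))).
Proof.
move=> mY; have mp := measurable_fun_phase a Y s mY.
have ic := integrable_cos P _ mp.
have isn : P.-integrable setT (EFin \o (fun w => sin (a + dotrV s (Y w)))).
  apply: (integrable_bounded P _ 1); last by move=> w; exact: sin_max.
  apply: measurableT_comp => //.
  by apply: continuous_measurable_fun; exact: continuous_sin.
rewrite /cosE -RintegralZl// -[X in _ - X]RintegralZl// -RintegralB//.
- apply: eq_Rintegral => w _.
  rewrite (_ : a + c + _ = c + (a + dotrV s (Y w))) ?cosD//; ring.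
- exact: (integrableZl measurableT (cos c) ic).
- exact: (integrableZl measurableT (sin c) isn).
Qed.

(** On a sign event the sum of the cube vectors is a fixed vector and only adds [c e] to the phase.
    By the addition formula, averaging over all signs replaces [cos (c e)] by the product of cosines
    and [sin (c e)] by 0. *)
Lemma cosE_cube_sum (a : R) (s : 'rV[R]_d) :
  cosE P a (fun w => X w + \sum_(k < n) xi k w) s =
  cosE P a X s * (\prod_j cos (s ord0 j)) ^+ n.
Proof.
pose Y w := X w + \sum_(k < n) xi k w.
have mX : measurable_fun setT (X : Omega -> 'rV[R]_d) by [].
have mY : measurable_fun setT Y.
  apply: measurable_fun_addrV => //.
  apply: measurable_fun_rVP => i; under eq_fun do rewrite summxE.
  by apply: measurable_sum => k; exact: measurable_fun_coord.
pose c (e : {ffun 'I_n * 'I_d -> bool}) := \sum_p s ord0 p.2 * signR (e p) : R.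
have ge0 (b : R) : 0 <= 1 + cos b by rewrite -lerBlDl sub0r cos_geN1.
have i1 Y' b : measurable_fun setT Y' ->
    (\int[P]_w (1 + cos (b + dotrV s (Y' w)))%:E = (1 + cosE P b Y' s)%:E)%E.
  move=> mY'; have iY := integrable_cos P _ (measurable_fun_phase b Y' s mY').
  under eq_integral do rewrite EFinD.
  rewrite integralD//; last exact: finite_measure_integrable_cst.
  rewrite integral_cst_probability EFinD fineK//.
  exact: integrable_fin_num iY.
have mphase (Y' : Omega -> 'rV[R]_d) (b : R) : measurable_fun setT Y' ->
    measurable_fun setT (fun w => (1 + cos (b + dotrV s (Y' w)))%:E).
  move=> mY'; apply/measurable_EFinP; apply: measurable_funD => //.
  by apply: measurable_fun_cos; exact: measurable_fun_phase.
have := i1 Y a mY.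
rewrite ge0_integral_signs; last 2 first.
- exact: mphase.
- by move=> w; rewrite lee_fin.
have E e : (\int[P]_(w in sign_event e) (1 + cos (a + dotrV s (Y w)))%:E =
    ((2 ^+ (n * d))^-1 * (1 + cosE P (a + c e) X s))%:E)%E.
  transitivity (\int[P]_(w in sign_event e) (1 + cos (a + c e + dotrV s (X w)))%:E)%E.
    apply: eq_integral => w; rewrite inE => /sign_eventP we; congr (1 + cos _)%:E.
    rewrite /Y dotrVDr -[RHS]addrA [c e + _]addrC; congr (_ + (_ + _)).
    transitivity (\sum_(k < n) dotrV s (xi k w)).
      by rewrite /dotrV exchange_big; apply: eq_bigr => j _; rewrite summxE mulr_sumr.
    transitivity (\sum_(k < n) \sum_(j < d) s ord0 j * signR (e (k, j))).
      by apply: eq_bigr => k _; rewrite we; apply: eq_bigr => j _; rewrite mxE.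
    by rewrite pair_bigA; apply: eq_bigr => -[k j] _.
  rewrite (ge0_integral_sign_event e (fun v => (1 + cos (a + c e + dotrV s v))%:E)).
  - by rewrite i1// EFinM.
  - apply/measurable_EFinP; apply: measurable_funD => //; apply: measurableT_comp.
      by apply: continuous_measurable_fun; exact: continuous_cos.
    by apply: measurable_funD => //; exact: measurable_fun_dotrV.
  - by move=> v; rewrite lee_fin.
rewrite (eq_bigr _ (fun e _ => E e)).
rewrite sumEFin => -[] /esym.
rewrite -/(Y _) -mulr_sumr big_split/= sumr_const card_signs.
have n2 : (2 ^ (n * d))%:R = 2 ^+ (n * d) :> R by rewrite natrX.
have n20 : 2 ^+ (n * d) != 0 :> R by rewrite expf_neq0// pnatr_eq0.
(* Removes the constant 1 that made the integrands nonnegative. *)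
rewrite n2 mulrDr mulVf// => /addrI ->.
rewrite (eq_bigr _ (fun e _ => cosE_shift_phase X a (c e) s mX)).
rewrite sumrB -!mulr_suml sum_cos_signs sum_sin_signs mul0r subr0.
rewrite card_prod !card_ord mulrA mulrA mulVf// mul1r mulrC; congr (_ * _).
rewrite -(pair_bigA _ (fun k j => cos (s ord0 j)))/=.
by rewrite prodr_const card_ord.
Qed.

End sum_of_cube_vectors.

(** * Gradient of the characteristic function *)

Section euclidean_norm.
Context {R : realType} {d : nat}.

Lemma dotrV_ge0 (v : 'rV[R]_d) : 0 <= dotrV v v.
Proof. by apply: sumr_ge0 => i _; rewrite -expr2 sqr_ge0. Qed.

Lemma enorm_ge0 (v : 'rV[R]_d) : 0 <= enorm v.
Proof. exact: sqrtr_ge0. Qed.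

Lemma enorm_sqr (v : 'rV[R]_d) : enorm v ^+ 2 = dotrV v v.
Proof. by rewrite sqr_sqrtr// dotrV_ge0. Qed.

Lemma coord_le_enorm (v : 'rV[R]_d) i : `|v ord0 i| <= enorm v.
Proof.
rewrite -sqrtr_sqr ler_wsqrtr// /dotrV (bigD1 i)//= -expr2 lerDl.
by apply: sumr_ge0 => j _; rewrite -expr2 sqr_ge0.
Qed.

Lemma enormZ (c : R) (v : 'rV[R]_d) : enorm (c *: v) = `|c| * enorm v.
Proof.
by rewrite /enorm dotrVZl dotrVZr mulrA -expr2 sqrtrM ?sqr_ge0// sqrtr_sqr.
Qed.

End euclidean_norm.

Section gradient.
Context {R : realType} {dO : measure_display} {Omega : measurableType dO}
  (P : probability Omega R) {d : nat}.
Variables (X : Omega -> 'rV[R]_d).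
Hypothesis mX : measurable_fun setT X.
Hypothesis hX_mean : P.-integrable setT (EFin \o (fun w => enorm (X w))).

(** With [phi] equal to [<v, X>] this is minus the derivative of [cosE] in direction [v]. A general
    weight lets coordinates and directions share one continuity lemma. *)
Definition sinE (phi : Omega -> R) (a : R) (t : 'rV[R]_d) : R :=
  \int[P]_w (sin (a + dotrV t (X w)) * phi w).

Let measurable_sin_phase a t : measurable_fun setT (fun w => sin (a + dotrV t (X w))).
Proof.
apply: measurableT_comp; first by apply: continuous_measurable_fun; exact: continuous_sin.
exact: measurable_fun_phase.
Qed.

Lemma integrable_sinE phi a t : P.-integrable setT (EFin \o phi) ->
  P.-integrable setT (EFin \o (fun w => sin (a + dotrV t (X w)) * phi w)).
Proof.
move=> iphi; have mphi : measurable_fun setT phi.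
  by have /integrableP[/measurable_EFinP] := iphi.
apply: (le_integrable_EFin _ _ _ _ (fun w => `|phi w|)) => //.
- exact: measurable_funM.
- by move=> w _; rewrite normrM ler_piMl// sin_max.
- exact: integrable_norm.
Qed.

Lemma continuous_sinE phi a : P.-integrable setT (EFin \o phi) ->
  continuous (sinE phi a).
Proof.
move=> iphi t; have mphi : measurable_fun setT phi.
  by have /integrableP[/measurable_EFinP] := iphi.
apply: sequentially_continuous_rV => u ut.
apply: fine_cvg; rewrite fineK; last exact: integrable_fin_num (integrable_sinE _ _ _ iphi).
apply: (@dominated_cvg _ _ _ P _ measurableT
  (fun k w => (sin (a + dotrV (u k) (X w)) * phi w)%:E) _
  (EFin \o (fun w => `|phi w|))) => //.
- by move=> k; apply/measurable_EFinP; exact: measurable_funM.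
- move=> w _; apply: cvg_EFin; first exact: nearW.
  apply: cvgM; last exact: cvg_cst.
  apply: continuous_cvg; first exact: continuous_sin.
  by apply: cvgD; [exact: cvg_cst|apply: cvg_dotrV => // i; exact: cvg_cst].
- exact: integrable_norm.
- by move=> k w _; rewrite lee_fin normrM ler_piMl// sin_max.
Qed.

Lemma integrable_coord i : P.-integrable setT (EFin \o (fun w => X w ord0 i)).
Proof.
apply: (le_integrable_EFin _ _ _ _ (fun w => enorm (X w))) => //.
  exact: measurable_fun_coord.
by move=> w _; exact: coord_le_enorm.
Qed.

Lemma integrable_dotrV v : P.-integrable setT (EFin \o (fun w => dotrV v (X w))).
Proof.
apply: (le_integrable_EFin _ _ _ _ (fun w => (\sum_i `|v ord0 i|) * enorm (X w))) => //.
- exact: measurable_fun_dotrV.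
- move=> w _; apply: le_trans (ler_norm_sum _ _ _) _; rewrite mulr_suml.
  by apply: ler_sum => i _; rewrite normrM ler_wpM2l// coord_le_enorm.
- exact: (integrableZl measurableT (\sum_i `|v ord0 i|) hX_mean).
Qed.

Lemma sinE_dotrV v a t : sinE (fun w => dotrV v (X w)) a t =
  \sum_i v ord0 i * sinE (fun w => X w ord0 i) a t.
Proof.
rewrite /sinE.
transitivity (\int[P]_w (\sum_i v ord0 i * (sin (a + dotrV t (X w)) * X w ord0 i))).
  by apply: eq_Rintegral => w _; rewrite /dotrV mulr_sumr; apply: eq_bigr => i _; ring.
rewrite /Rintegral; under eq_integral do rewrite -sumEFin.
rewrite integral_sum//; last first.
  move=> i; have := integrableZl measurableT (v ord0 i)
    (integrable_sinE _ a t (integrable_coord i)); exact.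
rewrite (eq_bigr (fun i => (v ord0 i * sinE (fun w => X w ord0 i) a t)%:E)).
  by rewrite sumEFin.
move=> i _; rewrite EFinM /sinE /Rintegral fineK.
  by rewrite -integralZl//; exact: integrable_sinE (integrable_coord i).
exact: integrable_fin_num (integrable_sinE _ a t (integrable_coord i)).
Qed.

(** Only the real parameter [h] along [v] moves, so one-variable differentiation under the integral
    applies; the derivative is dominated by [|<v, X>|], integrable since [E|X|] is finite. *)
Lemma cvg_cosE_direction (a : R) (t v : 'rV[R]_d) :
  h^-1 *: (cosE P a X (h *: v + t) - cosE P a X t) @[h --> 0^'] -->
  - sinE (fun w => dotrV v (X w)) a t.
Proof.
pose f (h : R) (w : Omega) := cos ((a + dotrV t (X w)) + h * dotrV v (X w)).
have fE h : cosE P a X (h *: v + t) = \int[P]_w f h w.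
  apply: eq_Rintegral => w _; congr cos; rewrite dotrVC dotrVDr dotrVZr dotrVC.
  by rewrite (dotrVC _ (X w)); ring.
have df (h : R) w : is_derive h 1 (f ^~ w)
    (- sin ((a + dotrV t (X w)) + h * dotrV v (X w)) * dotrV v (X w)).
  exact: is_derive_cos_affine.
have d1f h w : partial1of2 f h w =
    - sin ((a + dotrV t (X w)) + h * dotrV v (X w)) * dotrV v (X w).
  by rewrite partial1of2E; have [_] := df h w.
have mv : measurable_fun setT (fun w => dotrV v (X w)) by exact: measurable_fun_dotrV.
have H1 h : `]-1, 1[%classic h -> P.-integrable setT (EFin \o f h).
  move=> _; apply: integrable_cos; apply: measurable_funD.
    exact: measurable_fun_phase.
  exact: measurable_funM.
have H2 h w : `]-1, 1[%classic h -> setT w -> derivable (f ^~ w) h 1.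
  by move=> _ _; have [] := df h w.
have H3 h w : `]-1, 1[%classic h -> setT w -> `|partial1of2 f h w| <= `|dotrV v (X w)|.
  by move=> _ _; rewrite d1f normrM normrN ler_piMl// sin_max.
have tI : (`]-1, 1[%classic : set R) 0 by rewrite /= in_itv/= ltrN10 ltr01.
have := cvg_differentiation_under_integral measurableT tI H1 H2
  (fun w => normr_ge0 _) (integrable_norm (integrable_dotrV v)) H3.
rewrite (_ : \int[P]_w partial1of2 f 0 w = - sinE (fun w => dotrV v (X w)) a t); last first.
  rewrite /sinE -mulN1r -RintegralZl//; last exact: integrable_sinE (integrable_dotrV v).
  by apply: eq_Rintegral => w _; rewrite d1f mul0r addr0 mulN1r mulNr.
apply: cvg_trans; apply: near_eq_cvg; apply: nearW => h.
by rewrite addr0 -!fE scale0r add0r.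
Qed.

Lemma derive_cosE (a : R) (t v : 'rV[R]_d) :
  'D_v (cosE P a X) t = - sinE (fun w => dotrV v (X w)) a t.
Proof. by apply/cvg_lim => //; exact: cvg_cosE_direction. Qed.

Lemma is_derive_cosE_ray (a : R) (b u : 'rV[R]_d) (s : R) :
  is_derive s 1 (fun r => cosE P a X (b + r *: u))
    (- sinE (fun w => dotrV u (X w)) a (b + s *: u)).
Proof.
have := cvg_cosE_direction a (b + s *: u) u.
have E : (fun h => h^-1 *: (cosE P a X (h *: u + (b + s *: u)) - cosE P a X (b + s *: u))) =
    (fun h => h^-1 *: (((fun r => cosE P a X (b + r *: u)) \o shift s) (h *: 1) -
      cosE P a X (b + s *: u))).
  apply/funext => h; rewrite /= addrCA -scalerDl.
  by rewrite /GRing.scale /= mulr1.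
rewrite E => H; apply: DeriveDef; last by apply/cvg_lim.
by apply/cvg_ex; eexists; exact: H.
Qed.

(** [|f'|] written with expectations instead of derivatives, which makes its measurability
    accessible; the phases 0 and [- pi/2] account for the real and imaginary parts of [f]. *)
Definition grad_norm (t : 'rV[R]_d) : R :=
  Num.sqrt (\sum_j ((sinE (fun w => X w ord0 j) 0 t) ^+ 2 +
                    (sinE (fun w => X w ord0 j) (- (pi / 2)) t) ^+ 2)).

Lemma grad_norm_ge0 t : 0 <= grad_norm t.
Proof. exact: sqrtr_ge0. Qed.

Lemma measurable_grad_norm : measurable_fun setT grad_norm.
Proof.
apply: measurableT_comp.
  by apply: continuous_measurable_fun; exact: sqrt_continuous.
apply: measurable_sum => j; apply: measurable_funD; apply: measurable_funX;
  by apply: continuous_measurable_rV; apply: continuous_sinE; exact: integrable_coord.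
Qed.

Lemma sinE_le_grad_norm (a : R) t j : a = 0 \/ a = - (pi / 2) ->
  `|sinE (fun w => X w ord0 j) a t| <= grad_norm t.
Proof.
move=> ha; rewrite -sqrtr_sqr ler_wsqrtr// (bigD1 j)//=.
have h : 0 <= \sum_(i < d | i != j) (sinE (fun w => X w ord0 i) 0 t ^+ 2 +
    sinE (fun w => X w ord0 i) (- (pi / 2)) t ^+ 2).
  by apply: sumr_ge0 => i _; rewrite addr_ge0// sqr_ge0.
move: h; set S := \sum_(i < d | _) _ => h.
have := sqr_ge0 (sinE (fun w => X w ord0 j) 0 t).
have := sqr_ge0 (sinE (fun w => X w ord0 j) (- (pi / 2)) t).
by case: ha => ->; lra.
Qed.

(** The fundamental theorem along the segment from [b] to [b + u]. The derivative is a sum of [d]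
    products, each bounded by [enorm u] times [grad_norm]; this count, in place of Cauchy-Schwarz,
    is the factor [d]. *)
Lemma cosE_ray_bound (a : R) (b u : 'rV[R]_d) : a = 0 \/ a = - (pi / 2) ->
  cosE P a X b = 0 ->
  ((`|cosE P a X (b + u)|)%:E <= (d%:R * enorm u)%:E *
    \int[lebesgue_measure]_(s in `[0%R, 1%R]) (grad_norm (b + s *: u))%:E)%E.
Proof.
move=> ha cb0.
pose G s := - sinE (fun w => dotrV u (X w)) a (b + s *: u).
have cray : continuous (fun s : R => b + s *: u).
  by move=> s; apply: cvgD; [exact: cvg_cst|by apply: cvgZ; [exact: cvg_id|exact: cvg_cst]].
have cG : continuous G.
  move=> s; apply: cvgN; apply: (continuous_comp (cray s)).
  exact: (continuous_sinE (fun w => dotrV u (X w)) a (integrable_dotrV u)).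
have FTC : (\int[lebesgue_measure]_(s in `[0%R, 1%R]) (G s)%:E =
    (cosE P a X (b + 1 *: u))%:E - (cosE P a X (b + 0 *: u))%:E)%E.
  apply: (@continuous_FTC2 _ G (fun s => cosE P a X (b + s *: u))) => //.
  - exact: continuous_subspaceT.
  - split; first by move=> s _; have [] := is_derive_cosE_ray a b u s.
      by apply: cvg_at_right_filter; exact: is_derive_continuous (is_derive_cosE_ray a b u _).
    by apply: cvg_at_left_filter; exact: is_derive_continuous (is_derive_cosE_ray a b u _).
  - by move=> s _; rewrite derive1E; have [_] := is_derive_cosE_ray a b u s.
rewrite scale1r scale0r addr0 cb0 sube0 in FTC.
have -> : ((`|cosE P a X (b + u)|)%:E = `|(cosE P a X (b + u))%:E|)%E by [].
have mG : measurable_fun (`[0%R, 1%R] : set R) G.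
  by apply: measurable_funTS; exact: continuous_measurable_fun.
have mgr : measurable_fun (`[0%R, 1%R] : set R) (fun s => grad_norm (b + s *: u)).
  apply: measurable_funTS; apply: measurableT_comp; first exact: measurable_grad_norm.
  by apply: measurable_fun_addrV => //; exact: measurable_fun_scalerV.
rewrite -FTC; apply: le_trans (le_abse_integral _ _ _) _ => //.
  exact/measurable_EFinP.
have du0 : 0 <= d%:R * enorm u by rewrite mulr_ge0// enorm_ge0.
rewrite -ge0_integralZl//; last 2 first.
- exact/measurable_EFinP.
- by move=> s _; rewrite lee_fin grad_norm_ge0.
apply: ge0_le_integral => //.
- by apply/measurable_EFinP; exact: measurableT_comp.
- by apply/measurable_EFinP; exact: measurable_funM.
- move=> s _; rewrite lee_fin /G normrN sinE_dotrV.
  apply: le_trans (ler_norm_sum _ _ _) _.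
  apply: (@le_trans _ _ (\sum_(i < d) enorm u * grad_norm (b + s *: u))).
    apply: ler_sum => i _; rewrite normrM ler_pM//; first exact: coord_le_enorm.
    exact: sinE_le_grad_norm.
  by rewrite sumr_const card_ord -mulrA mulr_natl.
Qed.

End gradient.

Section characteristic_function.
Context {R : realType} {dO : measure_display} {Omega : measurableType dO}
  (P : probability Omega R) {d : nat}.
Variables (X : {RV P >-> 'rV[R]_d}).

Lemma Re_charfunE t : complex.Re (charfun X t) = cosE P 0 X t.
Proof.
rewrite /charfun /cexpectation /= unlock /cosE /Rintegral; congr fine.
by apply: eq_integral => w _; rewrite /= add0r.
Qed.

Lemma Im_charfunE t : complex.Im (charfun X t) = cosE P (- (pi / 2)) X t.
Proof.
rewrite /charfun /cexpectation /= unlock /cosE /Rintegral; congr fine.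
by apply: eq_integral => w _; rewrite /= addrC cosBpihalf.
Qed.

Hypothesis hX_mean : ('E_P[fun w => enorm (X w)] < +oo)%E.

Lemma integrable_enorm : P.-integrable setT (EFin \o (fun w => enorm (X w))).
Proof.
apply/integrableP; split.
  by apply/measurable_EFinP; exact: measurable_fun_enorm.
under eq_integral do rewrite /= ger0_norm ?enorm_ge0//.
by move: hX_mean; rewrite unlock.
Qed.

Lemma cenorm_gradE t : cenorm (cgradient (charfun X) t) = grad_norm P X t.
Proof.
congr Num.sqrt; apply: eq_bigr => j _; rewrite mxE /Normc.normc.
rewrite sqr_sqrtr; last by rewrite addr_ge0// sqr_ge0.
have dd w : dotrV (delta_mx ord0 j) (X w) = X w ord0 j.
  rewrite /dotrV (bigD1 j)//= big1 ?addr0; first by rewrite mxE !eqxx mul1r.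
  by move=> i ij; rewrite mxE eqxx (negbTE ij) mul0r.
have sE a : sinE P X (fun w => dotrV (delta_mx ord0 j) (X w)) a t =
    sinE P X (fun w => X w ord0 j) a t.
  by apply: eq_Rintegral => w _; rewrite dd.
have -> : (fun s => complex.Re (charfun X s)) = cosE P 0 X.
  by apply/funext => s; exact: Re_charfunE.
have -> : (fun s => complex.Im (charfun X s)) = cosE P (- (pi / 2)) X.
  by apply/funext => s; exact: Im_charfunE.
rewrite !derive_cosE ?sE ?sqrrN//; exact: integrable_enorm.
Qed.

End characteristic_function.

(** * The lattice and its fundamental cell *)

Section lattice.
Context {R : realType} {d : nat}.

Definition lat (k : 'rV[int]_d) : 'rV[R]_d := pi *: map_mx intr k.

Lemma latE k j : lat k ord0 j = pi * (k ord0 j)%:~R.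
Proof. by rewrite !mxE. Qed.

Lemma lat0 : lat 0 = 0.
Proof. by apply/rowP => j; rewrite latE !mxE mulr0. Qed.

(** Half-open, so that the translates by the lattice form a partition and not just a cover. *)
Definition cell0 : set 'rV[R]_d :=
  [set u | forall j, - (pi / 2) < u ord0 j <= pi / 2].

Lemma measurable_cell0 : measurable cell0.
Proof.
rewrite (_ : cell0 = \bigcap_(j in [set: 'I_d])
  ((fun v : 'rV[R]_d => v ord0 j) @^-1` `]- (pi / 2), pi / 2])); last first.
  apply/seteqP; split=> u h j; first by move=> _ /=; rewrite in_itv/=; exact: h.
  by have /= := h j I; rewrite in_itv.
apply: fin_bigcap_measurable => // j _.
by rewrite -[X in measurable X]setTI; apply: measurable_rV_coord.
Qed.

Lemma cell0_coord_le u j : cell0 u -> `|u ord0 j| <= pi / 2.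
Proof. by move=> /(_ j) /andP[h1 h2]; rewrite ler_norml h2 ltW. Qed.

Definition cell (k : 'rV[int]_d) : set 'rV[R]_d := [set t | cell0 (t - lat k)].

Lemma measurable_cell k : measurable (cell k).
Proof.
rewrite -[X in measurable X]setTI.
have m : measurable_fun setT (fun t : 'rV[R]_d => t - lat k).
  by apply: (measurable_fun_addrV _ _ (@measurable_id _ _ _) (measurable_cst _)).
by apply: m => //; exact: measurable_cell0.
Qed.

Lemma exists_cell t : exists k, cell k t.
Proof.
(* [ceil (x / pi - 1/2)] is the integer [k] with [- pi/2 < x - pi k <= pi/2]. *)
exists (\row_j Num.ceil (t ord0 j / pi - 2^-1)) => j.
rewrite !mxE; set x := t ord0 j; have p0 : 0 < pi :> R := pi_gt0 R.
have [h1 h2] : x / pi - 2^-1 <= (Num.ceil (x / pi - 2^-1))%:~R /\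
    (Num.ceil (x / pi - 2^-1))%:~R < x / pi - 2^-1 + 1.
  by split; [exact: ceil_ge|rewrite -ltrBlDr -[1]/(1%:~R) -intrB ceilB1_lt].
move: h1 h2; set c := _%:~R; have -> : x = x / pi * pi by rewrite divfK ?gt_eqF.
set y := x / pi; rewrite mulfK ?gt_eqF// => h1 h2; apply/andP; split; nra.
Qed.

Lemma cell_inj k k' t : cell k t -> cell k' t -> k = k'.
Proof.
move=> h h'; apply/rowP => j; have /andP[h1 h2] := h j; have /andP[h3 h4] := h' j.
move: h1 h2 h3 h4; rewrite !mxE; set a := k ord0 j; set b := k' ord0 j => h1 h2 h3 h4.
have p0 : 0 < pi :> R := pi_gt0 R.
have : `|a%:~R - b%:~R| < 1 :> R.
  by rewrite -(ltr_pM2l p0) mulr1 -{1}(gtr0_norm p0) -normrM ltr_norml; apply/andP; split; nra.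
rewrite -intrB -intr_norm -[1]/(1%:~R) ltr_int => h5.
by apply/eqP; rewrite -subr_eq0 -normr_eq0; lia.
Qed.

(** Cells are indexed by naturals through [pickle_inv], for countable additivity; a number that
    encodes no lattice vector gets the empty set. *)
Definition lat_enum (i : nat) : set 'rV[R]_d :=
  if pickle_inv i is Some k then cell k else set0.

Lemma measurable_lat_enum i : measurable (lat_enum i).
Proof. by rewrite /lat_enum; case: pickle_inv => // k; exact: measurable_cell. Qed.

Lemma trivIset_lat_enum : trivIset setT lat_enum.
Proof.
apply/trivIsetP => i j _ _ ij; apply/seteqP; split=> // t [].
rewrite /lat_enum; case Ei : (pickle_inv i) => [k|//] kt.
case Ej : (pickle_inv j) => [k'|//] kt'.
case/eqP: ij; have kk := cell_inj _ _ _ kt kt'.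
have := @choice.pickle_invK 'rV[int]_d i; have := @choice.pickle_invK 'rV[int]_d j.
by rewrite Ei Ej /= kk => -> ->.
Qed.

Lemma bigcup_lat_enum : \bigcup_i lat_enum i = setT.
Proof.
rewrite -subTset => t _; have [k kt] := exists_cell t.
by exists (choice.pickle k) => //; rewrite /lat_enum choice.pickleK_inv.
Qed.

Lemma integral_cell (g : 'rV[R]_d -> \bar R) k : measurable_fun setT g ->
  (forall x, (0 <= g x)%E) ->
  (\int[lebesgue_rV d]_(t in cell k) g t =
   \int[lebesgue_rV d]_(u in cell0) g (lat k + u)%R)%E.
Proof.
move=> mg g0; rewrite [LHS]integral_mkcond [RHS]integral_mkcond.
have := @ge0_integral_rV_affine _ d (g \_ (cell k)) (lat k) 1 ltr01.
rewrite expr1n invr1 mul1e => <-.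
- apply: eq_integral => u _; rewrite scale1r !patchE.
  rewrite (_ : (lat k + u \in cell k) = (u \in cell0))//.
  by apply/idP/idP; rewrite !inE /cell/= addrAC subrr add0r.
- by apply: (measurable_restrictT _ (measurable_cell k)).1; apply: (measurable_funS measurableT _ mg).
- by move=> x; rewrite erestrict_ge0.
Qed.

Lemma integral_lattice (g : 'rV[R]_d -> \bar R) : measurable_fun setT g ->
  (forall x, (0 <= g x)%E) ->
  (\int[lebesgue_rV d]_t g t = \sum_(i <oo)
   if pickle_inv i is Some k then \int[lebesgue_rV d]_(u in cell0) g (lat k + u)%R else 0)%E.
Proof.
move=> mg g0; rewrite -[in LHS]bigcup_lat_enum ge0_integral_bigcup//=.
- apply: eq_eseriesr => i _; rewrite /lat_enum; case: pickle_inv => [k|].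
    exact: integral_cell.
  exact: integral_set0.
- exact: measurable_lat_enum.
- by rewrite bigcup_lat_enum.
- exact: trivIset_lat_enum.
Qed.

(** Coordinate by coordinate: another lattice point shifts a coordinate [x], where [|x| <= pi/2], by
    a nonzero multiple of [pi] or not at all, and a shifted value has modulus at least
    [pi - pi/2]. *)
Lemma dist_pi_latticeE (k : 'rV[int]_d) u : cell0 u ->
  dist_pi_lattice (lat k + u) = enorm u.
Proof.
move=> hu.
have lb k' : enorm u <= enorm (lat k + u - lat k').
  rewrite ler_wsqrtr//; apply: ler_sum => j _; rewrite -!expr2 !mxE.
  rewrite -[X in X ^+ 2 <= _]/(u ord0 j) -(real_normK (num_real (u ord0 j))).
  rewrite -(real_normK (num_real (_ - _))) ler_sqr ?nnegrE//.
  have ux := cell0_coord_le _ j hu; set x := u ord0 j in ux *.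
  have p0 : 0 < pi :> R := pi_gt0 R.
  have [->|kk] := eqVneq (k ord0 j) (k' ord0 j).
    by rewrite addrAC subrr add0r.
  have h1 : 1 <= `|(k ord0 j)%:~R - (k' ord0 j)%:~R| :> R.
    rewrite -intrB -intr_norm -[1]/(1%:~R) ler_int.
    by move: kk; rewrite -subr_eq0 -normr_eq0; lia.
  apply: le_trans ux _.
  rewrite (_ : _ - _ = pi * ((k ord0 j)%:~R - (k' ord0 j)%:~R) - (- x)); last by ring.
  apply: le_trans (lerB_dist _ _); rewrite normrN normrM (gtr0_norm p0).
  by have := cell0_coord_le _ j hu; rewrite -/x; nra.
apply/le_anti/andP; split.
  apply: ge_inf; first by exists 0 => _ [k' _ <-]; exact: enorm_ge0.
  by exists k => //; congr enorm; rewrite -/(lat k) addrAC subrr add0r.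
apply: lb_le_inf; first by exists (enorm (lat k + u - lat 0)); exists 0.
by move=> _ [k' _ <-]; exact: lb.
Qed.

Lemma dist_pi_lattice_ge0 (t : 'rV[R]_d) : 0 <= dist_pi_lattice t.
Proof.
have [k kt] := exists_cell t; rewrite -(subrK (lat k) t) addrC dist_pi_latticeE//.
exact: enorm_ge0.
Qed.

End lattice.

(** * Integration along rays *)

Section kernel.
Context {R : realType}.

(* [integral_ray_kernel] with [c = nu * r ^+ 2] equals
   [(d * (sqrt nu * r) ^+ d)^-1 * decay d nu r]; the indicator makes [decay]
   vanish at [r = 0], so that it tends to 0 everywhere as [nu] grows. *)
Definition decay (d : nat) (nu r : R) : R :=
  \1_(~` [set 0]) r *
  (1 - (Num.sqrt nu * r / Num.sqrt (1 + nu * r ^+ 2)) ^+ d).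

Lemma is_derive_sqrtV (c s : R) : 0 < c ->
  is_derive s 1 (fun s => (Num.sqrt (s ^+ 2 + c))^-1)
    (- (s * (Num.sqrt (s ^+ 2 + c))^-1 ^+ 3)).
Proof.
move=> c0.
have sc0 (x : R) : 0 < x ^+ 2 + c by rewrite ltr_wpDl// sqr_ge0.
have d1 : is_derive s 1 (fun s : R => s ^+ 2 + c) (2 * s).
  have := is_deriveD (is_deriveX 2 (is_derive_id s (1:R))) (is_derive_cst c s 1).
  rewrite /= addr0 /GRing.scale /= mulr1 expr1 => h.
  by apply: is_derive_eq h _; ring.
have d2 := @is_derive1_comp R Num.sqrt (fun s : R => s ^+ 2 + c) s _ _
  (is_derive1_sqrt (sc0 s)) d1.
have sq0 : Num.sqrt (s ^+ 2 + c) != 0 by rewrite gt_eqF// sqrtr_gt0.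
have d3 := @is_deriveV R (Num.sqrt \o (fun s : R => s ^+ 2 + c)) s _ 1 sq0 d2.
apply: is_derive_eq d3 _; rewrite /GRing.scale /=; field.
by rewrite sq0.
Qed.

(** The integrand has the primitive [-(1/d) (s^2 + c)^(-d/2)]. *)
Lemma integral_ray_kernel (d : nat) (c : R) : (0 < d)%N -> 0 < c ->
  (\int[lebesgue_measure]_(s in `[0%R, 1%R])
     (s / Num.sqrt (s ^+ 2 + c) ^+ d.+2)%:E =
   (d%:R^-1 * ((Num.sqrt c)^-1 ^+ d - (Num.sqrt (1 + c))^-1 ^+ d))%:E)%E.
Proof.
move=> d0 c0; have dn0 : d%:R != 0 :> R by rewrite pnatr_eq0 -lt0n.
pose r (s : R) := (Num.sqrt (s ^+ 2 + c))^-1.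
have dr (s : R) : is_derive s 1 (fun s : R => - d%:R^-1 * r s ^+ d) (s * r s ^+ d.+2).
  have h := is_deriveZ (- d%:R^-1 : R) (is_deriveX d (is_derive_sqrtV _ s c0)).
  have -> : (fun s : R => - d%:R^-1 * r s ^+ d) = - d%:R^-1 \*: (r ^+ d).
    by apply/funext => x; rewrite exprfctE.
  apply: (is_derive_eq h); rewrite /GRing.scale /= -/(r s).
  clear h; case: d d0 dn0 => // e _ dn0 /=; rewrite !exprS -mulr_natl; field.
  by rewrite nat1r.
have cr (f : R -> R) (df : R -> R) : (forall s : R, is_derive s 1 f (df s)) -> continuous f.
  by move=> h s; exact: is_derive_continuous (h s).
under eq_integral do rewrite -exprVn -/(r _).
have -> : (d%:R^-1 * ((Num.sqrt c)^-1 ^+ d - (Num.sqrt (1 + c))^-1 ^+ d))%:E =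
    ((- d%:R^-1 * r 1 ^+ d)%:E - (- d%:R^-1 * r 0 ^+ d)%:E)%E.
  by rewrite -EFinB /r expr1n expr0n /= add0r; congr EFin; ring.
apply: (@continuous_FTC2 _ (fun s => s * r s ^+ d.+2) (fun s => - d%:R^-1 * r s ^+ d)) => //.
- apply: continuous_subspaceT => s; apply: cvgM; first exact: cvg_id.
  have := cr _ _ (fun s => is_deriveX d.+2 (is_derive_sqrtV c s c0)).
  by rewrite exprfctE; exact.
- split; first by move=> s _; have [] := dr s.
    by apply: cvg_at_right_filter; exact: is_derive_continuous (dr _).
  by apply: cvg_at_left_filter; exact: is_derive_continuous (dr _).
- by move=> s _; rewrite derive1E; have [_] := dr s.
Qed.

Lemma sqrtrM_sqr (nu r : R) : 0 <= nu -> 0 <= r ->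
  Num.sqrt nu * r = Num.sqrt (nu * r ^+ 2).
Proof. by move=> nu0 r0; rewrite sqrtrM// sqrtr_sqr ger0_norm. Qed.

Lemma decay_bounds d (nu r : R) : 0 <= nu -> 0 <= r -> 0 <= decay d nu r <= 1.
Proof.
move=> nu0 r0; rewrite /decay indicE.
have h0 : 0 <= Num.sqrt nu * r / Num.sqrt (1 + nu * r ^+ 2).
  by rewrite divr_ge0 ?mulr_ge0 ?sqrtr_ge0.
have h1 : Num.sqrt nu * r / Num.sqrt (1 + nu * r ^+ 2) <= 1.
  have p : 0 < 1 + nu * r ^+ 2 by rewrite ltr_pwDl// mulr_ge0 ?sqr_ge0.
  by rewrite ler_pdivrMr ?sqrtr_gt0// mul1r (sqrtrM_sqr _ _ nu0 r0) ler_wsqrtr// lerDr.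
have := exprn_ge0 d h0; have := exprn_ile1 d h0 h1.
by case: (_ \in _); rewrite ?mul0r ?mul1r; lra.
Qed.

Lemma cvg_decay d (r : R) : 0 <= r -> decay d n%:R r @[n --> \oo] --> (0 : R).
Proof.
move=> r0; rewrite /decay indicE; have [->|rn0] := eqVneq r 0.
  rewrite (_ : (_ \in _) = false); last by apply/negbTE/negP; rewrite inE => /(_ erefl).
  by under eq_fun do rewrite mul0r; exact: cvg_cst.
have rp : 0 < r by rewrite lt_neqAle eq_sym rn0.
rewrite mem_set; last exact/eqP.
under eq_fun do rewrite mul1r.
rewrite -(subrr (1 ^+ d : R)) [X in X - _]expr1n.
apply: cvgB; first exact: cvg_cst.
(* For [r > 0] the quotient is the square root of [1 - 1/(1 + n r^2)]. *)
apply: (@cvg_trans _ ((Num.sqrt (1 - (1 + n%:R * r ^+ 2)^-1) ^+ d) @[n --> \oo])).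
  apply: near_eq_cvg; near=> n; congr (_ ^+ _).
  have np : 0 < 1 + n%:R * r ^+ 2 by rewrite ltr_pwDl// mulr_ge0 ?sqr_ge0.
  rewrite sqrtrM_sqr// -sqrtrV ?ltW// -sqrtrM ?mulr_ge0 ?sqr_ge0//.
  by congr Num.sqrt; field; rewrite gt_eqF.
suff h : (1 + n%:R * r ^+ 2)^-1 @[n --> \oo] --> (0 : R).
  have h1 : 1 - (1 + n%:R * r ^+ 2)^-1 @[n --> \oo] --> (1 : R).
    suff H : 1 - (1 + n%:R * r ^+ 2)^-1 @[n --> \oo] --> (1 - 0 : R) by rewrite subr0 in H.
    by apply: cvgB => //; exact: cvg_cst.
  have h2 := cvg_comp _ _ h1 (@sqrt_continuous R 1); rewrite sqrtr1 in h2.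
  exact: (cvg_comp _ _ h2 (@exprn_continuous R d 1)).
have rV0 : 0 <= 1 + (r ^+ 2)^-1 by rewrite addr_ge0 ?invr_ge0 ?sqr_ge0.
(* The bound [1/(1 + n r^2) <= (1 + 1/r^2)/(n + 1)] holds because [(1 + 1/r^2)(1 + n r^2)] exceeds
   [n + 1] by [n r^2 + 1/r^2]. *)
apply: (@squeeze_cvgr _ _ _ _ (cst 0) (fun n => (1 + (r ^+ 2)^-1) * harmonic n)).
- near=> n; have np : 0 < 1 + n%:R * r ^+ 2 by rewrite ltr_pwDl// mulr_ge0 ?sqr_ge0.
  rewrite /= invr_ge0 (ltW np)/= -div1r ler_pdivrMr// /harmonic mulrAC ler_pdivlMr ?ltr0n// mul1r.
  rewrite -natr1 (_ : (1 + _) * _ = n%:R + 1 + n%:R * r ^+ 2 + (r ^+ 2)^-1); last by field.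
  have : 0 <= n%:R * r ^+ 2 by rewrite mulr_ge0 ?sqr_ge0.
  by have : 0 <= (r ^+ 2)^-1 by [rewrite invr_ge0 sqr_ge0]; lra.
- exact: cvg_cst.
- rewrite -[X in _ --> X](mulr0 (1 + (r ^+ 2)^-1)).
  by apply: cvgM; [exact: cvg_cst|exact: cvg_harmonic].
Unshelve. all: by end_near. Qed.

End kernel.

Section measurability.
Context {R : realType}.

Lemma eq_ler (x y : R) : x = y -> x <= y.
Proof. by move=> ->. Qed.

(** Inversion is continuous off 0, and every function is measurable on the single point 0. *)
Lemma measurable_invr : measurable_fun setT (@GRing.inv R).
Proof.
have m0 : measurable [set (0 : R)] by exact: measurable_set1.
rewrite -(setvU [set (0 : R)]); apply/measurable_funU => //.
  exact: measurableC.
split; last exact: measurable_fun_set1.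
apply: open_continuous_measurable_fun.
  apply: closed_openC.
  exact: accessible_closed_set1 (@hausdorff_accessible _ (@Rhausdorff R)) _.
by move=> x; rewrite inE => /eqP x0; exact: inv_continuous.
Qed.

Lemma measurable_funV {dT} {T : measurableType dT} (D : set T) (f : T -> R) :
  measurable_fun D f -> measurable_fun D (fun x => (f x)^-1).
Proof. by move=> mf; exact: (measurableT_comp measurable_invr mf). Qed.

Lemma measurable_sqrtr : measurable_fun setT (@Num.sqrt R).
Proof. by apply: continuous_measurable_fun; exact: sqrt_continuous. Qed.

Lemma integral_indicM {dT} {T : measurableType dT} (mu : {measure set T -> \bar R})
    (D : set T) (f : T -> R) :
  (\int[mu]_x (\1_D x * f x)%:E = \int[mu]_(x in D) (f x)%:E)%E.
Proof.
rewrite [RHS]integral_mkcond; apply: eq_integral => x _.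
by rewrite patchE indicE; case: (x \in D); rewrite ?mul1r ?mul0r.
Qed.

Lemma measurable_decay d (nu : R) : measurable_fun setT (decay d nu).
Proof.
apply: measurable_funM.
  by apply: measurable_indic; apply: measurableC; exact: measurable_set1.
apply: measurable_funB => //; apply: measurable_funX; apply: measurable_funM.
  exact: measurable_funM.
apply: measurable_funV; apply: (measurableT_comp measurable_sqrtr).
by apply: measurable_funD => //; apply: measurable_funM => //; exact: measurable_funX.
Qed.

End measurability.

Lemma decay_term_ge0 {R : realType} d k (nu x r : R) : 0 < nu -> 0 <= x -> 0 <= r ->
  0 <= x / r ^+ k * decay d nu r.
Proof.
move=> nu0 x0 r0; have /andP[D0 _] := decay_bounds d nu _ (ltW nu0) r0.
by apply: mulr_ge0 => //; apply: divr_ge0 => //; exact: exprn_ge0.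
Qed.

(** * Ray integrals on one cell, then summed over the lattice *)

Section fold.
Context {R : realType} {d : nat}.
Local Notation leb := (@lebesgue_measure R).
Implicit Types (u v : 'rV[R]_d).

Lemma cell0_scale (s : R) v : 0 < s <= 1 -> cell0 (s^-1 *: v) -> cell0 v.
Proof.
move=> /andP[s0 s1] h j; have := h j; rewrite mxE; set x := v ord0 j.
have -> : x = s * (s^-1 * x) by rewrite mulrA divff ?mul1r// gt_eqF.
set y := s^-1 * x; rewrite (_ : s^-1 * (s * y) = y); last by rewrite mulKf// gt_eqF.
have p0 : 0 < pi :> R := pi_gt0 R.
by move=> /andP[h1 h2]; apply/andP; split; nra.
Qed.

(** The explicit integral at [c = nu r^2] is of order [nu^(-d/2) r^(-d)]; the factor [enorm v], left
    from the mean value estimate, lowers the singularity to [r^(1-d)]. *)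
Lemma ray_integral_bound (nu : R) v : (0 < d)%N -> 0 < nu ->
  (\int[leb]_(s in `]0%R, 1%R]) (enorm v * (s / Num.sqrt (s ^+ 2 + nu * enorm v ^+ 2) ^+ d.+2))%:E
   <= ((Num.sqrt nu ^+ d)^-1 * d%:R^-1 * (decay d nu (enorm v) / enorm v ^+ d.-1))%:E)%E.
Proof.
move=> d0 nu0; set r := enorm v; have r0 : 0 <= r := enorm_ge0 v.
have [->|rn0] := eqVneq r 0.
  rewrite [X in (X <= _)%E](_ : _ = 0%E); last first.
    by apply: integral0_eq => s _; rewrite mul0r.
  have /andP[h _] := decay_bounds d nu 0 (ltW nu0) (lexx 0).
  rewrite lee_fin; apply: mulr_ge0; first by rewrite divr_ge0 ?invr_ge0 ?exprn_ge0 ?sqrtr_ge0.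
  by apply: divr_ge0 => //; exact: exprn_ge0.
have rp : 0 < r by rewrite lt_neqAle eq_sym rn0.
have c0 : 0 < nu * r ^+ 2 by rewrite mulr_gt0// exprn_gt0.
have q0 (s : R) : 0 < s ^+ 2 + nu * r ^+ 2 by rewrite ltr_wpDl// sqr_ge0.
have mk : measurable_fun setT (fun s : R => s / Num.sqrt (s ^+ 2 + nu * r ^+ 2) ^+ d.+2).
  apply: measurable_funM => //; apply: measurable_funV; apply: measurable_funX.
  apply: (measurableT_comp measurable_sqrtr).
  by apply: measurable_funD => //; exact: measurable_funX.
under eq_integral do rewrite EFinM.
rewrite ge0_integralZl//; first last.
- by move=> s; rewrite /= in_itv/= => /andP[s0 _]; rewrite lee_fin divr_ge0 ?exprn_ge0 ?sqrtr_ge0// ltW.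
- by apply/measurable_EFinP; exact: measurable_funTS.
rewrite integral_itv_obnd_cbnd; last by apply/measurable_EFinP; exact: measurable_funTS.
rewrite integral_ray_kernel// -EFinM lee_fin.
rewrite -(sqrtrM_sqr _ _ (ltW nu0) (ltW rp)) /decay indicE mem_set; last exact/eqP.
rewrite mul1r.
have n0 : Num.sqrt nu != 0 by rewrite gt_eqF// sqrtr_gt0.
have n1 : Num.sqrt (1 + nu * r ^+ 2) != 0 by rewrite gt_eqF// sqrtr_gt0 ltr_pwDl// ltW.
apply: eq_ler; move: (Num.sqrt (1 + _)) n1 => q n1; rewrite !exprVn !exprMn !exprVn.
case: d d0 => // e _ /=; rewrite !exprS; field.
by rewrite n0 n1 rn0 !expf_neq0//= nat1r pnatr_eq0.
Qed.

(* After Tonelli, substitute [u = v / s]: star-shapedness of the cell keeps [v] in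
   it, and the powers of [s] combine to the kernel [s / sqrt (s^2 + nu |v|^2) ^ (d+2)]. *)
Lemma ray_weight_bound (b : 'rV[R]_d) (h A : 'rV[R]_d -> R) (C nu : R) :
  (0 < d)%N -> measurable_fun setT h -> (forall t, 0 <= h t) ->
  measurable_fun setT A -> (forall t, 0 <= A t) ->
  0 <= C -> 0 < nu ->
  (forall u, ((A u)%:E <= (C * enorm u)%:E * \int[leb]_(s in `[0%R, 1%R]) (h (b + s *: u))%:E)%E) ->
  (\int[lebesgue_rV d]_(u in cell0) (A u / Num.sqrt (1 + nu * enorm u ^+ 2) ^+ d.+2)%:E
   <= (C * (Num.sqrt nu ^+ d)^-1 * d%:R^-1)%:E *
      \int[lebesgue_rV d]_(v in cell0) (h (b + v) / enorm v ^+ d.-1 * decay d nu (enorm v))%:E)%E.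
Proof.
move=> d0 mh h0 mA A0 C0 nu0 hA.
(* The null point 0 is left out because [v / s] is about to be substituted. *)
pose I : set R := [set` `]0, 1]].
have mI : measurable I by exact: measurable_itv.
have mI1 : measurable_fun setT (\1_I : R -> R) by exact: measurable_indic.
have mQ1 : measurable_fun setT (\1_cell0 : 'rV[R]_d -> R).
  by apply: measurable_indic; exact: measurable_cell0.
(* [F] and [G] are the integrands before and after the substitution; their domains are carried as
   indicators so that Tonelli applies on the full product. *)
pose F (z : 'rV[R]_d * measurableTypeR R) : R := \1_cell0 z.1 * (\1_I z.2 *
  (C * enorm z.1 / Num.sqrt (1 + nu * enorm z.1 ^+ 2) ^+ d.+2 * h (b + z.2 *: z.1))).
pose G (z : 'rV[R]_d * measurableTypeR R) : R := \1_cell0 z.1 * (\1_I z.2 *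
  (C * h (b + z.1) * (enorm z.1 * (z.2 / Num.sqrt (z.2 ^+ 2 + nu * enorm z.1 ^+ 2) ^+ d.+2)))).
have mi1 : measurable_fun setT (fun z : 'rV[R]_d * measurableTypeR R => \1_cell0 z.1 : R).
  exact: (measurableT_comp mQ1 measurable_fst).
have mi2 : measurable_fun setT (fun z : 'rV[R]_d * measurableTypeR R => \1_I z.2 : R).
  exact: (measurableT_comp mI1 measurable_snd).
have men : measurable_fun setT (fun z : 'rV[R]_d * measurableTypeR R => enorm z.1).
  exact: (measurable_fun_enorm _ measurable_fst).
have ms : measurable_fun setT (fun z : 'rV[R]_d * measurableTypeR R => z.2 : R).
  exact: measurable_snd.
have mnu : measurable_fun setT (fun z : 'rV[R]_d * measurableTypeR R => nu * enorm z.1 ^+ 2).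
  by apply: measurable_funM => //; exact: measurable_funX.
have mF : measurable_fun setT (EFin \o F).
  apply/measurable_EFinP; do 2 apply: measurable_funM => //; apply: measurable_funM.
    apply: measurable_funM; first exact: measurable_funM.
    apply: measurable_funV; apply: measurable_funX; apply: (measurableT_comp measurable_sqrtr).
    exact: measurable_funD.
  apply: (measurableT_comp mh); apply: measurable_fun_addrV => //.
  by apply: measurable_fun_scalerV => //; exact: measurable_fst.
have mG : measurable_fun setT (EFin \o G).
  apply/measurable_EFinP; do 2 apply: measurable_funM => //; apply: measurable_funM.
    apply: measurable_funM => //; apply: (measurableT_comp mh).
    by apply: measurable_fun_addrV => //; exact: measurable_fst.
  apply: measurable_funM => //; apply: measurable_funM => //.
  apply: measurable_funV; apply: measurable_funX; apply: (measurableT_comp measurable_sqrtr).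
  by apply: measurable_funD => //; exact: measurable_funX.
have F0 z : (0 <= (EFin \o F) z)%E.
  rewrite lee_fin /F !indicE !mulr_ge0 ?invr_ge0 ?exprn_ge0 ?sqrtr_ge0 ?enorm_ge0 ?ler0n//.
have G0 z : (0 <= (EFin \o G) z)%E.
  rewrite lee_fin /G !indicE mulr_ge0//; have [zI|] := boolP (z.2 \in I); last by rewrite mul0r.
  rewrite inE /I /= in_itv/= in zI; case/andP: zI => z0 _.
  by rewrite !mulr_ge0 ?invr_ge0 ?exprn_ge0 ?sqrtr_ge0 ?enorm_ge0// ltW.
have mray u : measurable_fun setT (fun s : R => h (b + s *: u)).
  apply: (measurableT_comp mh); apply: measurable_fun_addrV => //.
  exact: measurable_fun_scalerV.
apply: (@le_trans _ _ (\int[lebesgue_rV d]_u \int[leb]_s (EFin \o F) (u, s))%E).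
  rewrite -integral_indicM; apply: ge0_le_integral => //.
  - by move=> u _; rewrite lee_fin mulr_ge0 ?divr_ge0 ?exprn_ge0 ?sqrtr_ge0// indicE.
  - apply/measurable_EFinP; apply: measurable_funM => //; apply: measurable_funM => //.
    apply: measurable_funV; apply: measurable_funX; apply: (measurableT_comp measurable_sqrtr).
    apply: measurable_funD => //; apply: measurable_funM => //; apply: measurable_funX.
    exact: (measurable_fun_enorm _ (@measurable_id _ _ _)).
  - exact: (measurable_fun_fubini_tonelli_F (m2 := leb) _ mF F0).
  - move=> u _; rewrite /F /= indicE; case: (u \in cell0); last first.
      by under [leRHS]eq_integral do rewrite mul0r; rewrite mul0r integral0.
    under [leRHS]eq_integral do rewrite mul1r.
    rewrite mul1r integral_indicM; under [leRHS]eq_integral do rewrite EFinM.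
    have W0 : 0 <= (Num.sqrt (1 + nu * enorm u ^+ 2) ^+ d.+2)^-1.
      by rewrite invr_ge0 exprn_ge0 ?sqrtr_ge0.
    rewrite ge0_integralZl//; last first.
    - by rewrite lee_fin !mulr_ge0 ?enorm_ge0.
    - by move=> s _; rewrite lee_fin.
    - by apply/measurable_EFinP; apply: (measurable_funS measurableT _ (mray u)).
    rewrite integral_itv_obnd_cbnd; last first.
      by apply/measurable_EFinP; apply: (measurable_funS measurableT _ (mray u)).
    rewrite (mulrC (A u)) (mulrC (C * enorm u)) EFinM [in leRHS]EFinM -muleA.
    by apply: lee_wpmul2l; [rewrite lee_fin|exact: hA].
rewrite (fubini_tonelli _ mF F0).
apply: (@le_trans _ _ (\int[leb]_s \int[lebesgue_rV d]_v (EFin \o G) (v, s))%E).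
  apply: ge0_le_integral => //.
  - by move=> s _; apply: integral_ge0 => u _; exact: F0.
  - exact: (measurable_fun_fubini_tonelli_G (m1 := lebesgue_rV d) _ mF F0).
  - exact: (measurable_fun_fubini_tonelli_G (m1 := lebesgue_rV d) _ mG G0).
  move=> s _; rewrite /=.
  have [sI|sI] := boolP (s \in I); last first.
    rewrite [leLHS]integral0_eq; last first.
      by move=> u _; rewrite /F/= [\1_I s]indicE (negbTE sI) mul0r mulr0.
    by apply: integral_ge0 => u _; exact: G0.
  rewrite inE /I /= in_itv/= in sI; case/andP: (sI) => s0 s1.
  have mFs : measurable_fun setT (fun u => (F (s^-1 *: u, s))%:E).
    apply: (measurableT_comp mF); apply: measurable_fun_pair => //=.
    by apply: measurable_fun_scalerV => //; exact: measurable_id.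
  (* For fixed [s], the substitution read backwards: [F (u, s)] is the function [u |-> F (u / s, s)]
     taken at [s u], which yields the factor [s^(-d)]. *)
  have := ge0_integral_rV_affine d (fun u => (F (s^-1 *: u, s))%:E) 0 s s0 mFs (fun u => F0 _).
  rewrite (_ : (\int[_]_x _)%E = \int[lebesgue_rV d]_u (F (u, s))%:E)%E; last first.
    by apply: eq_integral => u _; rewrite add0r scalerA mulVf ?scale1r// gt_eqF.
  move=> ->; rewrite -ge0_integralZl//; last first.
  - by rewrite lee_fin invr_ge0 exprn_ge0// ltW.
  - by move=> u _; exact: F0.
  apply: ge0_le_integral => //.
  - by move=> v _; apply: mule_ge0; [rewrite lee_fin invr_ge0 exprn_ge0// ltW|exact: F0].
  - exact: (measurable_funeM _ mFs).
  - by apply: (measurableT_comp mG); apply: measurable_fun_pair => //=; exact: measurable_id.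
  move=> v _; rewrite -EFinM lee_fin /F /G/=.
  rewrite [\1_I s]indicE mem_set ?mul1r//.
  rewrite !indicE; have [vs|vs] := boolP (s^-1 *: v \in cell0); last first.
    rewrite mul0r mulr0 mulr_ge0// !mulr_ge0 ?invr_ge0 ?exprn_ge0 ?sqrtr_ge0 ?enorm_ge0//.
    exact: ltW.
  (* The domain grows from [s] times the cell to the whole cell, which only increases a nonnegative
     integrand. *)
  rewrite inE in vs; rewrite mem_set; last exact: (cell0_scale _ _ sI vs).
  rewrite !mul1r scalerA divff ?gt_eqF// scale1r enormZ gtr0_norm ?invr_gt0//.
  have -> : Num.sqrt (1 + nu * (s^-1 * enorm v) ^+ 2) = Num.sqrt (s ^+ 2 + nu * enorm v ^+ 2) / s.
    rewrite (_ : 1 + _ = (s ^+ 2 + nu * enorm v ^+ 2) * s^-1 ^+ 2); last first.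
      by field; rewrite gt_eqF.
    rewrite sqrtrM ?sqrtr_sqr ?gtr0_norm ?invr_gt0//.
    by rewrite addr_ge0 ?sqr_ge0// mulr_ge0 ?sqr_ge0 ?(ltW nu0).
  apply: eq_ler; have : Num.sqrt (s ^+ 2 + nu * enorm v ^+ 2) != 0.
    by rewrite gt_eqF// sqrtr_gt0 ltr_pwDl ?exprn_gt0// mulr_ge0 ?sqr_ge0 ?(ltW nu0).
  rewrite expr_div_n; move: (Num.sqrt _) => r r0; rewrite !exprS; field.
  by have sn0 : s != 0 by [rewrite gt_eqF]; rewrite !expf_neq0 ?r0 ?sn0.
rewrite -(fubini_tonelli _ mG G0).
have K0 : 0 <= C / Num.sqrt nu ^+ d / d%:R.
  by rewrite !divr_ge0 ?exprn_ge0 ?sqrtr_ge0.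
have D0 v : 0 <= decay d nu (enorm v) by have /andP[] := decay_bounds d nu _ (ltW nu0) (enorm_ge0 v).
have mD : measurable_fun setT (fun v => h (b + v) / enorm v ^+ d.-1 * decay d nu (enorm v)).
  have me := measurable_fun_enorm _ (@measurable_id _ 'rV[R]_d _).
  apply: measurable_funM.
    apply: measurable_funM; last by apply: measurable_funV; exact: measurable_funX.
    by apply: (measurableT_comp mh); exact: measurable_fun_addrV.
  exact: (measurableT_comp (measurable_decay d nu) me).
rewrite -integral_indicM -ge0_integralZl//; last first.
- by move=> v _; rewrite lee_fin indicE; apply: mulr_ge0 => //; apply: decay_term_ge0 => //; exact: enorm_ge0.
- by apply/measurable_EFinP; exact: measurable_funM.
apply: ge0_le_integral => //.
- by move=> v _; apply: integral_ge0 => s _; exact: G0.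
- exact: (measurable_fun_fubini_tonelli_F (m2 := leb) _ mG G0).
- by apply: measurable_funeM; apply/measurable_EFinP; exact: measurable_funM.
move=> v _; rewrite /G /= indicE; case: (v \in cell0); last first.
  by under [leLHS]eq_integral do rewrite mul0r; rewrite mul0r mule0 integral0.
under [leLHS]eq_integral do rewrite mul1r.
rewrite mul1r integral_indicM; under [leLHS]eq_integral do rewrite EFinM.
have mk : measurable_fun setT (fun s : R => enorm v * (s / Num.sqrt (s ^+ 2 + nu * enorm v ^+ 2) ^+ d.+2)).
  apply: measurable_funM => //; apply: measurable_funM => //.
  apply: measurable_funV; apply: measurable_funX; apply: (measurableT_comp measurable_sqrtr).
  by apply: measurable_funD => //; exact: measurable_funX.
rewrite ge0_integralZl//; last first.
- by rewrite lee_fin mulr_ge0.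
- move=> s; rewrite /I/= in_itv/= => /andP[s0 _].
  by rewrite lee_fin !mulr_ge0 ?invr_ge0 ?exprn_ge0 ?sqrtr_ge0 ?enorm_ge0// ltW.
- by apply/measurable_EFinP; exact: (measurable_funS measurableT _ mk).
apply: (@le_trans _ _ ((C * h (b + v))%:E *
   ((Num.sqrt nu ^+ d)^-1 * d%:R^-1 * (decay d nu (enorm v) / enorm v ^+ d.-1))%:E)%E).
  by apply: lee_wpmul2l => //; [rewrite lee_fin mulr_ge0|exact: ray_integral_bound].
by rewrite -!EFinM lee_fin; apply: eq_ler; ring.
Qed.

Lemma measurable_dist_pi_lattice :
  measurable_fun setT (dist_pi_lattice : 'rV[R]_d -> R).
Proof.
rewrite -bigcup_lat_enum; apply/measurable_fun_bigcup; first exact: measurable_lat_enum.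
move=> i; rewrite /lat_enum; case: pickle_inv => [k|]; last exact: measurable_fun_set0.
apply: (eq_measurable_fun (fun t : 'rV[R]_d => enorm (t - lat k))).
  move=> t; rewrite inE => kt; rewrite -(dist_pi_latticeE k)//; congr dist_pi_lattice.
  by rewrite addrC subrK.
apply: measurable_funTS; apply: measurable_fun_enorm.
by apply: measurable_fun_addrV => //; exact: measurable_id.
Qed.

(* The factor [enorm u] in the hypothesis on [A] turns the decay of [w] into the
   weight [1 / dist ^+ d.-1] against [h]. *)
Lemma lattice_weight_bound (h A w : 'rV[R]_d -> R) (C K nu : R) :
  (0 < d)%N -> measurable_fun setT h -> (forall t, 0 <= h t) ->
  measurable_fun setT A -> (forall t, 0 <= A t) ->
  measurable_fun setT w -> (forall t, 0 <= w t) ->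
  0 <= C -> 0 <= K -> 0 < nu ->
  (forall k u, cell0 u -> ((A (lat k + u))%:E <= (C * enorm u)%:E *
     \int[leb]_(s in `[0%R, 1%R]) (h (lat k + s *: u))%:E)%E) ->
  (forall k u, cell0 u -> w (lat k + u) <= K / Num.sqrt (1 + nu * enorm u ^+ 2) ^+ d.+2) ->
  (\int[lebesgue_rV d]_t (A t * w t)%:E <= (K * C * (Num.sqrt nu ^+ d)^-1 * d%:R^-1)%:E *
      \int[lebesgue_rV d]_t
        (h t / dist_pi_lattice t ^+ d.-1 * decay d nu (dist_pi_lattice t))%:E)%E.
Proof.
move=> d0 mh h0 mA A0 mw w0 C0 K0 nu0 hA hw.
have D0 (r : R) : 0 <= r -> 0 <= decay d nu r.
  by move=> r0; have /andP[] := decay_bounds d nu _ (ltW nu0) r0.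
have mdist := measurable_dist_pi_lattice.
have H0 t : 0 <= h t / dist_pi_lattice t ^+ d.-1 * decay d nu (dist_pi_lattice t).
  by apply: decay_term_ge0 => //; exact: dist_pi_lattice_ge0.
have mH : measurable_fun setT (fun t =>
    h t / dist_pi_lattice t ^+ d.-1 * decay d nu (dist_pi_lattice t)).
  apply: measurable_funM; last exact: (measurableT_comp (measurable_decay d nu) mdist).
  by apply: measurable_funM => //; apply: measurable_funV; exact: measurable_funX.
rewrite -ge0_integralZl//; last first.
- by rewrite lee_fin !mulr_ge0 ?invr_ge0 ?exprn_ge0 ?sqrtr_ge0.
- by move=> t _; rewrite lee_fin.
- exact/measurable_EFinP.
have c0 : 0 <= K * C * (Num.sqrt nu ^+ d)^-1 * d%:R^-1.
  by rewrite !mulr_ge0 ?invr_ge0 ?exprn_ge0 ?sqrtr_ge0.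
rewrite [leLHS]integral_lattice; last 2 first.
- by apply/measurable_EFinP; exact: measurable_funM.
- by move=> t; rewrite lee_fin mulr_ge0.
rewrite [leRHS]integral_lattice; last 2 first.
- by apply: measurable_funeM; exact/measurable_EFinP.
- by move=> t; apply: mule_ge0; rewrite lee_fin.
apply: lee_nneseries => i _.
  move=> _; case: pickle_inv => // k; apply: integral_ge0 => u _.
  by rewrite lee_fin mulr_ge0.
case: pickle_inv => // k.
have mshift (f : 'rV[R]_d -> R) : measurable_fun setT f ->
    measurable_fun setT (fun u => f (lat k + u)).
  move=> mf; apply: (measurableT_comp mf).
  by apply: measurable_fun_addrV => //; exact: measurable_id.
have mcell (f : 'rV[R]_d -> R) : measurable_fun setT f ->
    measurable_fun cell0 (fun u => (f u)%:E).
  by move=> mf; apply/measurable_EFinP; exact: (measurable_funS measurableT _ mf).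
have mc0 : measurable (cell0 : set 'rV[R]_d) := measurable_cell0.
have men := measurable_fun_enorm _ (@measurable_id _ 'rV[R]_d _).
(* Truncation to the central cell: the single-cell estimate asks for its bound at every [u], while
   [hA] provides it only on the cell. *)
pose A' u := \1_cell0 u * A (lat k + u).
have mA' : measurable_fun setT A'.
  by apply: measurable_funM; [exact: measurable_indic|exact: mshift].
have A'0 u : 0 <= A' u by rewrite /A' mulr_ge0// indicE.
have hA' u : ((A' u)%:E <= (C * enorm u)%:E * \int[leb]_(s in `[0%R, 1%R]) (h (lat k + s *: u))%:E)%E.
  rewrite /A' indicE; have [uc|_] := boolP (u \in cell0).
    by rewrite mul1r; apply: hA; rewrite inE in uc.
  by rewrite mul0r mule_ge0 ?lee_fin ?mulr_ge0 ?enorm_ge0//; apply: integral_ge0 => s _; rewrite lee_fin.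
have := ray_weight_bound (lat k) h A' C nu d0 mh h0 mA' A'0 C0 nu0 hA' => bound.
have mdec : measurable_fun setT (fun u => h (lat k + u) / enorm u ^+ d.-1 * decay d nu (enorm u)).
  apply: measurable_funM; last exact: (measurableT_comp (measurable_decay d nu) men).
  apply: measurable_funM; first exact: mshift.
  by apply: measurable_funV; exact: measurable_funX.
apply: (@le_trans _ _ (K%:E * \int[lebesgue_rV d]_(u in cell0)
    (A' u / Num.sqrt (1 + nu * enorm u ^+ 2) ^+ d.+2)%:E)%E).
  have mA'w : measurable_fun setT (fun u => A' u / Num.sqrt (1 + nu * enorm u ^+ 2) ^+ d.+2).
    apply: measurable_funM => //; apply: measurable_funV; apply: measurable_funX.
    apply: (measurableT_comp measurable_sqrtr).
    by apply: measurable_funD => //; apply: measurable_funM => //; exact: measurable_funX.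
  rewrite -ge0_integralZl//; last first.
  - by move=> u _; rewrite lee_fin divr_ge0// exprn_ge0// sqrtr_ge0.
  - exact: mcell.
  apply: ge0_le_integral => //.
  - by move=> u _; rewrite lee_fin mulr_ge0.
  - by apply: mcell; apply: measurable_funM; exact: mshift.
  - by apply: measurable_funeM; exact: mcell.
  - move=> u uc; rewrite -EFinM lee_fin /A' indicE mem_set// mul1r mulrCA ler_wpM2l//.
    exact: hw.
apply: le_trans (lee_wpmul2l _ bound) _; first by rewrite lee_fin.
rewrite muleA -EFinM -ge0_integralZl//; last first.
- by rewrite lee_fin !mulr_ge0 ?invr_ge0 ?exprn_ge0 ?sqrtr_ge0.
- by move=> u _; rewrite lee_fin; apply: decay_term_ge0 => //; exact: enorm_ge0.
- exact: mcell.
(* On the cell, [enorm u] is the distance from [lat k + u] to the lattice, so the two integrands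
   coincide. *)
rewrite le_eqVlt; apply/orP; left; apply/eqP; apply: eq_integral => u.
by rewrite inE => uc; rewrite dist_pi_latticeE// !mulrA.
Qed.

End fold.

(** * Powers of cosines *)

Section cosine_bounds.
Context {R : realType}.
Implicit Types x y : R.

Lemma sin_mean_value x : 0 <= x -> exists2 c, 0 <= c <= x & sin x = x * cos c.
Proof.
move=> x0; have cs : {within `[0, x], continuous (@sin R)}.
  by apply: continuous_subspaceT => z; exact: continuous_sin.
have [c cx h] := @MVT_segment R sin cos 0 x x0 (fun z _ => is_derive_sin z) cs.
exists c; first by move: cx; rewrite in_itv.
by move: h; rewrite sin0 !subr0 mulrC.
Qed.

Lemma sin_le_id x : 0 <= x -> `|sin x| <= x.
Proof.
move=> x0; have [c _ ->] := sin_mean_value x x0.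
by rewrite normrM (ger0_norm x0) ler_piMr// cos_max.
Qed.

(** Turns bounds on [sin ^ 2] into bounds on [cos]; the inequalities below all rest on it. *)
Lemma cos_half x : cos x = 1 - 2 * sin (x / 2) ^+ 2.
Proof.
rewrite {1}(_ : x = (x / 2) *+ 2); last by rewrite -mulr_natr divfK.
by rewrite cos_mulr2n cos2sin2 -mulr_natr; ring.
Qed.

Lemma sin_sqr_le x : sin x ^+ 2 <= x ^+ 2.
Proof.
wlog x0 : x / 0 <= x.
  move=> h; have [/h//|/ltW x0] := leP 0 x.
  by rewrite -[sin x]opprK -sinN sqrrN -[x ^+ 2]sqrrN; apply: h; rewrite oppr_ge0.
by rewrite -(real_normK (num_real (sin x))) lerXn2r ?nnegrE// sin_le_id.
Qed.

Lemma cos_ge x : 1 - x ^+ 2 / 2 <= cos x.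
Proof. by rewrite cos_half; have := sin_sqr_le (x / 2); rewrite expr_div_n; lra. Qed.

Lemma sin_ge x : 0 <= x -> x * (1 - x ^+ 2 / 2) <= sin x.
Proof.
move=> x0; have [c /andP[c0 cx] ->] := sin_mean_value x x0.
apply: ler_wpM2l => //; apply: le_trans (cos_ge c).
by have : c ^+ 2 <= x ^+ 2 by [rewrite lerXn2r ?nnegrE]; lra.
Qed.

Lemma sin_sqr_ge x : `|x| <= 1 -> x ^+ 2 * (1 - x ^+ 2 / 2) ^+ 2 <= sin x ^+ 2.
Proof.
wlog x0 : x / 0 <= x.
  move=> h; have [/h//|/ltW x0 x1] := leP 0 x.
  rewrite -[sin x]opprK -sinN sqrrN -[x ^+ 2]sqrrN; apply: h; first by rewrite oppr_ge0.
  by rewrite normrN.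
rewrite (ger0_norm x0) => x1.
have h : 0 <= 1 - x ^+ 2 / 2 by nra.
by rewrite -exprMn lerXn2r ?nnegrE ?mulr_ge0// ?sin_ge// (le_trans _ (sin_ge _ x0))// mulr_ge0.
Qed.

(** With [z = x/2] and [|z| <= 1] one has [sin z ^ 2 >= z^2 (1 - z^2/2)^2 >= z^2/4], so
    [cos x <= 1 - x^2/8]. The range [|x| <= 2] contains the sides of the cell. *)
Lemma cos_le_expR x : `|x| <= 2 -> cos x <= expR (- (x ^+ 2 / 8)).
Proof.
have [z ->] : exists z, x = z * 2 by exists (x / 2); rewrite divfK.
rewrite normrM (ger0_norm (ler0n R 2)) => x2; have z1 : `|z| <= 1 by lra.
apply: le_trans (expR_ge1Dx _); rewrite cos_half mulfK//.
have := sin_sqr_ge _ z1; have : z ^+ 2 <= 1 by rewrite -(real_normK (num_real z)) expr_le1.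
have := sqr_ge0 z; rewrite exprMn; move: (z ^+ 2) (sin z ^+ 2) => w s w0 w1 h.
have h4 : 4^-1 <= (1 - w / 2) ^+ 2 by nra.
by have := ler_wpM2l w0 h4; lra.
Qed.

Lemma cos_le_quartic x : `|x| <= 2 -> cos x <= 1 - x ^+ 2 / 2 + x ^+ 4.
Proof.
have [z ->] : exists z, x = z * 2 by exists (x / 2); rewrite divfK.
rewrite normrM (ger0_norm (ler0n R 2)) => x2; have z1 : `|z| <= 1 by lra.
rewrite cos_half mulfK// (_ : (z * 2) ^+ 4 = z ^+ 2 ^+ 2 * 16); last by ring.
have := sin_sqr_ge _ z1; have := sqr_ge0 z.
rewrite exprMn; move: (z ^+ 2) (sin z ^+ 2) => w s w0 h.
have := exprn_ge0 3 w0.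
(* With [w = z^2], nonnegativity of [w^3] says exactly that [w (1 - w/2)^2 >= w - w^2]. *)
have -> : w ^+ 3 = 4 * (w * (1 - w / 2) ^+ 2 - w + w ^+ 2) by field.
by have := sqr_ge0 w; lra.
Qed.

(** Both terms lie between [1 - x^2/2] and [1 - x^2/2 + x^4]. *)
Lemma cos_expR_close x : `|x| <= 2 -> `|cos x - expR (- (x ^+ 2 / 2))| <= x ^+ 4.
Proof.
move=> x2; have h1 := cos_ge x; have h2 := cos_le_quartic _ x2.
have h3 := expR_ge1Dx (- (x ^+ 2 / 2)); set z := x ^+ 2 / 2 in h3 *.
have z0 : 0 <= z by rewrite divr_ge0// sqr_ge0.
have h4 : expR (- z) <= 1 - z + z ^+ 2.
  have := expR_ge1Dx z; have := expR_gt0 z; rewrite expRN => e0 ez.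
  rewrite invf_ple ?posrE//; last by nra.
  apply: le_trans ez; rewrite -div1r ler_pdivrMr; last by nra.
  by have := exprn_ge0 3 z0; rewrite !exprS expr0; nra.
have z4 : x ^+ 4 = z ^+ 2 * 4 by rewrite /z; field.
have := sqr_ge0 z; rewrite -/z in h1 h2.
by rewrite z4 in h2 *; rewrite ler_norml => z2; apply/andP; split; lra.
Qed.

Lemma expr_dist_le (a b : R) n : `|a| <= 1 -> `|b| <= 1 ->
  `|a ^+ n - b ^+ n| <= n%:R * `|a - b|.
Proof.
move=> a1 b1; elim: n => [|n IHn]; first by rewrite !expr0 subrr normr0 mul0r.
rewrite (_ : _ - _ = a * (a ^+ n - b ^+ n) + (a - b) * b ^+ n); last by rewrite !exprS; ring.
apply: le_trans (ler_normD _ _) _; rewrite !normrM -natr1 mulrDl mul1r lerD//.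
  by apply: le_trans IHn; rewrite ler_piMl.
by rewrite ler_piMr// normrX exprn_ile1.
Qed.

(** With [y = x / sqrt n] the limit is itself an [n]-th power, of [exp(-y^2/2)]. Powers of numbers
    in [[-1, 1]] are Lipschitz with constant [n], so the error is at most [n y^4 = x^4 / n]. *)
Lemma cvg_cos_expn x :
  cos (x / Num.sqrt n%:R) ^+ n @[n --> \oo] --> expR (- (x ^+ 2 / 2)).
Proof.
apply/cvgrPdist_le => e e0.
near=> n.
have n0 : 0 < n%:R :> R by rewrite ltr0n; near: n; exists 1%N.
have sn0 : 0 < Num.sqrt n%:R :> R by rewrite sqrtr_gt0.
have sn : Num.sqrt n%:R ^+ 2 = n%:R :> R by rewrite sqr_sqrtr// ltW.
set y := x / Num.sqrt n%:R.
have yn : y ^+ 2 = x ^+ 2 / n%:R by rewrite expr_div_n sn.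
have y2 : `|y| <= 2.
  rewrite -(ler_pXn2r (ltn0Sn 1)) ?nnegrE// real_normK ?num_real// yn ler_pdivrMr//.
  have : x ^+ 2 <= n%:R by near: n; exact: nbhs_infty_ger.
  by nra.
have -> : expR (- (x ^+ 2 / 2)) = expR (- (y ^+ 2 / 2)) ^+ n.
  by rewrite -expRM_natr yn; congr expR; field; rewrite gt_eqF.
rewrite distrC; apply: le_trans (expr_dist_le _ _ _ (cos_max _) _) _.
  by rewrite ger0_norm ?expR_ge0// -expR0 ler_expR oppr_le0 divr_ge0// sqr_ge0.
apply: (@le_trans _ _ (n%:R * y ^+ 4)); first by rewrite ler_wpM2l// cos_expR_close.
have -> : n%:R * y ^+ 4 = x ^+ 4 / n%:R.
  rewrite (_ : y ^+ 4 = y ^+ 2 ^+ 2); last by rewrite -exprM.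
  by rewrite yn; field; rewrite gt_eqF.
rewrite ler_pdivrMr// -ler_pdivrMl//.
by near: n; exact: nbhs_infty_ger.
Unshelve. all: by end_near. Qed.

(** Trades the Gaussian decay of the cosines for the power decay that the ray kernel integrates:
    [exp(y/8)] is the [m]-th power of [exp(y/(8m))], and
    [8m exp(y/(8m)) >= 8m + y >= sqrt(1 + y)]. *)
Lemma expR_le_weight m (y : R) : (0 < m)%N -> 0 <= y ->
  expR (- (y / 8)) <= (8 * m%:R) ^+ m / Num.sqrt (1 + y) ^+ m.
Proof.
move=> m0 y0; have mr : 1 <= m%:R :> R by rewrite ler1n.
have y1 : 0 < 1 + y by rewrite ltr_pwDl.
rewrite ler_pdivlMr ?exprn_gt0 ?sqrtr_gt0// expRN ler_pdivrMl ?expR_gt0//.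
have -> : y / 8 = m%:R * (y / (8 * m%:R)).
  by field; rewrite gt_eqF// (lt_le_trans _ mr).
rewrite expRM_natl -exprMn lerXn2r ?nnegrE ?mulr_ge0 ?expR_ge0 ?sqrtr_ge0//.
apply: (@le_trans _ _ (1 + y)).
  rewrite -[leRHS]ger0_norm ?(ltW y1)// -sqrtr_sqr ler_wsqrtr//.
  by rewrite expr2 ler_peMr ?(ltW y1)// lerDl.
have := expR_ge1Dx (y / (8 * m%:R)); set e := expR _ => h.
have : (1 + y / (8 * m%:R)) * (8 * m%:R) <= e * (8 * m%:R) by rewrite ler_wpM2r// mulr_ge0.
by rewrite mulrDl divfK; [lra|rewrite gt_eqF// mulr_gt0// (lt_le_trans _ mr)].
Qed.

Lemma norm_cos_periodic x (k : int) : `|cos (pi * k%:~R + x)| = `|cos x|.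
Proof.
have nat_case n (z : R) : `|cos (pi * n%:R + z)| = `|cos z|.
  elim: n => [|n IHn]; first by rewrite mulr0 add0r.
  rewrite -natr1 mulrDr mulr1 addrAC (_ : _ + _ + _ = (pi * n%:R + z) + pi)//.
  by rewrite cosDpi normrN.
case: k => n; first exact: nat_case.
rewrite NegzE mulrNz mulrN -(nat_case n.+1 (- (pi * n.+1%:R) + x)) addrA.
by rewrite subrr add0r.
Qed.

End cosine_bounds.

Section cosine_product.
Context {R : realType} {d : nat}.
Implicit Types (u t : 'rV[R]_d).

Definition cos_prod t : R := \prod_(j < d) cos (t ord0 j).

Lemma cos_prod_le1 t : `|cos_prod t| <= 1.
Proof.
rewrite /cos_prod normr_prod; apply: prodr_ile1 => j _.
by rewrite normr_ge0 cos_max.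
Qed.

Lemma cos_prod_lat k u : `|cos_prod (lat k + u)| = `|cos_prod u|.
Proof.
rewrite /cos_prod !normr_prod; apply: eq_bigr => j _.
by rewrite mxE latE norm_cos_periodic.
Qed.

Lemma cos_prod_cell0 u : cell0 u -> `|cos_prod u| <= expR (- (dotrV u u / 8)).
Proof.
move=> uc; rewrite /cos_prod normr_prod /dotrV mulr_suml -sumrN expR_sum.
apply: ler_prod => j _; rewrite normr_ge0 /= -expr2.
have /andP[h1 h2] := uc j.
rewrite ger0_norm; last by rewrite cos_ge0_pihalf// h2 ltW.
apply: cos_le_expR; apply: le_trans (cell0_coord_le _ j uc) _.
by rewrite ltW// pihalf_lt2.
Qed.

Lemma measurable_cos_prod : measurable_fun setT cos_prod.
Proof.
apply: measurable_prod => j _; apply: (measurableT_comp _ (measurable_rV_coord j)).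
by apply: continuous_measurable_fun; exact: continuous_cos.
Qed.

Lemma cvg_cos_prod t :
  cos_prod ((Num.sqrt n%:R)^-1 *: t) ^+ n @[n --> \oo] --> gaussV t.
Proof.
have -> : gaussV t = \prod_(j < d) expR (- (t ord0 j ^+ 2 / 2)).
  rewrite /gaussV /dotrV mulr_suml -sumrN expR_sum.
  by apply: eq_bigr => j _; rewrite expr2.
have E n : cos_prod ((Num.sqrt n%:R)^-1 *: t) ^+ n =
    \prod_(j < d) cos (t ord0 j / Num.sqrt n%:R) ^+ n.
  by rewrite /cos_prod -prodrXl; apply: eq_bigr => j _; rewrite mxE mulrC.
under eq_fun do rewrite E.
by apply: cvg_big => [|j _]; [exact: mul_continuous|exact: cvg_cos_expn].
Qed.

End cosine_product.

(** * Integrability and tails of the characteristic function *)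

Lemma integrable_rV_scale {R : realType} {d : nat} (f : 'rV[R]_d -> R) (c : R) :
  0 < c -> (lebesgue_rV d).-integrable setT (EFin \o f) ->
  (lebesgue_rV d).-integrable setT (EFin \o (fun t => f (c *: t))).
Proof.
move=> c0 /integrableP[mf foo].
have mc : measurable_fun setT (fun t : 'rV[R]_d => c *: t).
  by apply: measurable_fun_scalerV => //; exact: measurable_id.
apply/integrableP; split; first exact: (measurableT_comp mf mc).
have mnf : measurable_fun setT (fun t => `|(EFin \o f) t|%E) by exact: measurableT_comp.
have := ge0_integral_rV_affine d _ 0 c c0 mnf (fun t => abse_ge0 _).
under eq_integral do rewrite add0r.
by move=> ->; apply: lte_mul_pinfty; rewrite ?lee_fin ?invr_ge0 ?exprn_ge0 ?ltW.
Qed.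

Lemma integrable_expR_dotrV {R : realType} {d : nat} :
  (lebesgue_rV d).-integrable setT
    (EFin \o (fun t : 'rV[R]_d => expR (- (dotrV t t / 8)))).
Proof.
have := integrable_rV_scale gaussV (2^-1 : R) _ (integrable_gaussV d).
rewrite invr_gt0 ltr0n => /(_ isT); congr (_.-integrable _ _).
apply/funext => t /=; rewrite /gaussV dotrVZl dotrVZr; congr (expR _)%:E.
by field.
Qed.

Lemma cell0_measure_lty {R : realType} {d : nat} :
  (lebesgue_rV d (cell0 : set 'rV[R]_d) < +oo)%E.
Proof.
pose A (_ : 'I_d) : set R := [set` `]- (pi / 2), pi / 2]].
rewrite (_ : cell0 = [set v : 'rV[R]_d | forall j, A j (v ord0 j)]); last first.
  by apply/seteqP; split => v h j; have := h j; rewrite /A /= in_itv.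
rewrite lebesgue_rV_box//; last by move=> j; exact: measurable_itv.
suff : (\big[mule/1]_(i < d) lebesgue_measure (A i))%E \is a fin_num.
  by rewrite fin_numElt => /andP[].
elim/big_ind : _ => // [x y|j _]; first exact: fin_numM.
by rewrite lebesgue_measure_itv /=; case: ifP.
Qed.

Section char_size.
Context {R : realType} {dO : measure_display} {Omega : measurableType dO}
  (P : probability Omega R) {d : nat}.
Variables (X : Omega -> 'rV[R]_d).
Hypothesis mX : measurable_fun setT X.

Lemma norm_cosE_le1 a t : `|cosE P a X t| <= 1.
Proof.
have ic := integrable_cos P _ (measurable_fun_phase a X t mX).
apply: le_trans (le_normr_Rintegral _ ic) _ => //.
rewrite -[leRHS](_ : \int[P]_w (cst (1 : R) w) = 1); last first.
  by rewrite Rintegral_cst//= probability_setT mulr1.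
apply: le_Rintegral => //.
- exact: (integrable_norm ic).
- exact: (finite_measure_integrable_cst P 1 measurableT).
- by move=> w _; exact: cos_max.
Qed.

Lemma cosE_phase a t :
  cosE P a X t = cos a * cosE P 0 X t - sin a * cosE P (- (pi / 2)) X t.
Proof.
rewrite -{1}[a]add0r cosE_shift_phase//; congr (_ - _ * _).
apply: eq_Rintegral => w _.
by rewrite add0r addrC cosBpihalf.
Qed.

(** A substitute for [|f|], equivalent to it up to a constant, that bounds [cosE] for every
    phase. *)
Definition char_size t : R := `|cosE P 0 X t| + `|cosE P (- (pi / 2)) X t|.

Lemma char_size_ge0 t : 0 <= char_size t.
Proof. by rewrite addr_ge0. Qed.

Lemma char_size_le2 t : char_size t <= 2.
Proof. by rewrite -[2]/(1 + 1) lerD ?norm_cosE_le1. Qed.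

Lemma cosE_le_char_size a t : `|cosE P a X t| <= char_size t.
Proof.
rewrite cosE_phase; apply: le_trans (ler_normB _ _) _.
by rewrite !normrM lerD// ler_piMl// ?cos_max ?sin_max.
Qed.

Lemma measurable_char_size : measurable_fun setT char_size.
Proof.
by apply: measurable_funD; apply: measurableT_comp => //; exact: measurable_cosE.
Qed.

(** The central cell is cut off because [f] does not vanish at its centre. *)
Definition char_size_out t : R := \1_(~` cell0) t * char_size t.

Lemma char_size_out_ge0 t : 0 <= char_size_out t.
Proof. by rewrite mulr_ge0 ?char_size_ge0// indicE. Qed.

Lemma measurable_char_size_out : measurable_fun setT char_size_out.
Proof.
apply: measurable_funM measurable_char_size.
by apply: measurable_indic; apply: measurableC; exact: measurable_cell0.
Qed.

Lemma char_size_split t : char_size t = \1_cell0 t * char_size t + char_size_out t.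
Proof.
rewrite /char_size_out !indicE in_setC; case: (t \in cell0) => /=.
  by rewrite mul1r mul0r addr0.
by rewrite mul0r mul1r add0r.
Qed.

Hypothesis iX : P.-integrable setT (EFin \o (fun w => enorm (X w))).
Hypothesis hlat : forall k : 'rV[int]_d, k != 0 ->
  cosE P 0 X (lat k) = 0 /\ cosE P (- (pi / 2)) X (lat k) = 0.

(** For [k = 0] the cut-off makes the left side 0; for the other cells [f] vanishes at the centre
    and the ray bound applies. The factor 2 counts the real and imaginary parts. *)
Lemma char_size_out_ray k u : cell0 u ->
  ((char_size_out (lat k + u))%:E <= (2 * d%:R * enorm u)%:E *
    \int[lebesgue_measure]_(s in `[0%R, 1%R]) (grad_norm P X (lat k + s *: u))%:E)%E.
Proof.
move=> uc; have I0 k' : (0 <= \int[lebesgue_measure]_(s in `[0%R, 1%R])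
    (grad_norm P X (lat k' + s *: u))%:E)%E.
  by apply: integral_ge0 => s _; rewrite lee_fin grad_norm_ge0.
have C0 : 0 <= 2 * d%:R * enorm u by rewrite mulr_ge0// enorm_ge0.
have [->|k0] := eqVneq k 0.
  have -> : char_size_out (lat 0 + u) = 0.
    by rewrite lat0 add0r /char_size_out indicE in_setC mem_set//= mul0r.
  by apply: mule_ge0; [rewrite lee_fin|exact: I0].
have [h1 h2] := hlat k k0.
have b1 := cosE_ray_bound P X mX iX 0 (lat k) u (or_introl erefl) h1.
have b2 := cosE_ray_bound P X mX iX _ (lat k) u (or_intror erefl) h2.
apply: (@le_trans _ _ (char_size (lat k + u))%:E).
  rewrite lee_fin /char_size_out indicE; case: (_ \in _); rewrite ?mul1r// mul0r.
  exact: char_size_ge0.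
rewrite EFinD -mulrA mulr_natl mulr2n EFinD ge0_muleDl ?lee_fin ?mulr_ge0 ?enorm_ge0//.
exact: leeD.
Qed.

Hypothesis d0 : (0 < d)%N.
Local Notation grad_weight := (fun t => grad_norm P X t / dist_pi_lattice t ^+ d.-1).
Hypothesis igrad : (lebesgue_rV d).-integrable setT (EFin \o grad_weight).

Lemma char_size_out_weight (w : 'rV[R]_d -> R) (K nu : R) :
  measurable_fun setT w -> (forall t, 0 <= w t) -> 0 <= K -> 0 < nu ->
  (forall k u, cell0 u -> w (lat k + u) <= K / Num.sqrt (1 + nu * enorm u ^+ 2) ^+ d.+2) ->
  (\int[lebesgue_rV d]_t (char_size_out t * w t)%:E <=
    (K * (2 * d%:R) * (Num.sqrt nu ^+ d)^-1 * d%:R^-1)%:E *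
      \int[lebesgue_rV d]_t (grad_weight t * decay d nu (dist_pi_lattice t))%:E)%E.
Proof.
move=> mw w0 K0 nu0 hw; apply: lattice_weight_bound => //.
- exact: measurable_grad_norm.
- exact: grad_norm_ge0.
- exact: measurable_char_size_out.
- exact: char_size_out_ge0.
- exact: char_size_out_ray.
Qed.

Lemma grad_weight_ge0 t : 0 <= grad_weight t.
Proof. by rewrite divr_ge0 ?grad_norm_ge0 ?exprn_ge0 ?dist_pi_lattice_ge0. Qed.

Lemma grad_weight_decay_le (nu : R) t : 0 <= nu ->
  `|grad_weight t * decay d nu (dist_pi_lattice t)| <= grad_weight t.
Proof.
move=> nu0; have /andP[D0 D1] := decay_bounds d nu _ nu0 (dist_pi_lattice_ge0 t).
by rewrite ger0_norm ?(mulr_ge0 _ D0) ?grad_weight_ge0// ler_piMr ?grad_weight_ge0.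
Qed.

Lemma measurable_grad_weight_decay (nu : R) :
  measurable_fun setT (fun t => grad_weight t * decay d nu (dist_pi_lattice t)).
Proof.
apply: measurable_funM.
  by have /integrableP[/measurable_EFinP] := igrad.
exact: (measurableT_comp (measurable_decay d nu) measurable_dist_pi_lattice).
Qed.

(** Off the central cell, the lattice estimate with [nu = 1] and the constant weight 1; on it, the
    bound 2 and finite measure. *)
Lemma integrable_char_size :
  (lebesgue_rV d).-integrable setT (EFin \o char_size).
Proof.
have io : (lebesgue_rV d).-integrable setT (EFin \o char_size_out).
  apply/integrableP; split.
    by apply/measurable_EFinP; exact: measurable_char_size_out.
  (* Since [pi/2 < 2], a point of the cell satisfies [|u|^2 <= 4 d]; this value of [K] makes the
     weight 1 admissible. *)
  have K0 : 0 <= Num.sqrt (1 + 4 * d%:R) ^+ d.+2 :> R by rewrite exprn_ge0 ?sqrtr_ge0.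
  have hw (k : 'rV[int]_d) (u : 'rV[R]_d) : cell0 u -> (1 : R) <=
      Num.sqrt (1 + 4 * d%:R) ^+ d.+2 / Num.sqrt (1 + 1 * enorm u ^+ 2) ^+ d.+2.
    move=> uc; rewrite mul1r enorm_sqr.
    have p : 0 < 1 + dotrV u u by rewrite ltr_pwDl// dotrV_ge0.
    rewrite ler_pdivlMr ?exprn_gt0 ?sqrtr_gt0// mul1r lerXn2r ?nnegrE ?sqrtr_ge0//.
    rewrite ler_wsqrtr// lerD2l.
    have -> : 4 * d%:R = \sum_(j < d) (4 : R) by rewrite sumr_const card_ord mulr_natr.
    apply: ler_sum => j _.
    have h1 := cell0_coord_le _ j uc; have h2 := pihalf_lt2 R.
    rewrite -expr2 -(real_normK (num_real (u ord0 j))) (_ : 4 = 2 ^+ 2); last by ring.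
    by rewrite lerXn2r ?nnegrE//; exact: le_trans h1 (ltW h2).
  have := char_size_out_weight (cst 1) _ 1 (measurable_cst _) (fun _ => ler01) K0 ltr01 hw.
  under [in X in (X <= _)%E -> _]eq_integral do rewrite mulr1.
  have -> : (\int[lebesgue_rV d]_t `|(EFin \o char_size_out) t| =
      \int[lebesgue_rV d]_t (char_size_out t)%:E)%E.
    by apply: eq_integral => t _; rewrite gee0_abs// lee_fin char_size_out_ge0.
  move=> H; apply: le_lt_trans H _.
  have iw : (lebesgue_rV d).-integrable setT
      (EFin \o (fun t => grad_weight t * decay d 1 (dist_pi_lattice t))).
    apply: (le_integrable_EFin _ _ _ _ grad_weight) => //.
      exact: measurable_grad_weight_decay.
    by move=> t _; exact: grad_weight_decay_le.
  rewrite -(fineK (integrable_fin_num measurableT iw)) -EFinM; exact: ltry.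
have ii : (lebesgue_rV d).-integrable setT (EFin \o (fun t : 'rV[R]_d => 2 * \1_cell0 t : R)).
  apply/integrableP; split.
    apply/measurable_EFinP; apply: measurable_funM => //.
    by apply: measurable_indic; exact: measurable_cell0.
  under eq_integral do rewrite /= ger0_norm ?mulr_ge0 ?indicE// EFinM.
  rewrite ge0_integralZl//; last first.
    apply/measurable_EFinP; apply: measurable_indic; exact: (@measurable_cell0 R d).
  rewrite integral_indic//; last exact: measurable_cell0.
  by rewrite setIT; apply: lte_mul_pinfty => //; exact: cell0_measure_lty.
apply: (le_integrable_EFin _ _ _ _ (fun t => 2 * \1_cell0 t + char_size_out t)) => //.
- exact: measurable_char_size.
- move=> t _; rewrite ger0_norm ?char_size_ge0// [leLHS]char_size_split lerD2r.
  by rewrite mulrC ler_wpM2r ?char_size_le2// indicE.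
- exact: (integrableD measurableT ii io).
Qed.

(** With [nu = n] the factor [sqrt(n)^d] cancels the one in the lattice estimate and [2 d] cancels
    [1/d] up to 2, leaving [2 K J n]; [J n] tends to 0 because [decay] does, with [grad_weight] as
    dominating function. *)
Lemma cvg_char_size_tail :
  ((Num.sqrt n%:R ^+ d)%:E *
    \int[lebesgue_rV d]_t (char_size_out t * `|cos_prod t| ^+ n)%:E)%E
  @[n --> \oo] --> 0%E.
Proof.
pose K : R := (8 * d.+2%:R) ^+ d.+2.
pose J n := \int[lebesgue_rV d]_t (grad_weight t * decay d n%:R (dist_pi_lattice t)).
have cJ : J n @[n --> \oo] --> (0 : R).
  have := cvg_integral_psi grad_weight igrad
    (fun n t => grad_weight t * decay d n%:R (dist_pi_lattice t)) (cst 0).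
  rewrite [X in _ -> _ -> _ -> _ --> X](_ : _ = 0); last first.
    by rewrite /Rintegral integral0_eq.
  apply.
  - by move=> n; exact: measurable_grad_weight_decay.
  - move=> t; rewrite -[X in _ --> X](mulr0 (grad_weight t)).
    by apply: cvgM; [exact: cvg_cst|apply: cvg_decay; exact: dist_pi_lattice_ge0].
  - by move=> n t; exact: grad_weight_decay_le.
apply: (squeeze_cvge (f := cst 0%E) (h := fun n => (K * 2 * J n)%:E)).
- near=> n; apply/andP; split.
    apply: mule_ge0; first by rewrite lee_fin exprn_ge0// sqrtr_ge0.
    by apply: integral_ge0 => t _; rewrite lee_fin mulr_ge0 ?exprn_ge0 ?char_size_out_ge0.
  have n0 : 0 < n%:R :> R by rewrite ltr0n; near: n; exists 1%N.
  have sn0 : 0 < Num.sqrt n%:R :> R by rewrite sqrtr_gt0.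
  have hw (k : 'rV[int]_d) (u : 'rV[R]_d) : cell0 u -> `|cos_prod (lat k + u)| ^+ n <=
      K / Num.sqrt (1 + n%:R * enorm u ^+ 2) ^+ d.+2.
    move=> uc; rewrite cos_prod_lat.
    apply: le_trans (expR_le_weight d.+2 (n%:R * enorm u ^+ 2) _ _) => //; last first.
      by rewrite mulr_ge0 ?sqr_ge0.
    rewrite enorm_sqr (_ : - _ = n%:R * - (dotrV u u / 8)); last by ring.
    by rewrite expRM_natl lerXn2r ?nnegrE ?expR_ge0 ?cos_prod_cell0.
  have mw : measurable_fun setT (fun t : 'rV[R]_d => `|cos_prod t| ^+ n).
    by apply: measurable_funX; apply: measurableT_comp => //; exact: measurable_cos_prod.
  have K0 : 0 <= K by rewrite exprn_ge0// mulr_ge0.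
  have := char_size_out_weight _ K n%:R mw (fun t => exprn_ge0 n (normr_ge0 _)) K0 n0 hw.
  have iw : (lebesgue_rV d).-integrable setT
      (EFin \o (fun t => grad_weight t * decay d n%:R (dist_pi_lattice t))).
    apply: (le_integrable_EFin _ _ _ _ grad_weight) => //.
      exact: measurable_grad_weight_decay.
    by move=> t _; exact: grad_weight_decay_le.
  rewrite -(fineK (integrable_fin_num measurableT iw)) -[fine _]/(J n) -EFinM => H.
  apply: le_trans (lee_wpmul2l _ H) _; first by rewrite lee_fin exprn_ge0// ltW.
  rewrite -EFinM lee_fin; apply: eq_ler; move: (J n) => j; field.
  by rewrite pnatr_eq0 -lt0n d0 expf_neq0 ?gt_eqF.
- exact: cvg_cst.
- apply: cvg_EFin; first exact: nearW.
  rewrite -[X in _ --> X](mulr0 (K * 2)).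
  by apply: cvgM => //; exact: cvg_cst.
Unshelve. all: by end_near. Qed.

End char_size.

(** * Distance to the Gaussian *)

Section normal.
Context {R : realType} {d : nat}.
Implicit Types x t : 'rV[R]_d.

Lemma integrable_cosM_gaussV (a : 'rV[R]_d -> R) : measurable_fun setT a ->
  (lebesgue_rV d).-integrable setT (EFin \o (fun t => cos (a t) * gaussV t)).
Proof.
move=> ma; apply: (le_integrable_EFin _ _ _ _ gaussV) => //.
- apply: measurable_funM; first exact: measurable_fun_cos.
  exact: (measurable_fun_gaussV _ _ _ _ (@measurable_id _ _ _)).
- move=> t _; rewrite normrM (ger0_norm (gaussV_ge0 _ _)).
  by rewrite ler_piMl ?gaussV_ge0 ?cos_max.
- exact: integrable_gaussV.
Qed.

Lemma Rintegral_cos_gaussV x :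
  \int[lebesgue_rV d]_t (cos (- dotrV t x) * gaussV t) = Num.sqrt (2 * pi) ^+ d * gaussV x.
Proof.
have m0 : measurable_fun setT (fun t => dotrV x t).
  by apply: measurable_fun_dotrV => //; exact: measurable_id.
have m1 : measurable_fun setT (fun t => 0 + dotrV x t) by exact: measurable_funD.
have i1 := integrable_cosM_gaussV _ m1.
have h1 : \int[lebesgue_rV d]_t ((1 + 1 * cos (0 + dotrV x t)) * gaussV t) =
    Num.sqrt (2 * pi) ^+ d * (1 + 1 * (cos 0 * gaussV x)).
  by rewrite /Rintegral integral_cos_gaussV// normr1.
have h2 : \int[lebesgue_rV d]_t (gaussV t) = Num.sqrt (2 * pi : R) ^+ d.
  by rewrite /Rintegral integral_gaussV.
have : \int[lebesgue_rV d]_t ((1 + 1 * cos (0 + dotrV x t)) * gaussV t) =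
   \int[lebesgue_rV d]_t (gaussV t) + \int[lebesgue_rV d]_t (cos (0 + dotrV x t) * gaussV t).
  rewrite -RintegralD//; last exact: integrable_gaussV.
  by apply: eq_Rintegral => t _; ring.
rewrite h1 h2 cos0 => h.
transitivity (\int[lebesgue_rV d]_t (cos (0 + dotrV x t) * gaussV t)).
  by apply: eq_Rintegral => t _; rewrite cosN add0r dotrVC.
by lra.
Qed.

(** Gives the normal density the shape of [inversion_density], so that the two can be subtracted
    under one integral. *)
Lemma normal_densityE x : normal_density x =
  ((2 * pi) ^+ d)^-1 * \int[lebesgue_rV d]_t (cos (- dotrV t x) * gaussV t).
Proof.
have p0 : 0 < 2 * pi :> R by rewrite mulr_gt0// pi_gt0.
have s0 : Num.sqrt (2 * pi) != 0 :> R by rewrite gt_eqF// sqrtr_gt0.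
rewrite Rintegral_cos_gaussV mulrA /normal_density enorm_sqr -/(gaussV x); congr (_ * _).
rewrite powRN [d%:R / 2]mulrC powRrM powR12_sqrt ?(ltW p0)// powR_mulrn ?sqrtr_ge0//.
have -> : (2 * pi) ^+ d = Num.sqrt (2 * pi) ^+ d * Num.sqrt (2 * pi) ^+ d :> R.
  by rewrite -exprMn -expr2 sqr_sqrtr ?(ltW p0).
by field; rewrite expf_neq0.
Qed.

End normal.

Section limit.
Context {R : realType} {dO : measure_display} {Omega : measurableType dO}
  (P : probability Omega R) {d : nat}.
Variables (X : Omega -> 'rV[R]_d).
Hypothesis mX : measurable_fun setT X.
Implicit Types t : 'rV[R]_d.

Local Notation scale n t := ((Num.sqrt n%:R)^-1 *: t).

Lemma measurable_scale n : measurable_fun setT (fun t : 'rV[R]_d => scale n t).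
Proof. by apply: measurable_fun_scalerV => //; exact: measurable_id. Qed.

Lemma cvg_scale t i : (scale n t) ord0 i @[n --> \oo] --> (0 : R).
Proof.
under eq_fun do rewrite mxE.
suff H : (Num.sqrt n%:R)^-1 * t ord0 i @[n --> \oo] --> (0 * t ord0 i : R) by rewrite mul0r in H.
apply: cvgM; last exact: cvg_cst.
have h := cvg_comp _ _ (@cvg_harmonic R) (@sqrt_continuous R 0).
rewrite sqrtr0 in h; rewrite -cvg_shiftS /=.
by under eq_fun do rewrite -sqrtrV//; exact: h.
Qed.

Lemma near_scale_cell0 t : \forall n \near \oo, cell0 (scale n t).
Proof.
apply: filter_forall => i.
have p0 : 0 < pi / 2 :> R by rewrite divr_gt0// pi_gt0.
have /cvgrPdist_lt /(_ _ p0) := cvg_scale t i.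
apply: filterS => n; rewrite sub0r normrN ltr_norml => /andP[h1 h2].
by rewrite h1 ltW.
Qed.

(** Bounds the difference of the two transforms for every phase at once. The second term is the
    imaginary part, which is absent from the Gaussian. *)
Definition cf_diff n t : R :=
  `|cosE P 0 X (scale n t) * cos_prod (scale n t) ^+ n - gaussV t| +
  `|cosE P (- (pi / 2)) X (scale n t)| * `|cos_prod (scale n t)| ^+ n.

(** The part with a Gaussian majorant: the whole difference inside the rescaled cell, only the
    Gaussian outside. What remains of the characteristic function outside is [cf_tail]. *)
Definition cf_diff_in n t : R :=
  \1_cell0 (scale n t) * cf_diff n t + \1_(~` cell0) (scale n t) * gaussV t.

Definition cf_tail n t : R :=
  char_size_out P X (scale n t) * `|cos_prod (scale n t)| ^+ n.

Lemma cf_diff_ge0 n t : 0 <= cf_diff n t.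
Proof. by rewrite addr_ge0// mulr_ge0// exprn_ge0. Qed.

Lemma cf_tail_ge0 n t : 0 <= cf_tail n t.
Proof. by rewrite mulr_ge0 ?char_size_out_ge0// exprn_ge0. Qed.

Lemma cf_diff_in_ge0 n t : 0 <= cf_diff_in n t.
Proof. by rewrite addr_ge0// mulr_ge0 ?indicE ?cf_diff_ge0 ?gaussV_ge0. Qed.

Lemma cf_diff_split n t : cf_diff n t <= cf_diff_in n t + cf_tail n t.
Proof.
rewrite /cf_diff_in /cf_tail /char_size_out !indicE in_setC.
case: (scale n t \in cell0); rewrite /= !(mul0r, mul1r, addr0, add0r)//.
have := ler_normB (cosE P 0 X (scale n t) * cos_prod (scale n t) ^+ n) (gaussV t).
rewrite normrM normrX (ger0_norm (gaussV_ge0 _ _)) /cf_diff /char_size.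
by rewrite [(_ + _) * _]mulrDl; lra.
Qed.

Lemma measurable_cf_diff n : measurable_fun setT (cf_diff n).
Proof.
have ms := measurable_scale n.
have mc := measurableT_comp (@measurable_cos_prod R d) ms.
have mB a := measurableT_comp (measurable_cosE P a X mX) ms.
apply: measurable_funD.
  apply: measurableT_comp => //; apply: measurable_funB.
    by apply: measurable_funM; [exact: mB|exact: measurable_funX].
  exact: (measurable_fun_gaussV _ _ _ _ (@measurable_id _ _ _)).
apply: measurable_funM; first by apply: measurableT_comp => //; exact: mB.
by apply: measurable_funX; exact: measurableT_comp.
Qed.

Lemma measurable_cf_diff_in n : measurable_fun setT (cf_diff_in n).
Proof.
have ms := measurable_scale n.
have mi (D : set 'rV[R]_d) : measurable D -> measurable_fun setT (fun t => \1_D (scale n t) : R).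
  by move=> mD; exact: (measurableT_comp (measurable_indic mD) ms).
have mg := measurable_fun_gaussV _ _ _ _ (@measurable_id _ 'rV[R]_d setT).
apply: measurable_funD; apply: measurable_funM => //.
- by apply: mi; exact: measurable_cell0.
- exact: measurable_cf_diff.
- by apply: mi; apply: measurableC; exact: measurable_cell0.
Qed.

Lemma measurable_cf_tail n : measurable_fun setT (cf_tail n).
Proof.
have ms := measurable_scale n.
apply: measurable_funM; first exact: (measurableT_comp (measurable_char_size_out P X mX) ms).
apply: measurable_funX; apply: measurableT_comp => //.
exact: (measurableT_comp measurable_cos_prod ms).
Qed.

(** In the cell [n |t / sqrt n|^2 / 8 = |t|^2 / 8], so the majorant does not depend on [n]. The 3
    counts the real part, the imaginary part and the Gaussian. *)
Lemma cf_diff_in_le n t : (0 < n)%N ->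
  `|cf_diff_in n t| <= 3 * expR (- (dotrV t t / 8)).
Proof.
move=> n0; rewrite ger0_norm ?cf_diff_in_ge0// /cf_diff_in !indicE in_setC.
have g8 : gaussV t <= expR (- (dotrV t t / 8)).
  by rewrite ler_expR lerN2; have := dotrV_ge0 t; lra.
have e0 := expR_gt0 (- (dotrV t t / 8)).
have [sc|_] := boolP (scale n t \in cell0); rewrite /= ?mul0r ?mul1r ?addr0 ?add0r; last by lra.
have cp : `|cos_prod (scale n t)| ^+ n <= expR (- (dotrV t t / 8)).
  rewrite inE in sc; have := cos_prod_cell0 _ sc.
  move=> /(lerXn2r n) h; apply: le_trans (h _ _) _; rewrite ?nnegrE ?expR_ge0//.
  have nn0 : n%:R != 0 :> R by rewrite pnatr_eq0 -lt0n.
  have e : (Num.sqrt n%:R)^-1 * (Num.sqrt n%:R)^-1 = n%:R^-1 :> R.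
    by rewrite -invfM -expr2 sqr_sqrtr.
  rewrite -expRM_natl dotrVZl dotrVZr mulrA e; apply: eq_ler; congr expR.
  by field.
have b1 := norm_cosE_le1 P X mX 0 (scale n t).
have b2 := norm_cosE_le1 P X mX (- (pi / 2)) (scale n t).
have c0 : 0 <= `|cos_prod (scale n t)| ^+ n by exact: exprn_ge0.
rewrite /cf_diff; apply: (@le_trans _ _ ((`|cos_prod (scale n t)| ^+ n + gaussV t) + `|cos_prod (scale n t)| ^+ n)); last by lra.
apply: lerD; last by rewrite ler_piMl.
apply: le_trans (ler_normB _ _) _; rewrite (ger0_norm (gaussV_ge0 _ _)) lerD2r.
by rewrite normrM normrX ler_piMl.
Qed.

Lemma cvg_cosE_scale a t : cosE P a X (scale n t) @[n --> \oo] --> cos a.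
Proof.
have -> : cos a = \int[P]_w (cos (a + dotrV 0 (X w))).
  under eq_Rintegral do rewrite dotrV0l addr0.
  by rewrite Rintegral_cst//= probability_setT mulr1.
apply: cvg_integral_cos => [n||w]; try exact: measurable_fun_phase.
apply: cvgD; first exact: cvg_cst.
apply: cvg_dotrV => i; last exact: cvg_cst.
by rewrite (_ : (0 : 'rV[R]_d) ord0 i = 0) ?mxE//; exact: cvg_scale.
Qed.

Lemma cvg_cf_diff t : cf_diff n t @[n --> \oo] --> (0 : R).
Proof.
have c1 : `|cosE P 0 X (scale n t) * cos_prod (scale n t) ^+ n - gaussV t| @[n --> \oo] --> (0 : R).
  have H : `|cosE P 0 X (scale n t) * cos_prod (scale n t) ^+ n - gaussV t| @[n --> \oo]
      --> `|cos 0 * gaussV t - gaussV t|.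
    apply: cvg_norm; apply: cvgB; last exact: cvg_cst.
    by apply: cvgM; [exact: cvg_cosE_scale|exact: cvg_cos_prod].
  by rewrite cos0 mul1r subrr normr0 in H.
have c2 : `|cosE P (- (pi / 2)) X (scale n t)| * `|cos_prod (scale n t)| ^+ n @[n --> \oo] --> (0 : R).
  have H : `|cosE P (- (pi / 2)) X (scale n t)| * `|cos_prod (scale n t) ^+ n| @[n --> \oo]
      --> `|cos (- (pi / 2) : R)| * `|gaussV t|.
    by apply: cvgM; apply: cvg_norm; [exact: cvg_cosE_scale|exact: cvg_cos_prod].
  rewrite cosN cos_pihalf normr0 mul0r in H.
  by under eq_fun do rewrite -normrX.
have := cvgD c1 c2; rewrite addr0; exact.
Qed.

Lemma cvg_cf_diff_in t : cf_diff_in n t @[n --> \oo] --> (0 : R).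
Proof.
apply: cvg_trans (cvg_cf_diff t); apply: near_eq_cvg; near=> n.
have sc : cell0 (scale n t) by near: n; exact: near_scale_cell0.
by rewrite /cf_diff_in !indicE in_setC mem_set//= mul0r addr0 mul1r.
Unshelve. all: by end_near. Qed.

(** The index starts at 1 because the majorant is established only for positive [n]. Pointwise
    convergence holds since each [t] eventually lies in the rescaled cell. *)
Lemma cvg_integral_cf_diff_in :
  (\int[lebesgue_rV d]_t (cf_diff_in n.+1 t)%:E)%E @[n --> \oo] --> 0%E.
Proof.
pose psi t := 3 * expR (- (dotrV t t / 8)).
have ipsi : (lebesgue_rV d).-integrable setT (EFin \o psi).
  exact: (integrableZl measurableT 3 integrable_expR_dotrV).
have := cvg_integral_psi psi ipsi (fun n => cf_diff_in n.+1) (cst 0).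
rewrite (_ : \int[_]_t (cst 0 t) = 0); last by rewrite /Rintegral integral0_eq.
move=> H; have {}H : \int[lebesgue_rV d]_t (cf_diff_in n.+1 t) @[n --> \oo] --> (0 : R).
  apply: H => [n|t|n t]; first exact: measurable_cf_diff_in.
    by rewrite (cvg_shiftS (fun n => cf_diff_in n t)); exact: cvg_cf_diff_in.
  exact: cf_diff_in_le.
rewrite (_ : (fun n => _) = (fun n => (\int[lebesgue_rV d]_t (cf_diff_in n.+1 t))%:E)).
  by apply: cvg_EFin => //; exact: nearW.
apply/funext => n; rewrite /Rintegral fineK//; apply: integrable_fin_num => //.
apply: (le_integrable_EFin _ _ _ _ psi) => //; first exact: measurable_cf_diff_in.
by move=> t _; exact: cf_diff_in_le.
Qed.

Lemma integral_cf_tail n : (0 < n)%N ->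
  (\int[lebesgue_rV d]_t (cf_tail n t)%:E =
   (Num.sqrt n%:R ^+ d)%:E *
   \int[lebesgue_rV d]_t (char_size_out P X t * `|cos_prod t| ^+ n)%:E)%E.
Proof.
move=> n0; have c0 : 0 < (Num.sqrt n%:R)^-1 :> R by rewrite invr_gt0 sqrtr_gt0 ltr0n.
have m : measurable_fun setT (fun t => (char_size_out P X t * `|cos_prod t| ^+ n)%:E).
  apply/measurable_EFinP; apply: measurable_funM; first exact: measurable_char_size_out.
  apply: measurable_funX; apply: measurableT_comp => //; exact: measurable_cos_prod.
rewrite -[Num.sqrt _]invrK exprVn -(ge0_integral_rV_affine d _ 0 _ c0 m).
  by apply: eq_integral => t _; rewrite add0r.
by move=> t; rewrite lee_fin mulr_ge0 ?exprn_ge0 ?char_size_out_ge0.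
Qed.

End limit.

(** * Densities of the normalized sums and their uniform distance to the normal density *)

Section normalized_sums.
Context {R : realType} {dO : measure_display} {Omega : measurableType dO}
  (P : probability Omega R) {d : nat}.
Variables (X : {RV P >-> 'rV[R]_d}) (xi : nat -> {RV P >-> 'rV[R]_d}).
Hypotheses (hxi_indep : mutually_independent xi)
  (hxi_unif : forall k, uniform_on_cube (xi k))
  (hX_indep : independent_of_sequence X xi).

Let mX : measurable_fun setT X.
Proof. exact: measurable_funPT. Qed.

Local Notation scale n t := ((Num.sqrt n%:R)^-1 *: t).
Local Notation Z := (normalized_sum X xi).

Lemma measurable_normalized_sum n : measurable_fun setT (Z n).
Proof.
apply: measurable_fun_scalerV => //; apply: measurable_fun_addrV => //.
apply: measurable_fun_rVP => i; under eq_fun do rewrite summxE.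
by apply: measurable_sum => k; apply: measurable_fun_coord; exact: measurable_funPT.
Qed.

Lemma cosE_normalized_sum a n t :
  cosE P a (Z n) t = cosE P a X (scale n t) * cos_prod (scale n t) ^+ n.
Proof.
rewrite /cos_prod -(cosE_cube_sum P X xi hxi_indep hxi_unif hX_indep).
by apply: eq_Rintegral => w _; rewrite dotrVZl dotrVZr.
Qed.

Hypothesis isize : (lebesgue_rV d).-integrable setT (EFin \o char_size P X).

Let psi n (t : 'rV[R]_d) : R := char_size P X (scale n t) * `|cos_prod (scale n t)| ^+ n.

Let psi_ge n a t : `|cosE P a (Z n) t| <= psi n t.
Proof.
rewrite cosE_normalized_sum normrM normrX ler_wpM2r ?exprn_ge0//.
exact: cosE_le_char_size.
Qed.

Let integrable_psi n : (0 < n)%N -> (lebesgue_rV d).-integrable setT (EFin \o psi n).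
Proof.
move=> n0; have c0 : 0 < (Num.sqrt n%:R)^-1 :> R by rewrite invr_gt0 sqrtr_gt0 ltr0n.
have ms := measurable_scale (R := R) (d := d) n.
apply: (le_integrable_EFin _ _ _ _ (fun t : 'rV[R]_d => char_size P X (scale n t))) => //.
- apply: measurable_funM; first exact: (measurableT_comp (measurable_char_size P X mX) ms).
  apply: measurable_funX; apply: measurableT_comp => //.
  exact: (measurableT_comp measurable_cos_prod ms).
- move=> t _; rewrite ger0_norm ?mulr_ge0 ?exprn_ge0 ?char_size_ge0//.
  by rewrite ler_piMr ?char_size_ge0// exprn_ile1 ?cos_prod_le1.
- exact: integrable_rV_scale c0 isize.
Qed.

Lemma density_normalized_sum n : (0 < n)%N ->
  continuous (inversion_density P (Z n)) /\
  has_density P (Z n) (inversion_density P (Z n)).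
Proof.
move=> n0; have mZ := measurable_normalized_sum n; split.
  exact: (continuous_inversion_density P (Z n) (psi n)) (integrable_psi n n0) (psi_ge n).
exact: (has_density_inversion_density P (Z n) (psi n)) (integrable_psi n n0) (psi_ge n).
Qed.

(** The bound is free of [x]: the point enters only through the phase [a = - <t,x>], hence through
    the coefficients [cos a] and [sin a], which are at most 1 in modulus. *)
Lemma dist_density_normal_le n x : (0 < n)%N ->
  ((`|inversion_density P (Z n) x - normal_density x|)%:E <=
   (((2 * pi) ^+ d)^-1)%:E * \int[lebesgue_rV d]_t (cf_diff P X n t)%:E)%E.
Proof.
move=> n0; have mZ := measurable_normalized_sum n.
have c0 : 0 <= ((2 * pi : R) ^+ d)^-1.
  by rewrite invr_ge0 exprn_ge0// mulr_ge0// pi_ge0.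
have mdot : measurable_fun setT (fun t => - dotrV t x).
  apply: measurableT_comp => //; apply: measurable_fun_dotrV => //; exact: measurable_id.
have icos := integrable_cosM_gaussV _ mdot.
have iZ : (lebesgue_rV d).-integrable setT
    (EFin \o (fun t => cosE P 0 (fun w => Z n w - x) t)).
  apply: (le_integrable_EFin _ _ _ _ (psi n)) => //.
  - by apply: measurable_cosE; exact: measurable_fun_subV.
  - by move=> t _; rewrite cosE_shift.
  - exact: integrable_psi.
have iD := integrableB measurableT iZ icos.
rewrite normal_densityE /inversion_density -mulrBr normrM ger0_norm// -RintegralB//.
rewrite EFinM; apply: lee_wpmul2l; first by rewrite lee_fin.
rewrite EFin_normr_Rintegral//; apply: le_trans (le_abse_integral _ _ _) _ => //.
  by have /integrableP[] := iD.
apply: ge0_le_integral => //.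
- by apply: measurableT_comp => //; have /integrableP[] := iD.
- by apply/measurable_EFinP; exact: measurable_cf_diff.
move=> t _; rewrite lee_fin cosE_shift cosE_normalized_sum cosE_phase//.
set a := - dotrV t x; set B1 := cosE P 0 X _; set B2 := cosE P _ X _; set c := cos_prod _ ^+ n.
rewrite (_ : _ - _ = cos a * (B1 * c - gaussV t) - sin a * (B2 * c)); last by ring.
apply: le_trans (ler_normB _ _) _; rewrite /cf_diff -/B1 -/B2 -normrX -/c -normrM !(normrM (_ a)).
by apply: lerD; rewrite ler_piMl// ?cos_max ?sin_max.
Qed.

End normalized_sums.

Theorem theorem3p1 (R : realType) (d : nat) (hd : (0 < d)%N)
    (dO : measure_display) (Omega : measurableType dO) (P : probability Omega R)
    (X : {RV P >-> 'rV[R]_d}) (xi : nat -> {RV P >-> 'rV[R]_d})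
    (hxi_indep : mutually_independent xi)
    (hxi_unif : forall k, uniform_on_cube (xi k))
    (hX_indep : independent_of_sequence X xi)
    (hX_mean : ('E_P[fun w => enorm (X w)] < +oo)%E)
    (hf_int : (\int[lebesgue_rV d]_t
        (cenorm (cgradient (charfun X) t) / dist_pi_lattice t ^+ d.-1)%:E
          < +oo)%E)
    (hf_lattice : forall k : 'rV[int]_d, k != 0 ->
        charfun X (pi *: map_mx intr k) = 0) :
  exists p : nat -> 'rV[R]_d -> R,
    (forall n, (0 < n)%N ->
        continuous (p n) /\ has_density P (normalized_sum X xi n) (p n)) /\
    (ereal_sup [set `|p n x - normal_density x|%:E | x in [set: 'rV[R]_d]]
        @[n --> \oo] --> 0%E).
Proof.
have mX : measurable_fun setT X by exact: measurable_funPT.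
have iX := integrable_enorm P X hX_mean.
have hlat (k : 'rV[int]_d) : k != 0 ->
    cosE P 0 X (lat k) = 0 /\ cosE P (- (pi / 2)) X (lat k) = 0.
  (* A complex zero of [f] is a common zero of the cosine transforms with phases 0 and [- pi/2]. *)
  by move=> k0; rewrite -Re_charfunE -Im_charfunE /lat hf_lattice.
have igrad : (lebesgue_rV d).-integrable setT
    (EFin \o (fun t => grad_norm P X t / dist_pi_lattice t ^+ d.-1)).
  apply/integrableP; split.
    apply/measurable_EFinP; apply: measurable_funM; first exact: measurable_grad_norm.
    by apply: measurable_funV; apply: measurable_funX; exact: measurable_dist_pi_lattice.
  under eq_integral => t _.
    rewrite gee0_abs ?lee_fin ?grad_weight_ge0//= -cenorm_gradE//.
    over.
  exact: hf_int.
have isize := integrable_char_size P X mX iX hlat hd igrad.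
exists (fun n => inversion_density P (normalized_sum X xi n)); split.
  by move=> n n0; exact: density_normalized_sum.
pose c : R := ((2 * pi) ^+ d)^-1.
have c0 : 0 <= c by rewrite invr_ge0 exprn_ge0// mulr_ge0// pi_ge0.
pose S n := ereal_sup [set `|inversion_density P (normalized_sum X xi n) x -
  normal_density x|%:E | x in [set: 'rV[R]_d]].
(* The estimates hold for positive [n] only, so the limit is taken along [n.+1]. *)
suff SS : (fun n => S n.+1) @ \oo --> (0%E : \bar R).
  by have E := cvg_shiftS S (nbhs (0%E : \bar R)); rewrite E in SS; exact: SS.
pose T n := ((Num.sqrt n%:R ^+ d)%:E *
  \int[lebesgue_rV d]_t (char_size_out P X t * `|cos_prod t| ^+ n)%:E)%E.
pose I n := (\int[lebesgue_rV d]_t (cf_diff_in P X n t)%:E)%E.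
apply: (squeeze_cvge (f := cst 0%E)
  (h := fun n => (c%:E * (I n.+1 + T n.+1))%E)).
- near=> n; rewrite /=; apply/andP; split.
    apply: ereal_sup_ge; exists (`|inversion_density P (normalized_sum X xi n.+1)
      (0 : 'rV[R]_d) - normal_density (0 : 'rV[R]_d)|%:E); last by rewrite lee_fin.
    by exists 0.
  apply: ge_ereal_sup => _ [x _ <-].
  apply: le_trans (dist_density_normal_le P X xi hxi_indep hxi_unif hX_indep isize n.+1 x _) _ => //.
  apply: lee_wpmul2l; first by rewrite lee_fin.
  rewrite /I /T -integral_cf_tail// -ge0_integralD//; first last.
  - by apply/measurable_EFinP; exact: measurable_cf_tail.
  - by move=> t _; rewrite lee_fin cf_tail_ge0.
  - by apply/measurable_EFinP; exact: measurable_cf_diff_in.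
  - by move=> t _; rewrite lee_fin cf_diff_in_ge0.
  apply: ge0_le_integral => //.
  - by move=> t _; rewrite lee_fin cf_diff_ge0.
  - by apply/measurable_EFinP; exact: measurable_cf_diff.
  - apply: emeasurable_funD; apply/measurable_EFinP.
      exact: measurable_cf_diff_in.
    exact: measurable_cf_tail.
  - by move=> t _; rewrite -EFinD lee_fin cf_diff_split.
- exact: cvg_cst.
- have cI : (fun n => I n.+1) @ \oo --> (0%E : \bar R) by exact: cvg_integral_cf_diff_in.
  have cT : (fun n => T n.+1) @ \oo --> (0%E : \bar R).
    have E := cvg_shiftS T (nbhs (0%E : \bar R)); rewrite E.
    exact: (cvg_char_size_tail P X mX iX hlat hd igrad).
  have cIT : (fun n => I n.+1 + T n.+1)%E @ \oo --> (0 + 0 : \bar R)%E by exact: cvgeD.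
  rewrite adde0 in cIT.
  have H : (fun n => c%:E * (I n.+1 + T n.+1))%E @ \oo --> (c%:E * 0)%E by exact: cvgeZl.
  by rewrite mule0 in H.
Unshelve. all: by end_near. Qed.
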